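(* Let $0<2\alpha<\beta\le 1$. Then for every $p>\max\{p(\alpha,\beta),1\}$ the weak $*$-topology on the space of Borel probability measures on $X$ is generated by the metric $$\rho_{\alpha,\beta,p}(\varphi,\psi):=\sup\{|\varphi(f)-\psi(f)| : f\in \text{H\''ol}_\beta(X,d),\ \|\mathrm{cl}([\Delta_\alpha,\mathrm m_f])\|_{\mathcal S_p}\le 1\}.$$ In particular, there are uniform constants $0<c(\alpha,\beta,p)<C(\alpha,\beta,p)$ such that for all $x,y\in X$ the distance of the Dirac masses $\delta_x,\delta_y$ satisfies $$c(\alpha,\beta,p)\,d(x,y)^{\beta}\le \rho_{\alpha,\beta,p}(\delta_x,\delta_y)\le C(\alpha,\beta,p)\,d(x,y)^{2\alpha}.$$ The constant $c(\alpha,\beta,p)$ is bounded with respect to $p$, whereas $C(\alpha,\beta,p)\to\infty$ as $p\to\infty$.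
   Context: $(X,d)$ is a compact metric space and $\mu$ is a finite Borel measure on $X$ that is Ahlfors $d_f$-regular for some $d_f>0$: there is $C\ge 1$ with $C^{-1}r^{d_f}\le \mu(\overline B(x,r))\le Cr^{d_f}$ for all $x\in X$ and $0\le r<\operatorname{diam}X$. All function spaces are complex. For $0<\beta\le1$, $\text{H\''ol}_\beta(X,d)$ is the $*$-algebra of $\beta$-H\''older continuous functions $f:X\to\mathbb C$. $L^2=L^2(X,\mu)$ and $\mathrm m_f$ is the operator of multiplication by $f$ on $L^2$. Fractional Dirichlet Laplacian: for $0<\alpha<1$ let $\mathcal H_\alpha=\{f\in L^2:\int_X\int_X\frac{|f(x)-f(y)|^2}{d(x,y)^{d_f+2\alpha}}d\mu(y)d\mu(x)<\infty\}$ and $\mathcal E_\alpha(f,g)=\frac12\int_X\int_X\frac{\overline{(f(x)-f(y))}(g(x)-g(y))}{d(x,y)^{d_f+2\alpha}}d\mu(y)d\mu(x)$ for $f,g\in\mathcal H_\alpha$ (integrals taken off the diagonal). This is a densely defined closed form, and $\Delta_\alpha$ is the associated positive self-adjoint operator: $\operatorname{Dom}\Delta_\alpha^{1/2}=\mathcal H_\alpha$, $\mathcal E_\alpha(f,g)=\langle\Delta_\alpha^{1/2}f,\Delta_\alpha^{1/2}g\rangle_{L^2}$. For $0<2\alpha<\beta\le1$ and $f\in\text{H\''ol}_\beta(X,d)$, $\mathrm m_f$ preserves $\operatorname{Dom}\Delta_\alpha$ and $\mathrm{cl}([\Delta_\alpha,\mathrm m_f])$ denotes the bounded extension to $L^2$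 of the commutator $[\Delta_\alpha,\mathrm m_f]:\operatorname{Dom}\Delta_\alpha\to L^2$. For $p\ge1$, $\mathcal S_p$ is the Schatten $p$-ideal of compact operators on $L^2$ whose singular value sequence lies in $\ell^p$, with norm $\|T\|_{\mathcal S_p}=\|(s_n(T))_n\|_{\ell^p}$. $p(\alpha,\beta):=\ell\, d_f/(\beta-2\alpha)$, where $\ell=1$ if $d_f/(\beta-2\alpha)\ge2$, and $\ell=\lceil d_f/\beta\rceil+1$ otherwise. A probability measure $\varphi$ is identified with the state $\varphi(f)=\int f\,d\varphi$ on $C(X)$. *)

(* Defs.v *)
From HB Require Import structures.
From mathcomp Require Import all_boot all_order all_algebra.
From mathcomp Require Import generic_quotient ring_quotient.
From mathcomp Require Import all_classical all_reals all_analysis.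
From mathcomp Require Import complex.

Set Implicit Arguments.
Unset Strict Implicit.
Unset Printing Implicit Defensive.

Import Order.TTheory GRing.Theory Num.Theory.
Import numFieldTopology.Exports numFieldNormedType.Exports.

Local Open Scope classical_set_scope.
Local Open Scope complex_scope.
Local Open Scope ring_scope.

Notation cmod := Normc.normc.

Definition cintegral d (T : measurableType d) (R : realType)
    (mu : {measure set T -> \bar R}) (D : set T) (f : T -> R[i]) : R[i] :=
  Rintegral mu D (fun x => complex.Re (f x))
    +i* Rintegral mu D (fun x => complex.Im (f x)).

Section L2.
Context d (T : measurableType d) (R : realType).
Variable mu : {measure set T -> \bar R}.

(* As [|f|^2 = (Re f)^2 + (Im f)^2], a complex function is square-integrable
   iff its real and imaginary parts are. *)
Definition sqint : {pred T -> R[i]} := fun f =>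
  ((fun x => complex.Re (f x)) \in Lfun mu 2%:E) &&
  ((fun x => complex.Im (f x)) \in Lfun mu 2%:E).

Lemma sqint_submod_closed : submod_closed sqint.
Proof.
have p12 : (1 <= 2%:E :> \bar R)%E by rewrite lee_fin ler1n.
have [L0 LZD] := Lfun_submod_closed mu p12.
have LZ a f : f \in Lfun mu 2%:E -> a *: f \in Lfun mu 2%:E.
  by move=> fL; rewrite -[_ *: _]addr0; exact: LZD.
have LD f g : f \in Lfun mu 2%:E -> g \in Lfun mu 2%:E ->
    f + g \in Lfun mu 2%:E.
  by move=> fL gL; rewrite -[f]scale1r; exact: LZD.
split; first by apply/andP; split; exact: L0.
move=> [a b] f g /andP[fr fi] /andP[gr gi]; apply/andP; split.
- rewrite [X in X \in _](_ : _ =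
      a *: (fun x => complex.Re (f x)) + (- b) *: (fun x => complex.Im (f x))
      + (fun x => complex.Re (g x))).
    by apply: (LD) => //; apply: (LD); apply: (LZ).
  apply/funext => x; rewrite !fctE /=.
  by case: (f x) => u v; case: (g x) => u' v' /=; rewrite /GRing.scale/= mulNr.
- rewrite [X in X \in _](_ : _ =
      a *: (fun x => complex.Im (f x)) + b *: (fun x => complex.Re (f x))
      + (fun x => complex.Im (g x))).
    by apply: (LD) => //; apply: (LD); apply: (LZ).
  apply/funext => x; rewrite !fctE /=.
  by case: (f x) => u v; case: (g x) => u' v' /=; rewrite /GRing.scale/=.
Qed.

HB.instance Definition _ :=
  GRing.isSubmodClosed.Build _ _ sqint sqint_submod_closed.

Record sqfun := Sqfun { sqfun_val :> T -> R[i] ; _ : sqfun_val \in sqint }.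

HB.instance Definition _ := [isSub for sqfun_val].
HB.instance Definition _ := [Choice of sqfun by <:].
HB.instance Definition _ := [SubChoice_isSubLmodule of sqfun by <:].

Definition aenull : {pred sqfun} :=
  fun f => `[< {ae mu, forall x, (f : T -> R[i]) x = 0} >].

Lemma aenull_zmod_closed : zmod_closed aenull.
Proof.
split; first by apply/asboolP; exact: aeW.
move=> f g /asboolP f0 /asboolP g0; apply/asboolP.
by apply: filterS2 f0 g0 => x /= f0 g0; rewrite !fctE f0 g0 subrr.
Qed.

HB.instance Definition _ := GRing.isZmodClosed.Build _ aenull aenull_zmod_closed.

Lemma aenullZ a (f : sqfun) : f \in aenull -> a *: f \in aenull.
Proof.
move=> /asboolP f0; apply/asboolP.
by apply: filterS f0 => x /= f0; rewrite !fctE f0 scaler0.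
Qed.

Definition L2 : Type := Quotient.quot aenull.
HB.instance Definition _ := GRing.Zmodule.on L2.

Definition L2_of (f : sqfun) : L2 := (\pi_(Quotient.quot aenull) f)%qT.
(* An arbitrary representative of the class [u]. *)
Definition L2_repr (u : L2) : T -> R[i] := repr (u : Quotient.quot aenull).
Definition L2_scale (a : R[i]) (u : L2) : L2 :=
  L2_of (a *: repr (u : Quotient.quot aenull)).

Lemma L2_ofD f g : L2_of (f + g) = L2_of f + L2_of g.
Proof. exact: (@Quotient.pi_add sqfun aenull f g). Qed.

Lemma L2_of_eq f g : f - g \in aenull -> L2_of f = L2_of g.
Proof. by rewrite Quotient.idealrBE => /eqP. Qed.

Lemma L2_reprK (u : L2) : L2_of (repr (u : Quotient.quot aenull)) = u.
Proof. exact: reprK. Qed.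

Lemma L2_repr_of f : repr (L2_of f : Quotient.quot aenull) - f \in aenull.
Proof. by rewrite Quotient.idealrBE; apply/eqP; exact: L2_reprK. Qed.

Lemma L2_scale_of a f : L2_scale a (L2_of f) = L2_of (a *: f).
Proof. by apply: L2_of_eq; rewrite -scalerBr; apply/aenullZ/L2_repr_of. Qed.

Lemma L2_scalerA a b (u : L2) : L2_scale a (L2_scale b u) = L2_scale (a * b) u.
Proof. by rewrite -[u]L2_reprK !L2_scale_of scalerA. Qed.

Lemma L2_scale1r : left_id 1 L2_scale.
Proof. by move=> u; rewrite -[u]L2_reprK L2_scale_of scale1r. Qed.

Lemma L2_scalerDr : right_distributive L2_scale +%R.
Proof.
move=> a u v; rewrite -[u]L2_reprK -[v]L2_reprK.
by rewrite -L2_ofD !L2_scale_of scalerDr L2_ofD.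
Qed.

Lemma L2_scalerDl u : {morph L2_scale^~ u : a b / a + b}.
Proof.
move=> a b; rewrite -[u]L2_reprK.
by rewrite !L2_scale_of scalerDl L2_ofD.
Qed.

HB.instance Definition _ := GRing.Zmodule_isLmodule.Build R[i] L2
  L2_scalerA L2_scale1r L2_scalerDr L2_scalerDl.

Definition L2_ip (u v : L2) : R[i] :=
  cintegral mu setT (fun x => (L2_repr u x)^* * L2_repr v x).

(* The class of [g], or [0] if [g] is not square-integrable. *)
Definition L2_class (g : T -> R[i]) : L2 := oapp L2_of 0 (insub g).

Definition L2_mult (f : T -> R[i]) (u : L2) : L2 :=
  L2_class (fun x => f x * L2_repr u x).

End L2.

Section Operators.
Context (R : realType) (H : lmodType R[i]) (ip : H -> H -> R[i]).

Definition ip_norm (u : H) : R := Num.sqrt (complex.Re (ip u u)).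

(* An unbounded operator; the values of [opfun] outside [dom] are
   irrelevant. *)
Record unbounded := Unbounded { dom : set H ; opfun :> H -> H }.

Definition linear_on_dom (A : unbounded) :=
  dom A 0 /\
  forall a u v, dom A u -> dom A v ->
    dom A (a *: u + v) /\ A (a *: u + v) = a *: A u + A v.

Definition dense_dom (A : unbounded) :=
  forall u e, 0 < e -> exists2 v, dom A v & ip_norm (u - v) < e.

(* [(u, v)] lies in the graph of the adjoint of [A]. *)
Definition adjoint_graph (D : set H) (A : H -> H) (u v : H) :=
  forall w, D w -> ip (A w) u = ip w v.

Definition selfadjoint (A : unbounded) :=
  [/\ linear_on_dom A, dense_dom A &
      forall u v, adjoint_graph (dom A) A u v <-> dom A u /\ A u = v].

Definition positive_selfadjoint (A : unbounded) :=
  selfadjoint A /\ forall u, dom A u -> 0 <= ip u (A u).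

Definition is_square (S A : unbounded) :=
  (forall u, dom A u <-> dom S u /\ dom S (S u)) /\
  (forall u, dom A u -> A u = S (S u)).

Definition bounded_op (K : H -> H) :=
  exists M : R, forall u, ip_norm (K u) <= M * ip_norm u.

Definition compact_op (K : H -> H) :=
  forall u : nat -> H, (exists M : R, forall n, ip_norm (u n) <= M) ->
  exists (k : nat -> nat) (v : H),
    {homo k : m n / (m < n)%N} /\
    (fun n => ip_norm (K (u (k n)) - v)) @ \oo --> (0 : R).

Definition has_dim (E : set H) (n : nat) :=
  exists b : 'I_n -> H,
    (forall a : 'I_n -> R[i], \sum_i a i *: b i = 0 -> forall i, a i = 0) /\
    (forall u, E u <-> exists a : 'I_n -> R[i], u = \sum_i a i *: b i).

(* [s] lists the singular values of [K], i.e. the square roots of the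
   eigenvalues of [K^* K] in nonincreasing order, each positive one being
   repeated according to its multiplicity. The equation
   [K^* (K u) = t ^+ 2 *: u] is written with the graph of [K^*]. *)
Definition singular_values (K : H -> H) (s : nat -> R) :=
  [/\ forall n, 0 <= s n,
      {homo s : m n / (m <= n)%N >-> n <= m},
      s @ \oo --> (0 : R) &
      forall t : R, 0 < t -> exists2 n : nat,
        ([set k | s k = t] #= `I_n)%card &
        has_dim [set u | adjoint_graph setT K (K u) ((t ^+ 2)%:C *: u)] n].

(* The l^p-norm of the singular values if [K] is compact, and [+oo] (the
   infimum of the empty set) otherwise. *)
Definition schatten_norm (p : R) (K : H -> H) : \bar R :=
  ereal_inf [set ('N[counting]_(p%:E)[EFin \o s])%E
            | s in [set s | compact_op K /\ singular_values K s]].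

End Operators.

(* The library's measurable types, hence [borel X] below, are pointed. *)
#[short(type="pmetricType")]
HB.structure Definition PMetric (K : numDomainType) :=
  { M of Pointed M & Metric K M }.

Notation borel X := (g_sigma_algebraType (@open X)).

Section MetricMeasure.
Context (R : realType) (X : pmetricType R).

(* The closed ball, which may be larger than the closure of the open one. *)
Definition cball (x : X) (r : R) : set (borel X) := [set y | mdist x y <= r].

Definition diam : R := sup [set mdist xy.1 xy.2 | xy in [set: X * X]].

Definition ahlfors_regular (mu : set (borel X) -> \bar R) (df : R) :=
  exists2 K : R, 1 <= K & forall (x : X) (r : R), 0 <= r < diam ->
    ((K^-1 * r `^ df)%:E <= mu (cball x r) <= (K * r `^ df)%:E)%E.

Definition hoelder_fun (b : R) (f : X -> R[i]) :=
  exists K : R, forall x y, cmod (f x - f y) <= K * mdist x y `^ b.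

Section FractionalLaplacian.
Variables (mu : {finite_measure set (borel X) -> \bar R}) (df a : R).

Definition frac_dom : set (L2 mu) := [set f |
  (\int[mu]_(x in [set: borel X]) \int[mu]_(y in ~` [set x])
     (cmod (L2_repr f x - L2_repr f y) ^+ 2
        / mdist (x : X) y `^ (df + 2 * a))%:E < +oo)%E].

Definition frac_form (f g : L2 mu) : R[i] :=
  2^-1 * cintegral mu [set: borel X] (fun x =>
    cintegral mu (~` [set x]) (fun y =>
      (L2_repr f x - L2_repr f y)^* * (L2_repr g x - L2_repr g y)
        / (mdist (x : X) y `^ (df + 2 * a))%:C)).

(* [Delta] is the positive self-adjoint operator whose positive square root
   [S] has domain [frac_dom] and represents [frac_form]. *)
Definition frac_laplacian (Delta : unbounded (L2 mu)) :=
  positive_selfadjoint (@L2_ip _ _ _ mu) Delta /\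
  exists S : unbounded (L2 mu),
    [/\ positive_selfadjoint (@L2_ip _ _ _ mu) S, is_square S Delta,
        dom S = frac_dom &
        forall f g, frac_dom f -> frac_dom g ->
          frac_form f g = L2_ip (S f) (S g)].

End FractionalLaplacian.

Section Metric.
Variables (mu : {finite_measure set (borel X) -> \bar R}).
Variables (Delta : unbounded (L2 mu)) (b p : R).

(* [K] is the bounded extension to [L2 mu] of the commutator of [Delta] and
   the multiplication by [f]. *)
Definition commutator_cl (f : borel X -> R[i])
    (K : {linear L2 mu -> L2 mu}) :=
  bounded_op (@L2_ip _ _ _ mu) K /\
  forall u, dom Delta u -> dom Delta (L2_mult f u) /\
    K u = Delta (L2_mult f u) - L2_mult f (Delta u).

(* Extended-real-valued, since the supremum of an unbounded set of reals is
   a dummy value; [is_metric] below includes finiteness. *)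
Definition rho (phi psi : probability (borel X) R) : \bar R :=
  ereal_sup [set (cmod (cintegral phi setT f - cintegral psi setT f))%:E
            | f in [set f : borel X -> R[i] | hoelder_fun b f /\
                exists2 K, commutator_cl f K &
                  (schatten_norm (@L2_ip _ _ _ mu) p K <= 1)%E]].

End Metric.

(* The weak-* topology of the dual of the complex-valued continuous
   functions. *)
Definition weak_star : topologicalType :=
  initial_topology (fun phi : probability (borel X) R =>
    (fun f : continuousType X (R[i]^o) => cintegral phi [set: borel X] f)
    : {ptws continuousType X (R[i]^o) -> R[i]^o}).

(* A probability measure is a function on all sets, so equality of two
   measures is taken on Borel sets only. *)
Definition is_metric (r : probability (borel X) R -> probability (borel X) R
    -> \bar R) :=
  [/\ forall phi psi, r phi psi \is a fin_num,
      forall phi psi, r phi psi = 0%E <->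
        (forall A, measurable A -> phi A = psi A),
      forall phi psi, r phi psi = r psi phi &
      forall phi psi chi, (r phi chi <= r phi psi + r psi chi)%E].

Definition generates_weak_star (r : probability (borel X) R ->
    probability (borel X) R -> \bar R) :=
  is_metric r /\
  forall U : set (probability (borel X) R), @open weak_star U <->
    forall phi, U phi -> exists2 e : R, 0 < e &
      [set psi | (r phi psi < e%:E)%E] `<=` U.

End MetricMeasure.

Definition critical_exponent (R : realType) (df a b : R) : R :=
  (if 2 <= df / (b - 2 * a) then 1 else (Num.ceil (df / b))%:~R + 1)
  * df / (b - 2 * a).

(* Main.v *)
(* Polarising the form of [Delta] and using that [Delta^(1/2)] is
   self-adjoint identifies the closure of the commutator with the integral
   operator of kernel [k(x, y) = (f x - f y) / d(x, y) ^ (df + 2 alpha)],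
   which the Schur test bounds as soon as [f] is Hoelder of exponent
   [beta > 2 alpha].

   Smallness of singular values. On a net of mesh [r], of cardinality [n] of
   order [r ^ (- df)], replace [y] by the nearest net point wherever
   [d(x, y)] is large compared with [r]. This kernel has rank [n], and the
   Schur test bounds the norm of the difference by a multiple of
   [L r ^ (beta - 2 alpha)], where [L] is the Hoelder constant of [f]. Hence
   [s_n <= C L (n + 1) ^ (- (beta - 2 alpha) / df)], which is summable to
   the power [p > df / (beta - 2 alpha)]: every [f] with [L] small enough is
   admissible, and this gives the lower bound on [rho].

   Equicontinuity. The operator norm is at most the Schatten norm. Testing
   the commutator on the indicators of two balls of radius proportional to
   [d(x, y)] gives [|f x - f y| <= C d(x, y) ^ (2 alpha)] for every
   admissible [f], with [C] independent of [p].

   The weak-* topology follows from the two inclusions: an equicontinuous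
   family is, up to [e] and additive constants, determined by finitely many
   continuous functions through a partition of unity, and conversely
   continuous functions are approximated by multiples of small Hoelder
   functions. Since [C] is only an upper bound it may be enlarged by [|p|]
   to make it tend to infinity. *)
Require Import Defs.
From HB Require Import structures.
From mathcomp Require Import all_boot all_order all_algebra.
From mathcomp Require Import all_classical all_reals all_analysis.
From mathcomp Require Import complex.
From mathcomp Require Import measurable_realfun.
From mathcomp Require Import ring lra.
Import Order.TTheory GRing.Theory Num.Theory.
Import numFieldTopology.Exports numFieldNormedType.Exports.
Local Open Scope classical_set_scope.
Local Open Scope ring_scope.
Set Implicit Arguments.
Unset Strict Implicit.
Unset Printing Implicit Defensive.

(** * Complex numbers *)

Section ComplexParts.
Context (R : realType).
Implicit Types x y : R[i].

Lemma ReD x y : complex.Re (x + y) = complex.Re x + complex.Re y.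
Proof. by case: x; case: y. Qed.

Lemma ImD x y : complex.Im (x + y) = complex.Im x + complex.Im y.
Proof. by case: x; case: y. Qed.

Lemma ReN x : complex.Re (- x) = - complex.Re x.
Proof. by case: x. Qed.

Lemma ImN x : complex.Im (- x) = - complex.Im x.
Proof. by case: x. Qed.

Lemma ReM x y : complex.Re (x * y) =
  complex.Re x * complex.Re y - complex.Im x * complex.Im y.
Proof. by case: x; case: y. Qed.

Lemma ImM x y : complex.Im (x * y) =
  complex.Re x * complex.Im y + complex.Im x * complex.Re y.
Proof. by case: x; case: y. Qed.

Lemma ReJ x : complex.Re x^*%C = complex.Re x.
Proof. by case: x. Qed.

Lemma ImJ x : complex.Im x^*%C = - complex.Im x.
Proof. by case: x. Qed.

Lemma complex_eqP x y :
  complex.Re x = complex.Re y -> complex.Im x = complex.Im y -> x = y.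
Proof. by case: x; case: y => ? ? ? ? /= -> ->. Qed.

Lemma ReMr (a : R) x : complex.Re (a%:C%C * x) = a * complex.Re x.
Proof. by rewrite ReM /= mul0r subr0. Qed.

Lemma sqr_cmod x : cmod x ^+ 2 = complex.Re x ^+ 2 + complex.Im x ^+ 2.
Proof. by case: x => a b /=; rewrite sqr_sqrtr // addr_ge0 ?sqr_ge0. Qed.

Lemma cmod_ge0 x : 0 <= cmod x.
Proof. by case: x => a b; exact: sqrtr_ge0. Qed.

Lemma cmodC (a : R) : cmod a%:C%C = `|a|.
Proof. by rewrite /= expr0n addr0 sqrtr_sqr. Qed.

Lemma cmodJ x : cmod x^*%C = cmod x.
Proof. by case: x => a b /=; rewrite sqrrN. Qed.

Lemma cmodM x y : cmod (x * y) = cmod x * cmod y.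
Proof. exact: Normc.normcM. Qed.

Lemma cmodD x y : cmod (x + y) <= cmod x + cmod y.
Proof. exact: le_normcD. Qed.

Lemma cmodN x : cmod (- x) = cmod x.
Proof. exact: normcN. Qed.

Lemma cmod0 : cmod (0 : R[i]) = 0.
Proof. by rewrite /= expr0n/= addr0 sqrtr0. Qed.

Lemma cmod_eq0 x : cmod x = 0 -> x = 0.
Proof. exact: Normc.eq0_normc. Qed.

Lemma cmodB x y : cmod (x - y) = cmod (y - x).
Proof. by rewrite -cmodN opprB. Qed.

Lemma Re_le_cmod x : `|complex.Re x| <= cmod x.
Proof.
rewrite -ler_sqr ?nnegrE ?cmod_ge0// sqr_cmod real_normK ?num_real//.
by rewrite lerDl sqr_ge0.
Qed.

Lemma Im_le_cmod x : `|complex.Im x| <= cmod x.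
Proof.
rewrite -ler_sqr ?nnegrE ?cmod_ge0// sqr_cmod real_normK ?num_real//.
by rewrite lerDr sqr_ge0.
Qed.

Lemma cmod_le_ReIm x : cmod x <= `|complex.Re x| + `|complex.Im x|.
Proof.
rewrite -ler_sqr ?nnegrE ?cmod_ge0 ?addr_ge0// sqr_cmod sqrrD.
rewrite !real_normK ?num_real// -addrA lerD2l lerDr.
by rewrite mulrn_wge0 // mulr_ge0.
Qed.

Lemma mulJc x : x^*%C * x = (cmod x ^+ 2)%:C%C.
Proof.
apply: complex_eqP; rewrite ?ReM ?ImM ReJ ImJ /= ?sqr_cmod; last by lra.
by rewrite !expr2 mulNr opprK.
Qed.

Lemma cmod_sum n (F : 'I_n -> R[i]) : cmod (\sum_i F i) <= \sum_i cmod (F i).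
Proof.
elim/big_ind2 : _ => [|x a y b xa yb|//]; first by rewrite cmod0.
by rewrite (le_trans (cmodD _ _))// lerD.
Qed.

Lemma cmod_phase x : exists2 t : R[i], cmod t = 1 & t * x = (cmod x)%:C%C.
Proof.
have [->|x0] := eqVneq x 0; first by exists 1;
  rewrite ?mulr0 ?Normc.normc1 ?cmod0.
have c0 : cmod x != 0 by apply: contra x0 => /eqP/cmod_eq0 ->.
exists (x^*%C * ((cmod x)^-1)%:C%C).
  by rewrite cmodM cmodJ cmodC ger0_norm ?invr_ge0 ?cmod_ge0// divff.
by rewrite mulrAC mulJc -rmorphM/= expr2 mulfK.
Qed.

End ComplexParts.

(** * Compact operators on a complex inner product space *)

Section InnerProduct.
Context (R : realType) (H : lmodType R[i]) (ip : H -> H -> R[i]).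

Definition is_inner_product :=
  [/\ forall w a u v, ip w (a *: u + v) = a * ip w u + ip w v,
      forall u v, ip u v = (ip v u)^*%C,
      forall u, 0 <= complex.Re (ip u u) &
      forall u, complex.Re (ip u u) = 0 -> u = 0].

Hypothesis ipP : is_inner_product.
Let re u v := complex.Re (ip u v).
Let N u := ip_norm ip u.

Let ipL w a u v : ip w (a *: u + v) = a * ip w u + ip w v.
Proof. by case: ipP => + _ _ _; apply. Qed.

Lemma ipC u v : ip u v = (ip v u)^*%C.
Proof. by case: ipP. Qed.

Lemma ipDr w u v : ip w (u + v) = ip w u + ip w v.
Proof. by rewrite -[u]scale1r ipL mul1r scale1r. Qed.

Lemma ip0r w : ip w 0 = 0.
Proof. by apply: (addrI (ip w 0)); rewrite -ipDr !addr0. Qed.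

Lemma ipZr w a u : ip w (a *: u) = a * ip w u.
Proof. by rewrite -[a *: u]addr0 ipL ip0r addr0. Qed.

Lemma ipNr w u : ip w (- u) = - ip w u.
Proof. by rewrite -scaleN1r ipZr mulN1r. Qed.

Lemma ipBr w u v : ip w (u - v) = ip w u - ip w v.
Proof. by rewrite ipDr ipNr. Qed.

Lemma ipDl w u v : ip (u + v) w = ip u w + ip v w.
Proof. by rewrite ipC ipDr rmorphD/= -!ipC. Qed.

Lemma ip0l w : ip 0 w = 0.
Proof. by rewrite ipC ip0r conjc0. Qed.

Lemma ipZl w a u : ip (a *: u) w = a^*%C * ip u w.
Proof. by rewrite ipC ipZr rmorphM/= -ipC. Qed.

Lemma ip_sumr w n (c : 'I_n -> R[i]) (e : 'I_n -> H) :
  ip w (\sum_i c i *: e i) = \sum_i c i * ip w (e i).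
Proof.
elim/big_rec2 : _ => [|i x y _ <-]; first exact: ip0r.
by rewrite ipDr ipZr.
Qed.

Lemma ip_suml w n (c : 'I_n -> R[i]) (e : 'I_n -> H) :
  ip (\sum_i c i *: e i) w = \sum_i (c i)^*%C * ip (e i) w.
Proof.
rewrite ipC ip_sumr rmorph_sum/=; apply: eq_bigr => i _.
by rewrite rmorphM/= -ipC.
Qed.

Lemma ip_norm_ge0 u : 0 <= N u. Proof. exact: sqrtr_ge0. Qed.

Lemma ip_norm_sqr u : N u ^+ 2 = re u u.
Proof. by rewrite sqr_sqrtr //; case: ipP. Qed.

Lemma ip_normE u : ip u u = (N u ^+ 2)%:C%C.
Proof.
apply: complex_eqP => /=; first by rewrite ip_norm_sqr.
by have := congr1 (@complex.Im R) (ipC u u); rewrite ImJ; lra.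
Qed.

Lemma ip_norm0 : N 0 = 0.
Proof. by rewrite /N /ip_norm ip0r sqrtr0. Qed.

Lemma ip_norm_eq0 u : N u = 0 -> u = 0.
Proof.
move=> Nu; case: ipP => _ _ _; apply.
by rewrite -[LHS]ip_norm_sqr Nu expr0n.
Qed.

Lemma ip_normZ a u : N (a *: u) = cmod a * N u.
Proof.
apply/eqP; rewrite -(@eqrXn2 _ 2) ?mulr_ge0 ?cmod_ge0 ?ip_norm_ge0//.
rewrite exprMn !ip_norm_sqr /re ipZr ipZl mulrA [a * _]mulrC mulJc.
by rewrite ReMr.
Qed.

Lemma ip_normN u : N (- u) = N u.
Proof. by rewrite -scaleN1r ip_normZ cmodN Normc.normc1 mul1r. Qed.

Lemma ip_normB u v : N (u - v) = N (v - u).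
Proof. by rewrite -ip_normN opprB. Qed.

Lemma re_ipC u v : re u v = re v u.
Proof. by rewrite /re ipC ReJ. Qed.

Lemma ip_normD_sqr u v : N (u + v) ^+ 2 = N u ^+ 2 + 2 * re u v + N v ^+ 2.
Proof.
rewrite !ip_norm_sqr /re ipDl !ipDr !ReD -/(re _ _) -/(re u v) -/(re v u).
by rewrite (re_ipC v u); lra.
Qed.

Lemma re_ip_le u v : re u v <= N u * N v.
Proof.
have [u0|u0] := eqVneq (N u) 0.
  by rewrite (ip_norm_eq0 u0) /re ip0l ip_norm0 mul0r.
have [v0|v0] := eqVneq (N v) 0.
  by rewrite (ip_norm_eq0 v0) /re ip0r ip_norm0 mulr0.
have u0' : 0 < N u by rewrite lt_neqAle eq_sym u0 ip_norm_ge0.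
have v0' : 0 < N v by rewrite lt_neqAle eq_sym v0 ip_norm_ge0.
have := sqr_ge0 (N ((N v)%:C%C *: u + (- (N u)%:C%C) *: v)).
rewrite ip_normD_sqr !ip_normZ cmodN !cmodC !ger0_norm ?ip_norm_ge0//.
rewrite /re ipZr ipZl conjc_real mulNr ReN !ReMr -/(re u v) => h.
have : 0 <= (N u * N v) * (N u * N v - re u v) by nra.
by rewrite pmulr_rge0 ?mulr_gt0// subr_ge0.
Qed.

Lemma ip_normD u v : N (u + v) <= N u + N v.
Proof.
rewrite -ler_sqr ?nnegrE ?addr_ge0 ?ip_norm_ge0// ip_normD_sqr.
by have := re_ip_le u v; lra.
Qed.

Lemma cauchy_schwarz u v : cmod (ip u v) <= N u * N v.
Proof.
have [t t1 tE] := cmod_phase (ip u v).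
have := re_ip_le u (t *: v).
by rewrite /re ipZr tE ip_normZ t1 mul1r.
Qed.

Lemma ip_norm_sum n (F : 'I_n -> H) : N (\sum_i F i) <= \sum_i N (F i).
Proof.
elim/big_ind2 : _ => [|x a y b xa yb|//]; first by rewrite ip_norm0.
by rewrite (le_trans (ip_normD _ _))// lerD.
Qed.

Lemma ip_norm_le0 u : (forall e, 0 < e -> N u <= e) -> u = 0.
Proof.
move=> h; apply: ip_norm_eq0; apply/eqP; rewrite eq_le ip_norm_ge0 andbT.
by apply/ler_addgt0Pr => e e0; rewrite add0r h.
Qed.

Lemma ip_injl u v : (forall w, ip w u = ip w v) -> u = v.
Proof.
move=> h; apply/eqP; rewrite -subr_eq0; apply/eqP/ip_norm_eq0/eqP.
by rewrite -sqrf_eq0 ip_norm_sqr /re ipBr h subrr.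
Qed.

End InnerProduct.

Lemma bounded_op_gt0 (R : realType) (H : lmodType R[i]) (ip : H -> H -> R[i])
    (K : H -> H) : bounded_op ip K ->
  exists2 B : R, 0 < B & forall u, ip_norm ip (K u) <= B * ip_norm ip u.
Proof.
move=> [M MK]; exists (Num.max M 1); first by rewrite lt_max ltr01 orbT.
move=> u; rewrite (le_trans (MK u))// ler_wpM2r ?sqrtr_ge0//.
by rewrite le_max lexx.
Qed.

Section ApproximationNumbers.
Context (R : realType) (H : lmodType R[i]) (ip : H -> H -> R[i]).
Let N u := ip_norm ip u.

(* The [n]-th approximation number of [K] is at most [c]. *)
Definition approximable (K : H -> H) (n : nat) (c : R) :=
  exists (K' : H -> H) (q g : 'I_n -> H),
    (forall u, K u = K' u + \sum_i ip (q i) u *: g i) /\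
    (forall u, N (K' u) <= c * N u).

Lemma approximableW K n m c : (n <= m)%N ->
  approximable K n c -> approximable K m c.
Proof.
move=> /subnKC <- [K' [q [g [KE K'c]]]].
exists K', (fun i => if fintype.split i is inl j then q j else 0),
  (fun i => if fintype.split i is inl j then g j else 0); split=> // u.
rewrite big_split_ord/= [X in _ + (_ + X)]big1 ?addr0; last first.
  by move=> i _; rewrite (unsplitK (inr i)) scaler0.
rewrite KE; congr (_ + _); apply: eq_bigr => i _.
by rewrite (unsplitK (inl i)).
Qed.

End ApproximationNumbers.

Section CompactOperator.
Context (R : realType) (H : lmodType R[i]) (ip : H -> H -> R[i]).
Hypothesis ipP : is_inner_product ip.
Variables K Ks : {linear H -> H}.
Hypothesis K_adj : forall u v, ip (K u) v = ip u (Ks v).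
Hypothesis K_bounded : bounded_op ip K.
Hypothesis Ks_bounded : bounded_op ip Ks.
Let N u := ip_norm ip u.
Let T u := Ks (K u).

Let N_ge0 u : 0 <= N u. Proof. exact: ip_norm_ge0. Qed.

Let ip_K u v : ip (K u) (K v) = ip u (T v).
Proof. exact: K_adj. Qed.

Let T_sym u v : ip (T u) v = ip u (T v).
Proof. by rewrite (ipC ipP) -ip_K -(ipC ipP) ip_K. Qed.

Let N_K u : N (K u) ^+ 2 = complex.Re (ip u (T u)).
Proof. by rewrite ip_norm_sqr// ip_K. Qed.

Definition perp (l : seq H) u := forall x, x \in l -> ip x u = 0.

Definition eigen (l : seq H) := forall x, x \in l ->
  exists t : R, T x = t%:C%C *: x.

Let perp_T l u : eigen l -> perp l u -> perp l (T u).
Proof.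
move=> El lu x xl; rewrite -T_sym; have [t ->] := El x xl.
by rewrite ipZl// lu// mulr0.
Qed.

Let perpZ l a u : perp l u -> perp l (a *: u).
Proof. by move=> lu x xl; rewrite ipZr// lu// mulr0. Qed.

Definition is_top l (es : H * R) := let: (e, s) := es in
  [/\ 0 <= s, perp l e, T e = (s ^+ 2)%:C%C *: e,
      forall u, perp l u -> N (K u) <= s * N u &
      (s = 0 /\ e = 0) \/ (0 < s /\ N e = 1)].

Hypothesis K_compact : compact_op ip K.

Section Top.
Variable l : seq H.
Hypothesis El : eigen l.

Let S := [set N (K u) | u in [set u | perp l u /\ N u <= 1]].
Let s := sup S.

Let S_sup : has_sup S.
Proof.
split.
  exists (N (K 0)), 0 => //; split; last by rewrite [N _](ip_norm0 ipP).
  by move=> x _; rewrite ip0r.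
have [B B0 KB] := bounded_op_gt0 K_bounded.
exists B => _ [u [_ u1] <-]; rewrite (le_trans (KB u))//.
by rewrite -[leRHS]mulr1 ler_wpM2l// ltW.
Qed.

Let s_ge0 : 0 <= s.
Proof.
apply: le_trans (ub_le_sup S_sup.2 _); first exact: (N_ge0 (K 0)).
exists 0 => //; split; last by rewrite [N _](ip_norm0 ipP).
by move=> x _; rewrite ip0r.
Qed.

Let top_bound u : perp l u -> N (K u) <= s * N u.
Proof.
move=> lu; have [u0|u0] := eqVneq (N u) 0.
  by rewrite (ip_norm_eq0 ipP u0) linear0 [N _](ip_norm0 ipP) mulr0.
have u0' : 0 < N u by rewrite lt_neqAle eq_sym u0 N_ge0.
rewrite -ler_pdivrMr//.
suff : S (N (K u) / N u) by exact: ub_le_sup S_sup.2 _.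
exists (((N u)^-1)%:C%C *: u).
  split; first exact: perpZ.
  by rewrite [N _](ip_normZ ipP) cmodC ger0_norm ?invr_ge0// mulVf.
by rewrite linearZ/= [N _](ip_normZ ipP) cmodC ger0_norm ?invr_ge0// mulrC.
Qed.

Let T_bound u : perp l u -> N (T u) <= s ^+ 2 * N u.
Proof.
move=> lu; have [u0|u0] := eqVneq (N (T u)) 0.
  by rewrite u0 mulr_ge0 ?sqr_ge0.
have u0' : 0 < N (T u) by rewrite lt_neqAle eq_sym u0 N_ge0.
rewrite -(ler_pM2l u0') -[leLHS]expr2 [leLHS](ip_norm_sqr ipP).
rewrite -ip_K (le_trans (re_ip_le ipP _ _))//.
rewrite [leRHS](_ : _ = (s * N (T u)) * (s * N u)); last by rewrite expr2; ring.
by rewrite ler_pM ?N_ge0// top_bound//; exact: perp_T.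
Qed.

Let almost_eigen u : perp l u -> N u <= 1 ->
  N ((s ^+ 2)%:C%C *: u - T u) ^+ 2 <= 2 * s ^+ 2 * (s ^+ 2 - N (K u) ^+ 2).
Proof.
move=> lu u1; have := ip_normD_sqr ipP ((s ^+ 2)%:C%C *: u) (- T u).
rewrite -/(N _) => ->; rewrite (ip_normN ipP) (ip_normZ ipP) cmodC.
rewrite ger0_norm ?sqr_ge0// ipNr// ipZl// conjc_real ReN ReMr -N_K.
have h1 : ip_norm ip (T u) ^+ 2 <= s ^+ 2 ^+ 2.
  rewrite ler_sqr ?nnegrE ?sqr_ge0 ?N_ge0// (le_trans (T_bound lu))//.
  by rewrite -[leRHS]mulr1 ler_wpM2l// sqr_ge0.
have h2 : (s ^+ 2 * ip_norm ip u) ^+ 2 <= s ^+ 2 ^+ 2.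
  rewrite ler_sqr ?nnegrE ?mulr_ge0 ?sqr_ge0 ?N_ge0//.
  by rewrite -[leRHS]mulr1 ler_wpM2l// sqr_ge0.
by rewrite [leRHS](_ : _ =
    s ^+ 2 ^+ 2 - 2 * (s ^+ 2 * N (K u) ^+ 2) + s ^+ 2 ^+ 2);
  [lra|ring].
Qed.

Lemma top_eigenvector : exists es, is_top l es.
Proof.
have [s0|s0] := eqVneq s 0.
  exists (0, 0); split => //; rewrite ?ip0r//.
  - by move=> x _; rewrite ip0r.
  - by rewrite scaler0 /T linear0 linear0.
  - by rewrite -s0; exact: top_bound.
  - by left.
have s_gt0 : 0 < s by rewrite lt_neqAle eq_sym s0.
have /choice [u uP] (n : nat) : exists u,
    [/\ perp l u, N u <= 1 & s - n.+1%:R^-1 < N (K u)].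
  have [|_ [u [lu u1] <-] uS] := @sup_adherent _ S n.+1%:R^-1 _ S_sup.
    by rewrite invr_gt0.
  by exists u.
have [k [w [k_incr kw]]] : exists (k : nat -> nat) (v : H),
    {homo k : m n / (m < n)%N} /\
    (fun n => ip_norm ip (K (u (k n)) - v)) @ \oo --> (0 : R).
  by apply: K_compact; exists 1 => n; case: (uP n).
have k_ge n : (n <= k n)%N.
  by elim: n => // n /leq_ltn_trans; apply; exact: k_incr.
pose e := (s ^- 2)%:C%C *: Ks w.
have [Bs Bs0 KsB] := bounded_op_gt0 Ks_bounded.
have [B B0 KB] := bounded_op_gt0 K_bounded.
have approx (d : R) : 0 < d -> exists v,
    [/\ perp l v, N v <= 1, s - d < N (K v), N (v - e) <= d &
        N ((s ^+ 2)%:C%C *: v - T v) <= d].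
  move=> d0.
  pose d2 := Num.min d (d * s ^+ 2 / 2).
  have d2_gt0 : 0 < d2.
    by rewrite lt_min d0 divr_gt0// mulr_gt0// exprn_gt0.
  pose d1 := d2 / Bs.
  have d1_gt0 : 0 < d1 by rewrite divr_gt0.
  pose d3 := Num.min d (d2 ^+ 2 / (4 * s ^+ 3)).
  have d3_gt0 : 0 < d3.
    by rewrite lt_min d0 divr_gt0 ?exprn_gt0// mulr_gt0// exprn_gt0.
  have [n n1 n2] : exists2 n, N (K (u (k n)) - w) <= d1 & n.+1%:R^-1 <= d3.
    have /cvgrPdist_le /(_ d1 d1_gt0) h1 := kw.
    have /cvgrPdist_le /(_ d3 d3_gt0) h2 := @cvg_harmonic R.
    near \oo => n; exists n.
      by near: n; apply: filterS h1 => n; rewrite sub0r normrN ger0_norm ?N_ge0.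
    by near: n; apply: filterS h2 => n;
      rewrite sub0r normrN ger0_norm ?invr_ge0.
  have [lv v1 vs] := uP (k n); set v := u (k n) in n1 lv v1 vs.
  have vs3 : s - d3 < N (K v).
    apply: le_lt_trans vs; rewrite lerD2l lerN2 (le_trans _ n2)//.
    by rewrite lef_pV2 ?posrE// ler_nat ltnS.
  have Ks_s : N (K v) <= s.
    by rewrite (le_trans (top_bound lv))// -[leRHS]mulr1 ler_wpM2l// ltW.
  have d3d : d3 <= d by rewrite ge_min lexx.
  have vT : N ((s ^+ 2)%:C%C *: v - T v) <= d2.
    rewrite -ler_sqr ?nnegrE ?N_ge0 ?(ltW d2_gt0)//.
    apply: le_trans (almost_eigen lv v1) _.
    have h : s ^+ 2 - N (K v) ^+ 2 <= 2 * s * d3.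
      have -> : s ^+ 2 - N (K v) ^+ 2 = (s + N (K v)) * (s - N (K v)) by ring.
      have h1 : s + N (K v) <= 2 * s by rewrite mulr_natl mulr2n lerD2l.
      have h2 : s - N (K v) <= d3 by rewrite lerBlDr -lerBlDl ltW.
      by apply: ler_pM; rewrite ?subr_ge0// addr_ge0.
    apply: le_trans (ler_wpM2l _ h) _; first by rewrite mulr_ge0 ?sqr_ge0.
    have -> : 2 * s ^+ 2 * (2 * s * d3) = d3 * (4 * s ^+ 3) by ring.
    rewrite -ler_pdivlMr ?mulr_gt0 ?exprn_gt0//.
    by rewrite ge_min lexx orbT.
  exists v; split => //.
  - by apply: le_lt_trans vs3; rewrite lerD2l lerN2.
  - have -> : v - e = (s ^- 2)%:C%C *:
        (((s ^+ 2)%:C%C *: v - T v) + Ks (K v - w)).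
      rewrite linearB/= addrA subrK scalerBr scalerA -rmorphM/= mulVf
        ?scale1r//.
      by rewrite expf_neq0.
    rewrite [N _](ip_normZ ipP) cmodC ger0_norm ?invr_ge0 ?sqr_ge0//.
    rewrite mulrC ler_pdivrMr ?exprn_gt0//.
    apply: le_trans (ip_normD ipP _ _) _.
    have h1 : N (Ks (K v - w)) <= d2.
      by rewrite (le_trans (KsB _))// mulrC -ler_pdivlMr.
    have h2 : d2 <= d * s ^+ 2 / 2 by rewrite ge_min lexx orbT.
    by rewrite -/(N _) -/(N (Ks _)); lra.
  - by rewrite (le_trans vT)// ge_min lexx.
have small (c x : R) : 0 <= c -> (forall d : R, 0 < d -> x <= c * d) -> x <= 0.
  move=> c0 h; apply/ler_addgt0Pr => d d0; rewrite add0r.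
  apply: le_trans (h (d / (c + 1)) _) _; first by rewrite divr_gt0// ltr_wpDl.
  rewrite mulrA ler_pdivrMr ?ltr_wpDl//; nra.
have le : perp l e.
  move=> x xl; apply: cmod_eq0; apply/eqP; rewrite eq_le cmod_ge0 andbT.
  apply: (small (N x)) => // d /approx[v [lv _ _ ve _]].
  have -> : ip x e = ip x (e - v) by rewrite ipBr// (lv x xl) subr0.
  apply: le_trans (cauchy_schwarz ipP _ _) _.
  by rewrite ler_wpM2l ?N_ge0// ip_normB.
have Te : T e = (s ^+ 2)%:C%C *: e.
  apply/eqP; rewrite -subr_eq0; apply/eqP/(ip_norm_eq0 ipP)/eqP.
  rewrite eq_le N_ge0 andbT.
  apply: (small (Bs * B + 1 + s ^+ 2)).
    by rewrite !addr_ge0 ?mulr_ge0 ?sqr_ge0 ?(ltW B0) ?(ltW Bs0).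
  move=> d /approx[v [lv _ _ ve vT]].
  have -> : T e - (s ^+ 2)%:C%C *: e = T (e - v) +
      ((T v - (s ^+ 2)%:C%C *: v) + (s ^+ 2)%:C%C *: (v - e)).
    have -> : T (e - v) = T e - T v by rewrite /T !linearB.
    by rewrite scalerBr !subrKA.
  apply: le_trans (ip_normD ipP _ _) _.
  rewrite mulrDl mulrDl -[leRHS]addrA; apply: lerD.
    apply: le_trans (KsB _) _; rewrite -mulrA ler_wpM2l ?(ltW Bs0)//.
    by apply: le_trans (KB _) _; rewrite ler_wpM2l ?(ltW B0)// ip_normB.
  apply: le_trans (ip_normD ipP _ _) _; apply: lerD.
    by rewrite mul1r ip_normB.
  by rewrite ip_normZ// cmodC ger0_norm ?sqr_ge0// ler_wpM2l ?sqr_ge0.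
exists (e, s); split => //; right; split => //.
apply/eqP; rewrite eq_le; apply/andP; split.
  rewrite -subr_le0; apply: (small 1) => // d /approx[v [_ v1 _ ve _]].
  have : N e <= N v + N (e - v).
    by rewrite -{1}(subrKC v e); exact: ip_normD.
  by rewrite [N (e - v)]ip_normB// -/(N _); lra.
have h : s <= N (K e).
  rewrite -subr_le0; apply: (small (1 + B)).
    by rewrite addr_ge0// ltW.
  move=> d /approx[v [_ _ vs ve _]].
  have h1 : N (K v) <= N (K e) + N (K (v - e)).
    by rewrite -{1}(subrKC e v) linearD; exact: ip_normD.
  have h2 : N (K (v - e)) <= B * d.
    by apply: le_trans (KB _) _; rewrite ler_wpM2l ?(ltW B0).
  lra.
by rewrite -(ler_pM2l s_gt0) mulr1 (le_trans h)// top_bound.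
Unshelve. all: by end_near. Qed.

End Top.

Definition singular_system (e : nat -> H) (s : nat -> R) :=
  [/\ forall i j, i != j -> ip (e i) (e j) = 0,
      forall n, T (e n) = (s n ^+ 2)%:C%C *: e n,
      forall n u, (forall i, (i < n)%N -> ip (e i) u = 0) ->
        N (K u) <= s n * N u &
      forall n, (s n = 0 /\ e n = 0) \/ (0 < s n /\ N (e n) = 1)].

Lemma singular_system_exists : exists e s, singular_system e s.
Proof.
have /choice[g gP] (l : seq H) : exists es, eigen l -> is_top l es.
  have [El|nEl] := pselect (eigen l); last by exists (0, 0).
  by have [es] := top_eigenvector El; exists es.
pose fix L n := if n is n'.+1 then (g (L n')).1 :: L n' else [::].
pose e n := (g (L n)).1; pose s n := (g (L n)).2.
have memL n x : (x \in L n) <-> exists2 i, (i < n)%N & x = e i.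
  elim: n x => [|n IHn] x /=; first by split => // -[].
  rewrite in_cons; split => [/orP[/eqP->|/IHn[i ni ->]]|[j]].
  - by exists n.
  - by exists i => //; exact: ltnW.
  - rewrite ltnS leq_eqVlt => /orP[/eqP-> ->|nj ->]; first by rewrite eqxx.
    by apply/orP; right; apply/IHn; exists j.
have eigenL n : eigen (L n).
  elim: n => [|n IHn] x; first by [].
  rewrite /= in_cons => /orP[/eqP->|/IHn//].
  have := gP _ IHn; case: (g (L n)) => e' s' [_ _ -> _ _].
  by exists (s' ^+ 2).
have topL n : is_top (L n) (e n, s n).
  by have := gP _ (eigenL n); rewrite /e /s; case: (g (L n)).
have orth i j : (i < j)%N -> ip (e i) (e j) = 0.
  by move=> ij; have [_ + _ _ _] := topL j; apply; apply/memL; exists i.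
exists e, s; split.
- move=> i j; rewrite neq_ltn => /orP[/orth//|/orth ji].
  by rewrite ipC// ji conjc0.
- by move=> n; have [_ _ + _ _] := topL n.
- move=> n u eu; have [_ _ _ + _] := topL n; apply.
  by move=> x /memL[i ni ->]; exact: eu.
- by move=> n; have [_ _ _ _] := topL n.
Qed.

Section System.
Variables (e : nat -> H) (s : nat -> R).
Hypothesis esP : singular_system e s.

Let s_ge0 n : 0 <= s n.
Proof. by case: esP => _ _ _ /(_ n)[[->//]|[/ltW]]. Qed.

Let e_orth i j : i != j -> ip (e i) (e j) = 0.
Proof. by case: esP => + _ _ _; apply. Qed.

Let T_e n : T (e n) = (s n ^+ 2)%:C%C *: e n.
Proof. by case: esP. Qed.

Let e_norm n : 0 < s n -> ip (e n) (e n) = 1.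
Proof.
case: esP => _ _ _ /(_ n)[[-> _]|[_ e1 _]]; first by rewrite ltxx.
by rewrite ip_normE// -/(N _) e1 expr1n.
Qed.

Let s_homo : {homo s : m n / (m <= n)%N >-> n <= m}.
Proof.
move=> m n mn; case: esP => _ _ top /(_ n)[[-> _]//|[sn_gt0 en1]].
have : N (K (e n)) <= s m * N (e n).
  apply: top => i im; apply: e_orth; rewrite neq_ltn.
  by rewrite (leq_trans im mn).
rewrite en1 mulr1; apply: le_trans.
rewrite -ler_sqr ?nnegrE ?N_ge0// N_K T_e ipZr// ReMr e_norm//.
by rewrite mulr1.
Qed.

Lemma singular_le_approx n (a : R) : 0 <= a -> approximable ip K n a ->
  s n <= a.
Proof.
move=> a0 [K' [q [g [KE K'a]]]]; have [sn0|sn0] := eqVneq (s n) 0;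
  first by rewrite sn0.
have s_gt0 (i : 'I_n.+1) : 0 < s i.
  apply: (@lt_le_trans _ _ (s n)); first by rewrite lt_neqAle eq_sym sn0 s_ge0.
  by apply: s_homo; rewrite -ltnS.
pose A := \matrix_(i < n.+1, j < n) ip (q j) (e i).
have /rowV0Pn[c /sub_kermxP cA c0] : kermx A != 0.
  by rewrite kermx_eq0 /row_free neq_ltn ltnS rank_leq_col.
pose w := \sum_i c 0 i *: e i.
have qw j : ip (q j) w = 0.
  rewrite ip_sumr//; have /rowP/(_ j) := cA; rewrite !mxE => cAj;
    rewrite -[RHS]cAj.
  by apply: eq_bigr => i _; rewrite mxE.
have Kw : K w = K' w by rewrite KE big1 ?addr0// => i _; rewrite qw scale0r.
have ew (i : 'I_n.+1) : ip (e i) w = c 0 i.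
  rewrite ip_sumr// (bigD1 i)//= e_norm// mulr1 big1 ?addr0// => j ji.
  by rewrite e_orth ?mulr0// eq_sym; apply: contra ji => /eqP/val_inj->.
have ww : N w ^+ 2 = \sum_i cmod (c 0 i) ^+ 2.
  rewrite /N ip_norm_sqr// ip_suml//.
  rewrite (eq_bigr (fun i => (cmod (c 0 i) ^+ 2)%:C%C)); last first.
    by move=> i _; rewrite ew mulJc.
  by rewrite -rmorph_sum.
have Tw : T w = \sum_(i < n.+1) ((s i ^+ 2)%:C%C * c 0 i) *: e i.
  rewrite /T !linear_sum/=; apply: eq_bigr => i _.
  by rewrite !linearZ/= -/(T _) T_e scalerA mulrC.
have NKw : s n ^+ 2 * N w ^+ 2 <= N (K w) ^+ 2.
  rewrite N_K Tw ip_sumr// ww mulr_sumr.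
  rewrite (eq_bigr (fun i : 'I_n.+1 => (s i ^+ 2 * cmod (c 0 i) ^+ 2)%:C%C));
    last first.
    move=> i _; rewrite (ipC ipP) ew -mulrA [c 0 i * _]mulrC mulJc.
    by rewrite -rmorphM.
  rewrite -rmorph_sum/=; apply: ler_sum => i _.
  rewrite ler_wpM2r ?sqr_ge0// ler_sqr ?nnegrE ?s_ge0//.
  by apply: s_homo; rewrite -ltnS.
have w_gt0 : 0 < N w.
  rewrite lt_neqAle N_ge0 andbT eq_sym.
  apply: contra c0 => /eqP w0; apply/eqP/rowP => i; rewrite mxE -ew.
  by rewrite (ip_norm_eq0 ipP w0) ip0r.
rewrite -(ler_pM2r w_gt0); apply: le_trans (K'a w); rewrite -Kw.
by rewrite -ler_sqr ?nnegrE ?mulr_ge0 ?s_ge0 ?N_ge0// exprMn.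
Qed.

Lemma singular_system_values : s @ \oo --> (0 : R) -> singular_values ip K s.
Proof.
move=> s_cvg0; split=> // t t0.
have ex_lt : exists n, s n < t.
  have /cvgrPdist_lt/(_ t t0)[n _ /(_ n (leqnn n))] := s_cvg0.
  by rewrite /= sub0r normrN ger0_norm//; exists n.
have ex_le : exists n, s n <= t by case: ex_lt => n /ltW; exists n.
case: (ex_minnP ex_lt) => n2 n2t n2_min.
case: (ex_minnP ex_le) => n1 n1t n1_min.
have n12 : (n1 <= n2)%N by apply: n1_min; exact: ltW.
have st k : s k = t <-> (n1 <= k < n2)%N.
  split=> [skt|/andP[n1k kn2]].
    rewrite n1_min ?skt//= ltnNge; apply/negP => /s_homo.
    by rewrite skt leNgt n2t.
  apply/eqP; rewrite eq_le (le_trans (s_homo n1k) n1t)/= leNgt.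
  by apply/negP => /n2_min; rewrite leqNgt kn2.
exists (n2 - n1)%N.
  apply/card_esym/pcard_eqP/bijPex; exists (addn n1); split.
  - move=> i /= ilt; apply/st; rewrite leq_addr/=.
    by rewrite -(subnKC n12) ltn_add2l.
  - by move=> i j _ _ /addnI.
  - move=> k /= /st/andP[n1k kn2]; exists (k - n1)%N; last exact: subnKC.
    by rewrite /= ltn_sub2r// (leq_ltn_trans n1k).
pose b (i : 'I_(n2 - n1)) := e (n1 + i).
have bt (i : 'I_(n2 - n1)) : s (n1 + i) = t.
  by apply/st; rewrite leq_addr/= -ltn_subRL.
have bb i j : ip (b i) (b j) = (i == j)%:R.
  have [->|ij] := eqVneq i j; first by rewrite e_norm// bt.
  by rewrite e_orth//; apply: contra ij => /eqP/addnI/val_inj->.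
have bsum (a : 'I_(n2 - n1) -> R[i]) j : ip (b j) (\sum_i a i *: b i) = a j.
  rewrite ip_sumr// (bigD1 j)//= bb eqxx mulr1 big1 ?addr0// => i ij.
  by rewrite bb eq_sym (negbTE ij) mulr0.
have Tb i : T (b i) = (t ^+ 2)%:C%C *: b i by rewrite T_e bt.
have Tsum (a : 'I_(n2 - n1) -> R[i]) :
    T (\sum_i a i *: b i) = (t ^+ 2)%:C%C *: \sum_i a i *: b i.
  rewrite /T linear_sum linear_sum scaler_sumr; apply: eq_bigr => i _ /=.
  have -> : Ks (K (a i *: b i)) = a i *: T (b i) by rewrite /T !linearZ.
  by rewrite Tb !scalerA mulrC.
exists b; split.
  by move=> a a0 i; rewrite -bsum a0 ip0r.
move=> u; split; last first.
  by move=> [a ->] w _; rewrite ip_K Tsum.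
move=> uT; have Tu : T u = (t ^+ 2)%:C%C *: u.
  by apply: (ip_injl ipP) => w; rewrite -uT// ip_K.
exists (fun i => ip (b i) u); set v := \sum_i _.
pose r := u - v.
have Tr : T r = (t ^+ 2)%:C%C *: r.
  have -> : T r = T u - T v by rewrite /T !linearB.
  by rewrite Tu Tsum scalerBr.
have er k : ip (e k) r = 0.
  have [skt|skt] := eqVneq (s k) t.
    have /st/andP[n1k kn2] := skt.
    have kn : (k - n1 < n2 - n1)%N by rewrite ltn_sub2r// (leq_ltn_trans n1k).
    have -> : e k = b (Ordinal kn) by rewrite /b /= subnKC.
    by rewrite ipBr// bsum subrr.
  have : (s k ^+ 2 - t ^+ 2)%:C%C * ip (e k) r = 0.
    rewrite rmorphB/= mulrBl -[X in _ - X](ipZr ipP) -Tr -T_sym T_e (ipZl ipP).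
    by rewrite conjc_real subrr.
  move/eqP; rewrite mulf_eq0 => /orP[|/eqP//].
  rewrite fmorph_eq0 subr_eq0 eqrXn2 ?s_ge0 ?(ltW t0)//.
  by rewrite (negbTE skt).
have Kr : K r = 0.
  apply: (ip_norm_le0 ipP) => d d0; rewrite -/(N _).
  have d1_gt0 : 0 < d / (N r + 1) by rewrite divr_gt0// ltr_wpDl.
  have /cvgrPdist_lt/(_ _ d1_gt0)[n _ /(_ n (leqnn n))] := s_cvg0.
  rewrite /= sub0r normrN ger0_norm// => sn.
  have : N (K r) <= s n * N r by case: esP => _ _ + _; apply.
  move/le_trans; apply.
  apply: (@le_trans _ _ (d / (N r + 1) * (N r + 1))); last first.
    by rewrite divfK// gt_eqF// ltr_wpDl.
  by rewrite ler_pM ?N_ge0 ?s_ge0 ?(ltW sn)// lerDl.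
apply/eqP; rewrite -subr_eq0 -/r.
have : (t ^+ 2)%:C%C *: r == 0 by rewrite -Tr /T Kr linear0.
by rewrite scaler_eq0 fmorph_eq0 expf_eq0/= gt_eqF.
Qed.

End System.

Lemma op_norm_le_schatten_norm (s : nat -> R) (p : R) : 0 < p ->
  singular_values ip K s ->
  forall u, ((N (K u))%:E <= 'N[counting]_(p%:E)[EFin \o s] * (N u)%:E)%E.
Proof.
move=> p0 [s_ge0 _ _ sK] u.
have [[e t] [/= t0 _ Te top e_alt]] : exists es, is_top [::] es.
  by apply: top_eigenvector => x.
have : N (K u) <= t * N u by exact: top.
rewrite -lee_fin => /le_trans; apply; rewrite EFinM lee_wpmul2r ?lee_fin//.
case: e_alt => [[-> _]|[t_gt0 e1]]; first exact: Lnorm_ge0.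
have [n st [b [b_free bE]]] := sK _ t_gt0.
have /bE[a ea] : adjoint_graph ip setT K (K e) ((t ^+ 2)%:C%C *: e).
  by move=> w _; rewrite ip_K Te.
have [k skt] : exists k, s k = t.
  apply: contrapT => /forallNP nst.
  have := st; rewrite (_ : [set k | s k = t] = set0); last first.
    by rewrite -subset0 => k /= /nst.
  case: n a b b_free bE ea {st} => [|n] a b _ _ ea.
    by move: e1; rewrite ea big_ord0 [N _]ip_norm0// => /esym/eqP;
      rewrite oner_eq0.
  move/card_esym; rewrite card_eq0 => /eqP/seteqP[/(_ 0%N) h _]; exact: h.
have fk_ge0 (i : nat) : (0 <= `|(EFin \o s) i| `^ p)%E by exact: poweR_ge0.
have tE : (t%:E = (`|(EFin \o s) k| `^ p) `^ p^-1)%E.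
  rewrite /= skt ger0_norm// -powRrM mulfV ?gt_eqF//.
  by rewrite powRr1.
rewrite Lnorm_counting// tE gt0_ler_poweR ?invr_ge0 ?(ltW p0)//.
- by rewrite in_itv/= fk_ge0 leey.
- by rewrite in_itv/= leey andbT nneseries_ge0.
apply: le_trans (nneseries_lim_ge k.+1 _) => //.
by rewrite big_mkord big_ord_recr/= leeDr// sume_ge0.
Qed.

End CompactOperator.

Lemma compact_op_approx (R : realType) (H : lmodType R[i])
    (ip : H -> H -> R[i]) (K : {linear H -> H}) :
  is_inner_product ip ->
  (forall w : nat -> H,
    (forall n, ip_norm ip (w n.+1 - w n) <= 2 ^- n) ->
    exists v, (fun n => ip_norm ip (w n - v)) @ \oo --> (0 : R)) ->
  (forall a : R, 0 < a -> exists n, approximable ip K n a) ->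
  compact_op ip K.
Proof.
move=> ipP H_complete K_approx u [M uM].
pose N u := ip_norm ip u.
have M_ge0 : 0 <= M by rewrite (le_trans _ (uM 0%N))// ip_norm_ge0.
have [G [G_ultra G_oo]] := @ultraFilterLemma nat \oo _.
have G_scalar (q : H) (e : R) : 0 < e -> exists A, G A /\
    forall m n, A m -> A n -> cmod (ip q (u m - u n)) <= e.
  move=> e0.
  have conv (x : nat -> R) (D : R) : (forall n, `|x n| <= D) ->
      exists l, G [set n | `|l - x n| < e / 4].
    move=> xD.
    have : compact `[- D, D]%classic by exact: segment_compact.
    move=> /(_ (x @ G) _)[].
      apply: (@filterS _ G _ setT); last exact: filterT.
      by move=> n _; rewrite /= in_itv/= -ler_norml xD.
    move=> l [_ xl]; exists l.
    have [//|nG] := in_ultra_setVsetC [set n | `|l - x n| < e / 4] G_ultra.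
    have [||y [yA yB]] := xl [set y | ~ (`|l - y| < e / 4)] (ball l (e / 4)).
    - exact: nG.
    - by apply: nbhsx_ballx; rewrite divr_gt0.
    - by case: (yA yB).
  have ipM n : cmod (ip q (u n)) <= N q * M.
    apply: le_trans (cauchy_schwarz ipP _ _) _.
    by rewrite ler_wpM2l ?ip_norm_ge0.
  have [l1 Gl1] := conv (fun n => complex.Re (ip q (u n))) (N q * M)
    (fun n => le_trans (Re_le_cmod _) (ipM n)).
  have [l2 Gl2] := conv (fun n => complex.Im (ip q (u n))) (N q * M)
    (fun n => le_trans (Im_le_cmod _) (ipM n)).
  exists [set n | `|l1 - complex.Re (ip q (u n))| < e / 4 /\
                  `|l2 - complex.Im (ip q (u n))| < e / 4].
  split; first exact: filterI.
  move=> m n /= [m1 m2] [n1 n2].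
  rewrite ipBr// (le_trans (cmod_le_ReIm _))// ReD ImD ReN ImN.
  have h (a b c : R) : `|c - a| < e / 4 -> `|c - b| < e / 4 ->
      `|a - b| <= e / 2.
    rewrite !ltr_norml ler_norml => /andP[? ?] /andP[? ?].
    by apply/andP; split; lra.
  by rewrite [leRHS]splitr lerD// (h _ _ _ m1 n1, h _ _ _ m2 n2).
have G_cauchy (e : R) : 0 < e -> exists A, G A /\
    forall m n, A m -> A n -> N (K (u m) - K (u n)) <= e.
  move=> e0; have a0 : 0 < e / (4 * (M + 1)).
    by rewrite divr_gt0// mulr_gt0// ltr_wpDl.
  have [n [K' [q [g [KE K'a]]]]] := K_approx _ a0.
  pose d i := e / (2 * n.+1%:R * (N (g i) + 1)).
  have d0 i : 0 < d i.
    by rewrite divr_gt0// mulr_gt0// ltr_wpDl// ip_norm_ge0.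
  have /choice[A AP] i := G_scalar (q i) _ (d0 i).
  exists [set k | forall i, A i k]; split.
    by apply: filter_forall => i; case: (AP i).
  move=> k l /= Ak Al; rewrite -linearB KE.
  apply: le_trans (ip_normD ipP _ _) _; rewrite [leRHS]splitr; apply: lerD.
    apply: le_trans (K'a _) _.
    rewrite (le_trans (ler_wpM2l (ltW a0) (ip_normD ipP _ _)))//.
    rewrite ip_normN//.
    apply: (@le_trans _ _ (e / (4 * (M + 1)) * (2 * (M + 1)))).
      by rewrite ler_wpM2l ?(ltW a0)//; have := uM k; have := uM l; lra.
    rewrite [leLHS](_ : _ = e / 2)//.
    by field; rewrite gt_eqF// ltr_wpDl.
  apply: le_trans (ip_norm_sum ipP _) _.
  apply: (@le_trans _ _ (\sum_(i < n) (e / 2 / n.+1%:R))).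
    apply: ler_sum => i _; rewrite ip_normZ//.
    apply: (@le_trans _ _ (d i * (N (g i) + 1))).
      apply: ler_pM; rewrite ?cmod_ge0 ?ip_norm_ge0 ?lerDl//.
      by case: (AP i) => _; apply.
    rewrite /d; have : n.+1%:R != 0 :> R by [].
    move: n.+1%:R (N (g i) + 1) (ltr_wpDl (ip_norm_ge0 ip (g i)) ltr01).
    move=> b c c0 b0; rewrite [leLHS](_ : _ = e / 2 / b)//.
    by field; rewrite b0 gt_eqF.
  rewrite sumr_const card_ord -[leLHS]mulr_natr -mulrA ger_pMr ?divr_gt0//.
  by rewrite mulrC ler_pdivrMr// mul1r ler_nat.
have /choice[A AP] (j : nat) : exists A, G A /\
    forall m n, A m -> A n -> N (K (u m) - K (u n)) <= 2 ^- j.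
  by apply: G_cauchy; rewrite invr_gt0 exprn_gt0.
pose B j := [set n | forall i : 'I_j.+1, A i n].
have GB j : G (B j) by apply: filter_forall => i; case: (AP i).
have /choice[next nextP] (jm : nat * nat) :
    exists n, B jm.1 n /\ (jm.2 < n)%N.
  have : G (B jm.1 `&` [set n | (jm.2 < n)%N]).
    by apply: filterI => //; apply: G_oo; exact: nbhs_infty_gt.
  by move=> /filter_ex[n []]; exists n.
pose fix k j := if j is j'.+1 then next (j, k j') else next (0%N, 0%N).
have kB j : B j (k j).
  by case: j => [|j]; [case: (nextP (0, 0)%N) | case: (nextP (j.+1, k j))].
have k_incr : {homo k : m n / (m < n)%N}.
  by apply: homo_ltn => [|j]; [exact: ltn_trans | case: (nextP (j.+1, k j))].
have [j|v kv] := H_complete (fun j => K (u (k j))); last by exists k, v.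
have [_ Aj] := AP j; apply: Aj.
  by have := kB j.+1 (widen_ord (leqnSn _) ord_max).
by have := kB j ord_max.
Qed.
(** * The complex Hilbert space [L2] *)

Section ComplexMeasurable.
Context d (T : measurableType d) (R : realType).
Implicit Types f g : T -> R[i].

Definition cmeasurable f :=
  measurable_fun [set: T] (fun x => complex.Re (f x)) /\
  measurable_fun [set: T] (fun x => complex.Im (f x)).

Lemma cmeasurable_cst c : cmeasurable (fun=> c).
Proof. by split; exact: measurable_cst. Qed.

Lemma cmeasurableD f g : cmeasurable f -> cmeasurable g ->
  cmeasurable (fun x => f x + g x).
Proof.
move=> [fr fi] [gr gi]; split.
  by under eq_fun do rewrite ReD; exact: measurable_funD.
by under eq_fun do rewrite ImD; exact: measurable_funD.
Qed.

Lemma cmeasurableN f : cmeasurable f -> cmeasurable (fun x => - f x).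
Proof.
move=> [fr fi]; split.
  by under eq_fun do rewrite ReN; exact: measurableT_comp.
by under eq_fun do rewrite ImN; exact: measurableT_comp.
Qed.

Lemma cmeasurableB f g : cmeasurable f -> cmeasurable g ->
  cmeasurable (fun x => f x - g x).
Proof. by move=> mf mg; apply: cmeasurableD => //; exact: cmeasurableN. Qed.

Lemma cmeasurableM f g : cmeasurable f -> cmeasurable g ->
  cmeasurable (fun x => f x * g x).
Proof.
move=> [fr fi] [gr gi]; split.
  by under eq_fun do rewrite ReM; apply: measurable_funB;
    exact: measurable_funM.
by under eq_fun do rewrite ImM; apply: measurable_funD;
  exact: measurable_funM.
Qed.

Lemma cmeasurableJ f : cmeasurable f -> cmeasurable (fun x => (f x)^*%C).
Proof.
move=> [fr fi]; split.
  by under eq_fun do rewrite ReJ.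
by under eq_fun do rewrite ImJ; exact: measurableT_comp.
Qed.

Lemma cmeasurable_real (f : T -> R) : measurable_fun setT f ->
  cmeasurable (fun x => (f x)%:C%C).
Proof. by move=> mf; split => //=; exact: measurable_cst. Qed.

Lemma cmeasurable_sum n (f : 'I_n -> T -> R[i]) :
  (forall i, cmeasurable (f i)) -> cmeasurable (fun x => \sum_i f i x).
Proof.
move=> mf; have -> : (fun x => \sum_i f i x) = \sum_i f i.
  by apply/funext => x; rewrite fct_sumE.
elim/big_ind : _ => [|g h mg mh|i _]; [exact: cmeasurable_cst| |exact: mf].
exact: cmeasurableD.
Qed.

Lemma measurable_cmod f : cmeasurable f ->
  measurable_fun [set: T] (fun x => cmod (f x)).
Proof.
move=> [fr fi]; rewrite [X in measurable_fun _ X](_ : _ =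
    Num.sqrt \o (fun x => complex.Re (f x) ^+ 2 + complex.Im (f x) ^+ 2)).
  apply: (measurableT_comp (continuous_measurable_fun (@sqrt_continuous R))).
  by apply: measurable_funD; apply: measurable_funX.
by apply/funext => x /=; case: (f x).
Qed.

End ComplexMeasurable.

Section ComplexIntegral.
Context d (T : measurableType d) (R : realType).
Variable mu : {measure set T -> \bar R}.
Implicit Types f g : T -> R[i].

Definition cintegrable f :=
  mu.-integrable [set: T] (fun x => (complex.Re (f x))%:E) /\
  mu.-integrable [set: T] (fun x => (complex.Im (f x))%:E).

Lemma cintegrable_measurable f : cintegrable f -> cmeasurable f.
Proof.
by move=> [/measurable_int/measurable_EFinP ? /measurable_int/measurable_EFinP].
Qed.

Lemma cintegrable_le f (h : T -> R) : cmeasurable f ->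
  mu.-integrable setT (fun x => (h x)%:E) ->
  (forall x, cmod (f x) <= h x) -> cintegrable f.
Proof.
move=> [fr fi] ih fh; split; apply: (le_integrable measurableT _ _ ih).
- exact/measurable_EFinP.
- move=> x _; rewrite /= lee_fin (le_trans (Re_le_cmod _))//.
  by rewrite (le_trans (fh x))// ler_norm.
- exact/measurable_EFinP.
- move=> x _; rewrite /= lee_fin (le_trans (Im_le_cmod _))//.
  by rewrite (le_trans (fh x))// ler_norm.
Qed.

Lemma integrable_cmod f : cintegrable f ->
  mu.-integrable setT (fun x => (cmod (f x))%:E).
Proof.
move=> fi; have mf := cintegrable_measurable fi; case: fi => fr fi.
have := integrableD measurableT (integrable_abse fr)
  (integrable_abse fi).
apply: le_integrable => //; first exact/measurable_EFinP/measurable_cmod.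
move=> x _ /=; rewrite lee_fin ger0_norm ?cmod_ge0//.
by rewrite ger0_norm ?addr_ge0// cmod_le_ReIm.
Qed.

Lemma cintegrableD f g : cintegrable f -> cintegrable g ->
  cintegrable (fun x => f x + g x).
Proof.
move=> [fr fi] [gr gi]; split.
  under eq_fun do rewrite ReD EFinD; exact: integrableD.
under eq_fun do rewrite ImD EFinD; exact: integrableD.
Qed.

Lemma cintegrableZ a f : cintegrable f -> cintegrable (fun x => a * f x).
Proof.
move=> [fr fi]; split.
  under eq_fun do rewrite ReM EFinB 2!EFinM; apply: integrableB => //;
    exact: integrableZl.
under eq_fun do rewrite ImM EFinD 2!EFinM; apply: integrableD => //;
  exact: integrableZl.
Qed.

Lemma cintegrableN f : cintegrable f -> cintegrable (fun x => - f x).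
Proof. by move=> /(cintegrableZ (-1)); under eq_fun do rewrite mulN1r. Qed.

Lemma cintegrableB f g : cintegrable f -> cintegrable g ->
  cintegrable (fun x => f x - g x).
Proof. by move=> fi gi; apply: cintegrableD => //; exact: cintegrableN. Qed.

Lemma cintegrableJ f : cintegrable f -> cintegrable (fun x => (f x)^*%C).
Proof.
move=> [fr fi]; split; first by under eq_fun do rewrite ReJ.
by under eq_fun do rewrite ImJ EFinN; exact: integrableN.
Qed.

Lemma cintegralD f g : cintegrable f -> cintegrable g ->
  cintegral mu setT (fun x => f x + g x) =
  cintegral mu setT f + cintegral mu setT g.
Proof.
move=> [fr fi] [gr gi]; apply: complex_eqP; rewrite ?ReD ?ImD /=.
  by under eq_Rintegral do rewrite ReD; exact: RintegralD.
by under eq_Rintegral do rewrite ImD; exact: RintegralD.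
Qed.

Lemma cintegralZ a f : cintegrable f ->
  cintegral mu setT (fun x => a * f x) = a * cintegral mu setT f.
Proof.
move=> [fr fi]; apply: complex_eqP; rewrite ?ReM ?ImM /=.
  under eq_Rintegral do rewrite ReM.
  rewrite RintegralB ?RintegralZl//;
    [exact: (integrableZl measurableT _ fr)|
     exact: (integrableZl measurableT _ fi)].
under eq_Rintegral do rewrite ImM.
rewrite RintegralD ?RintegralZl//;
  [exact: (integrableZl measurableT _ fi)|
   exact: (integrableZl measurableT _ fr)].
Qed.

Lemma cintegralN f : cintegrable f ->
  cintegral mu setT (fun x => - f x) = - cintegral mu setT f.
Proof.
move=> fi; rewrite -mulN1r -cintegralZ//.
by congr cintegral; apply/funext => x; rewrite mulN1r.
Qed.

Lemma cintegralB f g : cintegrable f -> cintegrable g ->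
  cintegral mu setT (fun x => f x - g x) =
  cintegral mu setT f - cintegral mu setT g.
Proof.
by move=> fi gi; rewrite cintegralD ?cintegralN//; exact: cintegrableN.
Qed.

Lemma cintegralJ f : cintegrable f ->
  cintegral mu setT (fun x => (f x)^*%C) = (cintegral mu setT f)^*%C.
Proof.
move=> [fr fi]; apply: complex_eqP; rewrite ?ReJ ?ImJ /=.
  by under eq_Rintegral do rewrite ReJ.
under eq_Rintegral do rewrite ImJ -mulN1r.
by rewrite RintegralZl// mulN1r.
Qed.

Lemma cintegrable0 : cintegrable (fun=> 0).
Proof. by split; exact: integrable0. Qed.

Lemma cintegral0 : cintegral mu setT (fun=> 0) = 0.
Proof. by apply: complex_eqP; rewrite /= /Rintegral integral0. Qed.

Lemma cintegrable_sum n (f : 'I_n -> T -> R[i]) :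
  (forall i, cintegrable (f i)) -> cintegrable (fun x => \sum_i f i x).
Proof.
elim: n f => [|n IH] f fi.
  under eq_fun do rewrite big_ord0; exact: cintegrable0.
under eq_fun do rewrite big_ord_recl; apply: cintegrableD => //.
exact: (IH (fun i => f (lift ord0 i))).
Qed.

Lemma cintegral_sum n (f : 'I_n -> T -> R[i]) :
  (forall i, cintegrable (f i)) ->
  cintegral mu setT (fun x => \sum_i f i x) = \sum_i cintegral mu setT (f i).
Proof.
elim: n f => [|n IH] f fi.
  rewrite big_ord0 -[RHS]cintegral0; congr cintegral.
  by apply/funext => x; rewrite big_ord0.
rewrite big_ord_recl -IH// -cintegralD//; last exact: cintegrable_sum.
by congr cintegral; apply/funext => x; rewrite big_ord_recl.
Qed.

Lemma ae_eq_cintegral f g : cmeasurable f -> cmeasurable g ->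
  {ae mu, forall x, f x = g x} -> cintegral mu setT f = cintegral mu setT g.
Proof.
move=> [fr fi] [gr gi] fg; apply: complex_eqP; congr fine.
- apply: ae_eq_integral => //; try exact/measurable_EFinP.
  by apply: filterS fg => x fgx _ /=; rewrite fgx.
- apply: ae_eq_integral => //; try exact/measurable_EFinP.
  by apply: filterS fg => x fgx _ /=; rewrite fgx.
Qed.

Lemma cmod_cintegral_le f : cintegrable f ->
  cmod (cintegral mu setT f) <= Rintegral mu setT (fun x => cmod (f x)).
Proof.
move=> fi; have [t t1 tE] := cmod_phase (cintegral mu setT f).
have : complex.Re (cintegral mu setT (fun x => t * f x)) =
    cmod (cintegral mu setT f) by rewrite cintegralZ// tE.
move=> <-; have [tr _] := cintegrableZ t fi.
apply: le_Rintegral => //; first exact: integrable_cmod.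
move=> x _; rewrite (le_trans (ler_norm _))// (le_trans (Re_le_cmod _))//.
by rewrite cmodM t1 mul1r.
Qed.

End ComplexIntegral.

Section L2Space.
Context d (T : measurableType d) (R : realType).
Variable mu : {measure set T -> \bar R}.
Implicit Types (f g : T -> R[i]) (u v : L2 mu).

Definition sq_integrable f :=
  cmeasurable f /\ mu.-integrable [set: T] (fun x => (cmod (f x) ^+ 2)%:E).

Lemma sqintP f : f \in sqint mu <-> sq_integrable f.
Proof.
split=> [/andP[fr fi]|[[fr fi] f2]].
  split.
    split; first by move: fr; rewrite inE => /andP[]; rewrite inE.
    by move: fi; rewrite inE => /andP[]; rewrite inE.
  have := integrableD measurableT (Lfun2_integrable_sqr fr)
    (Lfun2_integrable_sqr fi).
  by apply: eq_integrable => // x _; rewrite sqr_cmod EFinD.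
have h (g : T -> R) : measurable_fun setT g ->
    (forall x, `|g x| <= cmod (f x)) -> g \in Lfun mu 2%:E.
  move=> mg gf; rewrite inE; apply/andP; split; rewrite inE//=.
  have -> : finite_norm mu 2%:E g =
      ((\int[mu]_x (g x ^+ 2)%:E) `^ 2^-1 < +oo)%E.
    rewrite /finite_norm unlock; congr (_ `^ _ < _)%E.
    apply: eq_integral => x _ /=.
    by rewrite powR_mulrn// real_normK ?num_real.
  rewrite poweR_lty//.
  have /integrableP[_] := f2; apply: le_lt_trans; apply: ge0_le_integral => //.
  - by move=> x _; rewrite lee_fin sqr_ge0.
  - exact/measurable_EFinP/measurable_funX.
  - apply: measurableT_comp => //; apply/measurable_EFinP/measurable_funX.
    exact: measurable_cmod.
  - move=> x _; rewrite lee_fin [leRHS]ger0_norm ?sqr_ge0//.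
    rewrite -[leLHS]real_normK ?num_real// ler_sqr ?nnegrE ?cmod_ge0//.
apply/andP; split; apply: h => // x; first exact: Re_le_cmod.
exact: Im_le_cmod.
Qed.

Lemma sq_integrable_repr u : sq_integrable (L2_repr u).
Proof. by apply/sqintP; exact: valP. Qed.

Lemma L2_classK g : sq_integrable g ->
  {ae mu, forall x, L2_repr (L2_class mu g) x = g x}.
Proof.
move=> /sqintP gL; rewrite /L2_class insubT /=.
have /asboolP := L2_repr_of (Sqfun gL).
by apply: filterS => x /= /eqP; rewrite !fctE subr_eq0 => /eqP.
Qed.

Lemma L2_eq u v : {ae mu, forall x, L2_repr u x = L2_repr v x} -> u = v.
Proof.
move=> uv; rewrite -[u]L2_reprK -[v]L2_reprK; apply: L2_of_eq.
apply/asboolP; apply: filterS uv => x /= uvx.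
rewrite !fctE; apply/eqP; rewrite subr_eq0; exact/eqP.
Qed.

Lemma L2_reprD u v :
  {ae mu, forall x, L2_repr (u + v) x = L2_repr u x + L2_repr v x}.
Proof.
have -> : u + v = L2_of (repr (u : Quotient.quot (@aenull _ _ _ mu)) +
    repr (v : Quotient.quot (@aenull _ _ _ mu))) by rewrite L2_ofD !L2_reprK.
have /asboolP := L2_repr_of (repr (u : Quotient.quot (@aenull _ _ _ mu)) +
  repr (v : Quotient.quot (@aenull _ _ _ mu))).
by apply: filterS => x /= /eqP; rewrite !fctE subr_eq0 => /eqP.
Qed.

Lemma L2_reprZ a u : {ae mu, forall x, L2_repr (a *: u) x = a * L2_repr u x}.
Proof.
have -> : a *: u = L2_of (a *: repr (u : Quotient.quot (@aenull _ _ _ mu))).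
  by rewrite -L2_scale_of L2_reprK.
have /asboolP := L2_repr_of (a *: repr (u : Quotient.quot (@aenull _ _ _ mu))).
by apply: filterS => x /= /eqP; rewrite !fctE subr_eq0 => /eqP.
Qed.

Lemma L2_reprN u : {ae mu, forall x, L2_repr (- u) x = - L2_repr u x}.
Proof.
rewrite -scaleN1r; apply: filterS (L2_reprZ (-1) u) => x ->.
by rewrite mulN1r.
Qed.

Lemma L2_reprB u v :
  {ae mu, forall x, L2_repr (u - v) x = L2_repr u x - L2_repr v x}.
Proof. by apply: filterS2 (L2_reprD u (- v)) (L2_reprN v) => x -> ->. Qed.

Lemma sq_integrableD f g : sq_integrable f -> sq_integrable g ->
  sq_integrable (fun x => f x + g x).
Proof. by move=> /sqintP ? /sqintP ?; apply/sqintP/rpredD. Qed.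

Lemma sq_integrableZ a f : sq_integrable f -> sq_integrable (fun x => a * f x).
Proof. by move=> /sqintP ?; apply/sqintP; exact: (rpredZ a). Qed.

Lemma sq_integrable_le f (h : T -> R) : cmeasurable f ->
  mu.-integrable setT (fun x => (h x)%:E) ->
  (forall x, cmod (f x) ^+ 2 <= h x) -> sq_integrable f.
Proof.
move=> mf ih fh; split=> //; apply: (le_integrable measurableT _ _ ih).
  by apply/measurable_EFinP/measurable_funX/measurable_cmod.
move=> x _; rewrite /= lee_fin ger0_norm ?sqr_ge0// (le_trans (fh x))//.
exact: ler_norm.
Qed.

Lemma sq_integrable_bounded g f (M : R) : cmeasurable g -> sq_integrable f ->
  (forall x, cmod (g x) <= M) -> sq_integrable (fun x => g x * f x).
Proof.
move=> mg [mf f2] gM.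
apply: (@sq_integrable_le _ (fun x => M ^+ 2 * cmod (f x) ^+ 2)).
- exact: cmeasurableM.
- by under eq_fun do rewrite EFinM; exact: integrableZl.
- move=> x; rewrite cmodM exprMn ler_wpM2r ?sqr_ge0// ler_sqr ?nnegrE
  ?cmod_ge0//.
  by rewrite (le_trans _ (gM x))// cmod_ge0.
Qed.

Lemma cintegrable_mul f g : sq_integrable f -> sq_integrable g ->
  cintegrable mu (fun x => f x * g x).
Proof.
move=> [mf f2] [mg g2].
apply: (@cintegrable_le _ _ _ _ _ (fun x => cmod (f x) ^+ 2 + cmod (g x) ^+ 2)).
- exact: cmeasurableM.
- by under eq_fun do rewrite EFinD; exact: integrableD.
- move=> x; rewrite cmodM.
  by have := cmod_ge0 (f x); have := cmod_ge0 (g x); nra.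
Qed.

Lemma sq_integrableJ f : sq_integrable f -> sq_integrable (fun x => (f x)^*%C).
Proof.
move=> [mf f2]; split; first exact: cmeasurableJ.
by under eq_fun do rewrite cmodJ.
Qed.

Lemma L2_ipE u v f g : sq_integrable f -> sq_integrable g ->
  {ae mu, forall x, L2_repr u x = f x} ->
  {ae mu, forall x, L2_repr v x = g x} ->
  L2_ip u v = cintegral mu setT (fun x => (f x)^*%C * g x).
Proof.
move=> [mf _] [mg _] uf vg; apply: ae_eq_cintegral.
- apply: cmeasurableM; last by case: (sq_integrable_repr v).
  by apply: cmeasurableJ; case: (sq_integrable_repr u).
- by apply: cmeasurableM => //; exact: cmeasurableJ.
- by apply: filterS2 uf vg => x -> ->.
Qed.

Let N u := ip_norm (@L2_ip _ _ _ mu) u.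

Let ip_self u : L2_ip u u =
  (Rintegral mu setT (fun x => cmod (L2_repr u x) ^+ 2))%:C%C.
Proof.
apply: complex_eqP => /=.
  by apply: eq_Rintegral => x _; rewrite mulJc.
rewrite /Rintegral (eq_integral (fun=> 0%E)) ?integral0//.
by move=> x _; rewrite mulJc.
Qed.

Let ip_self_ge0 u : 0 <= complex.Re (L2_ip u u).
Proof. by rewrite ip_self/=; apply: Rintegral_ge0 => x _; exact: sqr_ge0. Qed.

Lemma L2_norm_sqr u :
  ((N u ^+ 2)%:E = \int[mu]_x (cmod (L2_repr u x) ^+ 2)%:E)%E.
Proof.
rewrite sqr_sqrtr// ip_self /= fineK//.
by apply: integrable_fin_num => //; case: (sq_integrable_repr u).
Qed.

Lemma L2_inner_product : is_inner_product (@L2_ip _ _ _ mu).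
Proof.
have fJ u := sq_integrableJ (sq_integrable_repr u).
split.
- move=> w a u v.
  rewrite (@L2_ipE _ _ (L2_repr w) (fun x => a * L2_repr u x + L2_repr v x)).
  + under [X in cintegral _ _ X]eq_fun => x.
      rewrite mulrDr mulrCA; over.
    rewrite cintegralD ?cintegralZ//.
    * by apply: cintegrable_mul; [exact: fJ|exact: sq_integrable_repr].
    * apply: cintegrableZ.
      by apply: cintegrable_mul; [exact: fJ|exact: sq_integrable_repr].
    * by apply: cintegrable_mul; [exact: fJ|exact: sq_integrable_repr].
  + exact: sq_integrable_repr.
  + apply: sq_integrableD; last exact: sq_integrable_repr.
    by apply: sq_integrableZ; exact: sq_integrable_repr.
  + by apply: aeW.
  + by apply: filterS2 (L2_reprD (a *: u) v) (L2_reprZ a u) => x -> ->.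
- move=> u v; rewrite -cintegralJ; last first.
    by apply: cintegrable_mul; [exact: fJ|exact: sq_integrable_repr].
  congr cintegral; apply/funext => x.
  by rewrite rmorphM/= conjcK mulrC.
- exact: ip_self_ge0.
- move=> u u0.
  have : (\int[mu]_x (cmod (L2_repr u x) ^+ 2)%:E = 0)%E.
    by rewrite -L2_norm_sqr sqr_sqrtr// u0.
  have [mu_u _] := sq_integrable_repr u.
  have /(ae_eq_integral_abs mu measurableT)[h _] : measurable_fun setT
      (fun x => (cmod (L2_repr u x) ^+ 2)%:E).
    exact/measurable_EFinP/measurable_funX/measurable_cmod.
  move=> I0; apply: L2_eq.
  have {}/h : (\int[mu]_x `|(cmod (L2_repr u x) ^+ 2)%:E| = 0)%E.
    by rewrite -[RHS]I0; apply: eq_integral => x _;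
      rewrite gee0_abs ?lee_fin ?sqr_ge0.
  have := L2_reprZ 0 u; rewrite scale0r.
  apply: filterS2 => x -> /(_ I)[/eqP]; rewrite sqrf_eq0 mul0r => /eqP.
  exact: cmod_eq0.
Qed.

End L2Space.

Section NonnegativeSeries.
Context (R : realType).

Lemma nneseries_le (u : nat -> \bar R) (c : \bar R) : (forall n, 0 <= u n)%E ->
  (forall n, \sum_(0 <= k < n) u k <= c)%E -> (\sum_(k <oo) u k <= c)%E.
Proof.
move=> u0 uc; apply: lime_le; first exact: is_cvg_nneseries.
by near=> n; exact: uc.
Unshelve. all: by end_near. Qed.

Lemma nneseries_geometric_le (c q : R) : 0 <= c -> 0 <= q < 1 ->
  (\sum_(k <oo) (c * q ^+ k)%:E <= (c / (1 - q))%:E)%E.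
Proof.
move=> c0 /andP[q0 q1]; apply: nneseries_le => n.
  by rewrite lee_fin mulr_ge0 ?exprn_ge0.
rewrite sumEFin lee_fin.
have := congr1 (fun f => f n) (@geometric_seriesE _ c q (negbT (lt_eqF q1))).
rewrite /series/= => ->; rewrite ler_wpM2r ?invr_ge0 ?subr_ge0 ?(ltW q1)//.
by rewrite ler_piMr// lerBlDr lerDl exprn_ge0.
Qed.

End NonnegativeSeries.

Section L2Complete.
Context d (T : measurableType d) (R : realType).
Variable mu : {measure set T -> \bar R}.
Let N (u : L2 mu) := ip_norm (@L2_ip _ _ _ mu) u.
Let ipP := L2_inner_product mu.

Lemma L2_norm_sqrE (u : L2 mu) (f : T -> R[i]) : cmeasurable f ->
  {ae mu, forall x, L2_repr u x = f x} ->
  ((N u ^+ 2)%:E = \int[mu]_x (cmod (f x) ^+ 2)%:E)%E.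
Proof.
move=> mf uf; rewrite L2_norm_sqr; apply: ge0_ae_eq_integral => //.
- apply/measurable_EFinP/measurable_funX/measurable_cmod.
  by case: (sq_integrable_repr u).
- exact/measurable_EFinP/measurable_funX/measurable_cmod.
- by move=> x _; rewrite lee_fin sqr_ge0.
- by move=> x _; rewrite lee_fin sqr_ge0.
- by apply: filterS uf => x /= -> _.
Qed.

Hypothesis mu_fin : (mu [set: T] < +oo)%E.
Variable w : nat -> L2 mu.
Hypothesis w_fast : forall n, N (w n.+1 - w n) <= 2 ^- n.

Let w_tail n k : N (w (n + k)%N - w n) <= 2 * 2 ^- n.
Proof.
suff : N (w (n + k)%N - w n) <= 2 * 2 ^- n - 2 * 2 ^- (n + k).
  move/le_trans; apply; rewrite lerBlDr lerDl.
  by rewrite mulr_ge0// invr_ge0 exprn_ge0.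
elim: k => [|k IH]; first by rewrite addn0 subrr [N _]ip_norm0 ?subrr.
rewrite -(subrKA (w (n + k)%N)); apply: le_trans (ip_normD ipP _ _) _.
have := w_fast (n + k); rewrite addnS => h.
apply: le_trans (lerD h IH) _.
have -> : (2 : R) ^- (n + k).+1 = 2 ^- (n + k) / 2.
  by rewrite exprS invfM mulrC.
by lra.
Qed.

Let f n := L2_repr (w n).
Let mf n : cmeasurable (f n). Proof. by case: (sq_integrable_repr (w n)). Qed.
Let g n x := cmod (f n.+1 x - f n x).
Let mg n : measurable_fun setT (g n).
Proof. by apply: measurable_cmod; exact: cmeasurableB. Qed.

Let g_int n : (\int[mu]_x (g n x)%:E <=
  (2^-1 * (fine (mu [set: T]) + 1) * 2 ^- n)%:E)%E.
Proof.
have mu_T : mu setT \is a fin_num by rewrite ge0_fin_numE.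
have h2 : (\int[mu]_x (g n x ^+ 2)%:E <= (2 ^- n ^+ 2)%:E)%E.
  rewrite -(@L2_norm_sqrE (w n.+1 - w n)); last 2 first.
  - exact: cmeasurableB.
  - exact: L2_reprB.
  by rewrite lee_fin ler_sqr ?nnegrE ?ip_norm_ge0 ?invr_ge0 ?exprn_ge0.
have h1 : (\int[mu]_x (g n x)%:E <=
    \int[mu]_x ((2^-1 * 2 ^- n)%:E + (2^-1 * 2 ^+ n)%:E * (g n x ^+ 2)%:E))%E.
  apply: ge0_le_integral => //.
  - by move=> x _; rewrite lee_fin cmod_ge0.
  - exact/measurable_EFinP.
  - apply: emeasurable_funD => //; apply: measurable_funeM.
    exact/measurable_EFinP/measurable_funX.
  - move=> x _; rewrite -EFinM -EFinD lee_fin.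
    have := sqr_ge0 (1 - 2 ^+ n * g n x).
    have : 0 < (2 : R) ^- n by rewrite invr_gt0 exprn_gt0.
    have : (2 : R) ^- n * 2 ^+ n = 1 by rewrite mulVf// expf_neq0.
    move: ((2 : R) ^+ n) ((2 : R) ^- n) => b a ab a0.
    rewrite -(pmulr_rge0 _ a0) => h.
    suff -> : 2^-1 * a + 2^-1 * b * g n x ^+ 2 =
      g n x + 2^-1 * (a * (1 - b * g n x) ^+ 2) by rewrite lerDl mulr_ge0.
    have -> : a * (1 - b * g n x) ^+ 2 = a - 2 * (a * b) * g n x +
      (a * b) * b * g n x ^+ 2 by ring.
    by rewrite ab; field.
apply: le_trans h1 _; rewrite ge0_integralD//; last 2 first.
- by move=> x _; apply: mule_ge0; rewrite lee_fin ?sqr_ge0.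
- by apply: measurable_funeM; exact/measurable_EFinP/measurable_funX.
rewrite integral_cst// ge0_integralZl//; last 2 first.
- exact/measurable_EFinP/measurable_funX.
- by move=> x _; rewrite lee_fin sqr_ge0.
rewrite -(fineK mu_T) -EFinM.
apply: le_trans (leeD2l _ (lee_wpmul2l _ h2)) _.
  by rewrite lee_fin mulr_ge0 ?exprn_ge0.
rewrite -EFinM -EFinD lee_fin.
have : (2 : R) ^- n * 2 ^+ n = 1 by rewrite mulVf// expf_neq0.
move: ((2 : R) ^+ n) ((2 : R) ^- n) => b a ab.
rewrite [X in _ + X <= _](_ : _ = 2^-1 * (a * b) * a); last by ring.
by rewrite ab /=; lra.
Qed.

Let G := [set x | (\sum_(n <oo) (g n x)%:E < +oo)%E].

Let mgs : measurable_fun setT (fun x => \sum_(n <oo) (g n x)%:E)%E.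
Proof.
apply: ge0_emeasurable_sum => [n x _ _|n _]; first by rewrite lee_fin cmod_ge0.
exact/measurable_EFinP.
Qed.

Let mG : measurable G.
Proof.
have := emeasurable_fun_infty_o measurableT mgs +oo%E.
by rewrite setTI.
Qed.

Let aeG : {ae mu, forall x, G x}.
Proof.
have gi : mu.-integrable setT (fun x => \sum_(n <oo) (g n x)%:E)%E.
  apply/integrableP; split=> //.
  have g0 n x : (0 <= (g n x)%:E)%E by rewrite lee_fin cmod_ge0.
  rewrite (eq_integral (fun x => \sum_(n <oo) (g n x)%:E)%E); last first.
    by move=> x _; rewrite gee0_abs// nneseries_ge0.
  rewrite integral_nneseries//; last by move=> n; exact/measurable_EFinP.
  apply: le_lt_trans (lee_nneseries _ _) _; last 2 first.
  - by move=> n _; exact: g_int.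
  - under eq_eseriesr => n _ do rewrite -exprVn.
    apply: le_lt_trans (nneseries_geometric_le _ _) _; last exact: ltry.
    + by rewrite mulr_ge0 ?addr_ge0 ?fine_ge0.
    + by rewrite invr_ge0 ler0n invf_lt1 ?ltr1n.
  - by move=> n _ _; exact: integral_ge0.
apply: filterS (integrable_ae measurableT gi) => x /(_ I) h.
by rewrite /G /= ltey_eq h.
Qed.

Let fG n x := if x \in G then f n x else 0.

Let mfG n : cmeasurable (fG n).
Proof.
have mI : measurable_fun setT (\1_G : T -> R) by exact: measurable_indic.
have -> : fG n = fun x => ((\1_G x : R)%:C%C * f n x).
  apply/funext => x; rewrite /fG indicE; case: (x \in G).
    by rewrite mul1r.
  by rewrite mul0r.
by apply: cmeasurableM => //; exact: cmeasurable_real.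
Qed.

Let cvg_fG (h : R[i] -> R) x : (forall a b, h (a - b) = h a - h b) ->
  (forall a, `|h a| <= cmod a) -> cvgn (fun n => h (fG n x)).
Proof.
move=> hB hc; rewrite /fG; have [xG|_] := boolP (x \in G);
  last exact: is_cvg_cst.
have Gx : G x by rewrite inE in xG.
have -> : (fun n => h (f n x)) =
    (fun n => h (f 0%N x) + series (telescope (fun n => h (f n x))) n).
  by apply/funext => n; rewrite telescopeK/= subrKC.
apply: is_cvgD; first exact: is_cvg_cst.
apply: normed_cvg; apply: (@series_le_cvg _ _ (g ^~ x)) => [n|n|n|].
- exact: normr_ge0.
- exact: cmod_ge0.
- by rewrite /telescope/= -hB.
apply: nondecreasing_is_cvgn.
  apply/nondecreasing_seqP => n.
  by rewrite !seriesEnat/= big_nat_recr//= lerDl cmod_ge0.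
exists (fine (\sum_(n <oo) (g n x)%:E)) => _ [n _ <-].
have g0 k : (0 <= (g k x)%:E)%E by rewrite lee_fin cmod_ge0.
rewrite -lee_fin fineK; last by rewrite ge0_fin_numE// nneseries_ge0.
by rewrite seriesEnat/= -sumEFin; exact: nneseries_lim_ge.
Qed.

Let cvgRe x : cvgn (fun n => complex.Re (fG n x)).
Proof. by apply: cvg_fG => [a b|a]; rewrite ?ReD ?ReN// Re_le_cmod. Qed.

Let cvgIm x : cvgn (fun n => complex.Im (fG n x)).
Proof. by apply: cvg_fG => [a b|a]; rewrite ?ImD ?ImN// Im_le_cmod. Qed.

Let F x : R[i] := Complex (limn (fun n => complex.Re (fG n x)))
  (limn (fun n => complex.Im (fG n x))).

Let mF : cmeasurable F.
Proof.
split.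
- apply: (@measurable_fun_cvg _ _ _ _ (fun n x => complex.Re (fG n x))).
    by move=> n; case: (mfG n).
  by move=> x _; exact: cvgRe.
- apply: (@measurable_fun_cvg _ _ _ _ (fun n x => complex.Im (fG n x))).
    by move=> n; case: (mfG n).
  by move=> x _; exact: cvgIm.
Qed.

Let F_dist n : (\int[mu]_x (cmod (fG n x - F x) ^+ 2)%:E <=
  ((2 * 2 ^- n) ^+ 2)%:E)%E.
Proof.
pose h m x := ((cmod (fG n x - fG m x)) ^+ 2)%:E.
have mh m : measurable_fun setT (h m).
  apply/measurable_EFinP/measurable_funX/measurable_cmod.
  exact: cmeasurableB.
have h0 m x : setT x -> (0 <= h m x)%E by rewrite lee_fin sqr_ge0.
have hF x : limn_einf (h ^~ x) = (cmod (fG n x - F x) ^+ 2)%:E.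
  have hc : h ^~ x @ \oo --> (cmod (fG n x - F x) ^+ 2)%:E.
    apply: cvg_EFin; first by near=> m.
    rewrite /comp /= sqr_cmod.
    under eq_fun do rewrite sqr_cmod !ReD !ImD !ReN !ImN.
    rewrite !ReD !ImD !ReN !ImN /=.
    apply: cvgD.
      rewrite expr2; under eq_fun do rewrite expr2.
      by apply: cvgM; apply: cvgB; first [exact: cvg_cst|exact: cvgRe].
    rewrite expr2; under eq_fun do rewrite expr2.
    by apply: cvgM; apply: cvgB; first [exact: cvg_cst|exact: cvgIm].
  rewrite is_cvg_limn_einfE; first exact/cvg_lim.
  by apply/cvg_ex; eexists; exact: hc.
have := fatou mu measurableT mh h0.
rewrite (eq_integral _ _ (fun x _ => hF x)) => /le_trans; apply.
rewrite limn_einf_lim; apply: lime_le; first exact: is_cvg_einfs.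
near=> m; rewrite /einfs/=.
apply: (@le_trans _ _ (\int[mu]_x h (n + m)%N x)%E).
  by apply: ereal_inf_lbound; exists (n + m)%N => //=; rewrite leq_addl.
apply: (@le_trans _ _ (\int[mu]_x (cmod (f (n + m)%N x - f n x) ^+ 2)%:E)%E).
  apply: ge0_le_integral => //.
  - exact: h0.
  - exact/measurable_EFinP/measurable_funX/measurable_cmod/cmeasurableB.
  - move=> x _; rewrite /h lee_fin cmodB /fG.
    by case: (x \in G); rewrite ?subrr ?cmod0 ?expr0n ?sqr_ge0.
rewrite -(@L2_norm_sqrE (w (n + m)%N - w n)); last 2 first.
- exact: cmeasurableB.
- exact: L2_reprB.
by rewrite lee_fin ler_sqr ?nnegrE ?ip_norm_ge0 ?mulr_ge0 ?invr_ge0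
  ?exprn_ge0//;
  exact: w_tail.
Unshelve. all: by end_near. Qed.

Lemma L2_complete : exists v, (fun n => N (w n - v)) @ \oo --> (0 : R).
Proof.
have fG0 : sq_integrable mu (fG 0%N).
  have [_ f0] := sq_integrable_repr (w 0%N).
  apply: sq_integrable_le f0 _ => // x; rewrite /fG.
  by case: (x \in G) => //; rewrite cmod0 expr0n sqr_ge0.
have fGF : sq_integrable mu (fun x => - 1 * (fG 0%N x - F x)).
  apply: sq_integrableZ; split; first exact: cmeasurableB.
  apply/integrableP; split.
    by apply/measurable_EFinP/measurable_funX/measurable_cmod/cmeasurableB.
  apply: le_lt_trans (ltry ((2 * 2 ^- 0%N) ^+ 2)).
  apply: le_trans (F_dist 0%N).
  by under eq_integral => x _ do rewrite gee0_abs ?lee_fin ?sqr_ge0//.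
have F2 : sq_integrable mu F.
  have := sq_integrableD fG0 fGF.
  by under eq_fun do rewrite mulN1r opprB subrKC.
have aeF n : {ae mu, forall x,
    L2_repr (w n - L2_class mu F) x = fG n x - F x}.
  apply: filterS3 (L2_reprB (w n) (L2_class mu F)) (L2_classK F2) aeG.
  by move=> x -> -> Gx; rewrite /fG ifT ?inE.
exists (L2_class mu F).
have Nle n : N (w n - L2_class mu F) <= 2 * 2 ^- n.
  rewrite -ler_sqr ?nnegrE ?ip_norm_ge0//.
  rewrite -lee_fin (@L2_norm_sqrE _ (fun x => fG n x - F x))//.
  exact: cmeasurableB.
apply: (@squeeze_cvgr _ _ _ _ (fun=> 0) (fun n => 2 * 2^-1 ^+ n)).
- by near=> n; rewrite ip_norm_ge0/= exprVn.
- exact: cvg_cst.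
- rewrite -(mulr0 2); apply: cvgM; first exact: cvg_cst.
  by apply: cvg_expr; rewrite ger0_norm ?invr_ge0// invf_lt1 ?ltr1n.
Unshelve. all: by end_near. Qed.

End L2Complete.

(** * Ahlfors regular measures *)

Section MetricBorel.
Context (R : realType) (X : pmetricType R).
Implicit Types (x y z : X).

Lemma open_borel (A : set X) : open A -> measurable (A : set (borel X)).
Proof. by move=> oA; exact: sub_sigma_algebra. Qed.

Lemma continuous_borel (f : X -> R) : continuous f ->
  measurable_fun [set: borel X] (f : borel X -> R).
Proof.
move=> /continuousP cf; apply: (measurability _ (RGenOpens.measurableE R)).
move=> _ [_ [a [b ->] <-]]; rewrite setTI; apply: open_borel.
exact/cf/interval_open.
Qed.

Lemma mdist_lip x y z : `|mdist x z - mdist y z| <= mdist x y.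
Proof.
rewrite ler_norml; have := metric_triangle x y z.
by have := metric_triangle y x z; rewrite (metric_sym y x); lra.
Qed.

Lemma near_continuous (f : X -> R) :
  (forall x e, 0 < e -> exists2 r, 0 < r &
    forall y, mdist x y < r -> `|f x - f y| <= e) -> continuous f.
Proof.
move=> h x; apply/cvgrPdist_le => e e0; have [r r0 hr] := h x e e0.
by apply/nbhs_ballP; exists r => // y; rewrite ballEmdist /= => /hr.
Qed.

Lemma mdist_measurable z :
  measurable_fun [set: borel X] (fun x : borel X => mdist (x : X) z).
Proof.
apply: continuous_borel; apply: near_continuous => x e e0; exists e => // y xy.
exact: le_trans (mdist_lip x y z) (ltW xy).
Qed.

Lemma measurable_cball x r : measurable (cball x r).
Proof.
have := mdist_measurable x.
move=> /(_ measurableT `]-oo, r]%classic (measurable_itv _)); rewrite setTI.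
congr (measurable _); apply/seteqP; split => y /=;
  by rewrite in_itv/= metric_sym.
Qed.

Hypothesis X_compact : compact [set: X].

Lemma finite_net (r : R) : 0 < r -> exists l : seq X,
  forall x, exists2 c, c \in l & mdist x c < r.
Proof.
move=> r0; have := X_compact; rewrite compact_cover.
move=> /(_ X setT (fun x => (ball x r)^°)) [].
- by move=> x _; exact: open_interior.
- by move=> x _; exists x => //; exact: nbhsx_ballx.
move=> D _ XD; exists (finmap.enum_fset D) => x.
have [//|c cD xc] := XD x; exists c => //.
by move/interior_subset: xc; rewrite ballEmdist/= metric_sym.
Qed.

Lemma separated_net (r : R) : 0 < r -> exists l : seq X,
  pairwise (fun x y => r <= mdist x y) l /\
  forall x, exists2 c, c \in l & mdist x c < 2 * r.
Proof.
move=> r0; have [l0 l0P] := finite_net r0.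
have [l [lr l0l]] : exists l : seq X,
    pairwise (fun x y => r <= mdist x y) l /\
    forall x, x \in l0 -> exists2 c, c \in l & mdist x c < r.
  elim: l0 {l0P} => [|x0 l0 [l [lr l0l]]]; first by exists [::].
  have [/hasP[c cl x0c]|/hasPn x0l] := boolP (has (fun c => mdist x0 c < r) l).
    exists l; split=> // x; rewrite in_cons => /orP[/eqP->|/l0l//].
    by exists c.
  exists (x0 :: l); split.
    rewrite /= lr andbT; apply/allP => c /x0l.
    by rewrite -leNgt.
  move=> x; rewrite in_cons => /orP[/eqP->|/l0l[c cl xc]].
    by exists x0; rewrite ?mem_head// mdistxx.
  by exists c => //; rewrite in_cons cl orbT.
exists l; split=> // x; have [c0 c0l xc0] := l0P x.
have [c cl c0c] := l0l _ c0l; exists c => //.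
by have := metric_triangle x c0 c; lra.
Qed.

Lemma dist_bounded : exists2 D : R, 0 < D & forall x y, mdist x y <= D.
Proof.
have [l lP] := finite_net (@ltr01 R).
pose M := \sum_(c <- l) mdist (point : X) c.
have h x : mdist (point : X) x <= 1 + M.
  have [c cl xc] := lP x.
  have : mdist (point : X) c <= M.
    rewrite /M (big_rem c)//= lerDl sumr_ge0// => i _.
    exact: mdist_ge0.
  by have := metric_triangle (point : X) c x; rewrite (metric_sym c x); lra.
exists (2 * (1 + M)).
  by rewrite mulr_gt0// ltr_wpDr// sumr_ge0// => i _; exact: mdist_ge0.
move=> x y; have := metric_triangle x (point : X) y.
by rewrite (metric_sym x point); have := h x; have := h y; lra.
Qed.

Lemma mdist_le_diam x y : mdist x y <= diam X.
Proof.
have [D _ XD] := dist_bounded; apply: sup_upper_bound.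
  split; first by exists (mdist x x); exists (x, x).
  by exists D => _ [[u v] _ <-].
by exists (x, y).
Qed.

(* [d(x, y)] is the infimum of [d(x, z) + d(z, y)] over a countable dense set,
   which makes it measurable for the product of the Borel sigma-algebras. *)
Lemma mdist_measurable2 : measurable_fun [set: borel X * borel X]
  (fun z : borel X * borel X => mdist (z.1 : X) z.2).
Proof.
have /choice[l lP] (n : nat) : exists l : seq X,
    forall x, exists2 c, c \in l & mdist x c < n.+1%:R^-1.
  by apply: finite_net; rewrite invr_gt0.
apply: (measurability _ (RGenInftyO.measurableE R)) => _ [_ [r ->] <-].
rewrite setTI (_ : _ @^-1` _ = \bigcup_n \bigcup_k
    [set z | mdist (z.1 : X) (nth point (l n) k) +
             mdist (z.2 : X) (nth point (l n) k) < r]); last first.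
  apply/seteqP; split => [[x y] /=|[x y] [n _ [k _]] /=]; rewrite in_itv/=.
    rewrite -subr_gt0 => xyr.
    have [n nr] : exists n, 2 * n.+1%:R^-1 <= r - mdist x y.
      pose N := Num.trunc (2 / (r - mdist x y)).
      exists N; rewrite ler_pdivrMr// mulrC -ler_pdivrMr//.
      exact/ltW/truncnS_gt.
    have [c cl xc] := lP n x.
    exists n => //; exists (index c (l n)) => //=; rewrite nth_index//.
    move: (n.+1%:R^-1) nr xc => t nr xc.
    by have := metric_triangle y x c; rewrite (metric_sym y x); lra.
  by apply: le_lt_trans; rewrite (metric_sym y); exact: metric_triangle.
apply: bigcupT_measurable => n; apply: bigcupT_measurable => k.
rewrite -[X in measurable X]setTI.
have mD z : measurable_fun [set: borel X * borel X]
    (fun u : borel X * borel X => mdist (u.1 : X) z + mdist (u.2 : X) z).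
  apply: measurable_funD.
    exact: (measurableT_comp (mdist_measurable z) measurable_fst).
  exact: (measurableT_comp (mdist_measurable z) measurable_snd).
have := mD (nth point (l n) k) measurableT _ (measurable_itv `]-oo, r[).
by congr (measurable (_ `&` _)); apply/seteqP; split => z /=; rewrite in_itv.
Qed.

End MetricBorel.

Section PowR.
Context (R : realType).
Implicit Types x y a b : R.

Lemma powRD_gt0 x a b : 0 < x -> x `^ (a + b) = x `^ a * x `^ b.
Proof. by move=> x0; rewrite powRD//; apply/implyP => _;
  rewrite (gt_eqF x0). Qed.

Lemma powR_homo x y a : 0 <= x -> x <= y -> 0 <= a -> x `^ a <= y `^ a.
Proof.
by move=> x0 xy a0; apply: ge0_ler_powR; rewrite // nnegrE (le_trans x0).
Qed.

Lemma powRV x a : 0 < x -> x^-1 `^ a = x `^ (- a).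
Proof. by move=> x0; rewrite -powR_inv1 ?ltW// -powRrM mulN1r. Qed.

Lemma powR_comparable x y a : 0 < x -> x / 2 <= y -> y <= 2 * x ->
  y `^ a <= 2 `^ `|a| * x `^ a.
Proof.
move=> x0 xy yx; have y0 : 0 < y by rewrite (lt_le_trans _ xy)// divr_gt0.
have [a0|a0] := leP 0 a.
  rewrite ger0_norm// -powRM ?(ltW x0)//; apply: powR_homo => //; exact: ltW.
rewrite ltr0_norm// -[X in _ `^ X <= _ * _ `^ X]opprK -!(powRV (- a))// -powRM
  ?invr_ge0 ?(ltW x0)//.
apply: powR_homo; rewrite ?invr_ge0 ?oppr_ge0 ?(ltW y0) ?(ltW a0)//.
by rewrite -invf_div lef_pV2 ?posrE ?divr_gt0.
Qed.

Lemma powRX x a n : 0 <= x -> (x ^+ n) `^ a = (x `^ a) ^+ n.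
Proof.
move=> x0; rewrite -powR_mulrn// -powRrM mulrC powRrM powR_mulrn//.
exact: powR_ge0.
Qed.

Lemma dyadic_bracket x : 1 <= x -> exists j, 2 ^+ j <= x < 2 ^+ j.+1.
Proof.
move=> x1; have x0 : 0 <= x by exact: le_trans x1.
have /andP[nx xn] := truncn_itv x0; set n := Num.trunc x in nx xn.
have n0 : (0 < n)%N.
  rewrite lt0n; apply/eqP => n0; move: xn; rewrite n0 ltNge.
  by rewrite x1.
have /andP[jn nj] := trunc_log_bounds (isT : 1 < 2)%N n0.
exists (trunc_log 2 n); rewrite -!natrX; apply/andP; split.
  by rewrite (le_trans _ nx)// ler_nat.
by rewrite (lt_le_trans xn)// ler_nat.
Qed.

End PowR.

Lemma measurable_singleton (R : realType) (X : pmetricType R) (x : X) :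
  measurable ([set x] : set (borel X)).
Proof.
rewrite (_ : [set x] = cball x 0); first exact: measurable_cball.
apply/seteqP; split => y; first by move=> ->; rewrite /cball/= mdistxx.
rewrite /cball/= => h; apply/esym/mdist_positivity/eqP.
by rewrite eq_le mdist_ge0 andbT.
Qed.

Section MeasureBounds.
Context (R : realType) (X : pmetricType R).
Variables (mu : {finite_measure set (borel X) -> \bar R}) (df : R).
Hypothesis X_compact : compact [set: X].
Hypothesis df_gt0 : 0 < df.
Hypothesis mu_regular : ahlfors_regular mu df.

Let mu_fin A : measurable A -> mu A \is a fin_num.
Proof. exact: fin_num_measure. Qed.

(* The centre is removed because a one-point space, whose diameter is [0],
   carries no regularity constraint. *)
Lemma punctured_ball_upper : exists2 C : R, 0 < C &
  forall (x : X) r, 0 < r ->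
    (mu (cball x r `\ (x : borel X)) <= (C * r `^ df)%:E)%E.
Proof.
have [K K1 KP] := mu_regular.
have K0 : 0 < K by exact: lt_le_trans K1.
have [d0|d0] := leP (diam X) 0.
  exists 1 => // x r r0; rewrite (_ : _ `\ _ = set0).
    by rewrite measure0 lee_fin mul1r powR_ge0.
  rewrite -subset0 => y [_ yx]; apply: yx; apply/esym/mdist_positivity.
  apply/eqP; rewrite eq_le mdist_ge0 andbT.
  exact: le_trans (mdist_le_diam X_compact _ _) d0.
have m1 (x : X) := measurable_singleton x.
exists (K + fine (mu setT) / diam X `^ df).
  by rewrite ltr_wpDr// divr_ge0 ?powR_ge0// fine_ge0.
move=> x r r0; have [rd|rd] := ltP r (diam X).
  have /andP[_ h] : ((K^-1 * r `^ df)%:E <= mu (cball x r) <=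
      (K * r `^ df)%:E)%E by apply: KP; rewrite rd ltW.
  apply: le_trans (le_trans _ h) _.
    apply: le_measure; rewrite ?inE; [|exact: measurable_cball|exact: subDsetl].
    by apply: measurableD => //; exact: measurable_cball.
  by rewrite lee_fin ler_wpM2r ?powR_ge0// lerDl divr_ge0 ?powR_ge0// fine_ge0.
apply: (@le_trans _ _ (mu setT)).
  apply: le_measure; rewrite ?inE//.
  by apply: measurableD => //; exact: measurable_cball.
rewrite -(fineK (mu_fin measurableT)) lee_fin.
apply: (@le_trans _ _ (fine (mu setT) / diam X `^ df * r `^ df)).
  rewrite -mulrA ler_peMr ?fine_ge0//.
  rewrite ler_pdivlMl ?powR_gt0// mulr1; apply: powR_homo => //; exact: ltW.
by rewrite ler_wpM2r ?powR_ge0// lerDr ltW.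
Qed.

Lemma ball_lower : exists2 c : R, 0 < c &
  forall (x : X) r, 0 <= r < diam X -> ((c * r `^ df)%:E <= mu (cball x r))%E.
Proof.
have [K K1 KP] := mu_regular.
exists K^-1; first by rewrite invr_gt0 (lt_le_trans _ K1).
by move=> x r /(KP x)/andP[].
Qed.

Lemma separated_size : exists2 C : R, 0 < C &
  forall (r : R) (l : seq X), 0 < r ->
  pairwise (fun x y => r <= mdist x y) l ->
  (size l)%:R <= Num.max 1 (C * r `^ (- df)).
Proof.
have [c c0 cP] := ball_lower.
exists (fine (mu setT) * 3 `^ df / c + 1).
  by rewrite ltr_wpDl// divr_ge0 ?mulr_ge0 ?powR_ge0 ?fine_ge0 ?(ltW c0).
move=> r l r0 /(pairwiseP (point : X)) lr.
have r3 : 0 < r / 3 by rewrite divr_gt0.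
have [rd|rd] := leP (diam X) (r / 3).
  rewrite le_max; apply/orP; left.
  rewrite (_ : 1 = 1%:R)// ler_nat leqNgt; apply/negP => l2.
  have := lr 0%N 1%N; rewrite !inE => /(_ (ltn_trans _ l2) l2)/= h.
  have := le_trans (h isT isT) (mdist_le_diam X_compact _ _).
  by lra.
rewrite le_max; apply/orP; right.
pose F (i : 'I_(size l)) := cball (nth point l i) (r / 3).
have mF i : measurable (F i) by exact: measurable_cball.
have tF : trivIset setT F.
  apply/trivIsetP => i j _ _ ij; rewrite -subset0 => x [xi xj].
  rewrite /F /cball /= in xi xj.
  have {}ij : i != j :> nat by [].
  have : r <= mdist (nth point l i) (nth point l j).
    move: ij; rewrite neq_ltn => /orP[ij|ij]; last rewrite metric_sym;
      by apply: lr => //; rewrite inE.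
  have := metric_triangle (nth point l i) (x : X) (nth point l j).
  by rewrite (metric_sym (x : X)); lra.
have h : (\sum_(i < size l) mu (F i) <= (fine (mu setT))%:E)%E.
  rewrite fineK ?mu_fin// -measure_bigsetU_ord//; apply: le_measure;
    rewrite ?inE//.
  by apply: bigsetU_measurable => i _.
have : (\sum_(i < size l) (c * (r / 3) `^ df)%:E <= (fine (mu setT))%:E)%E.
  by apply: le_trans h; apply: lee_sum => i _; apply: cP; rewrite rd ltW.
rewrite sumEFin lee_fin sumr_const card_ord -[leLHS]mulr_natl => {}h.
have rdf : 0 < r `^ df by rewrite powR_gt0.
apply: (@le_trans _ _ (fine (mu setT) * 3 `^ df / c * r `^ - df)); last first.
  by rewrite ler_wpM2r ?powR_ge0// lerDl.
rewrite powRN -ler_pdivrMr ?invr_gt0// invrK ler_pdivlMr// mulrAC.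
have e3 : 0 < (3 : R)^-1 by rewrite invr_gt0.
rewrite -ler_pdivrMr ?powR_gt0//; apply: le_trans h.
rewrite powRM ?(ltW r0)// ?(ltW e3)// powRV// powRN.
by rewrite le_eqVlt; apply/orP; left; apply/eqP; ring.
Qed.

End MeasureBounds.

Section ShellIntegrals.
Context (R : realType) (X : pmetricType R).
Variables (mu : {finite_measure set (borel X) -> \bar R}) (df C : R).
Hypothesis C_gt0 : 0 < C.
Hypothesis ball_upper : forall (x : X) r, 0 < r ->
  (mu (cball x r `\ (x : borel X)) <= (C * r `^ df)%:E)%E.

Let mball (x : X) r : measurable (cball x r `\ (x : borel X)).
Proof.
by apply: measurableD; [exact: measurable_cball|exact: measurable_singleton].
Qed.

Lemma measurable_mdist_comp (x : X) (h : R -> R) : measurable_fun setT h ->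
  measurable_fun [set: borel X] (fun y : borel X => h (mdist x y)).
Proof.
move=> mh; under eq_fun do rewrite metric_sym.
exact: measurableT_comp mh (mdist_measurable x).
Qed.

Lemma integral_shells (x : X) (h : R -> R) (b rho : nat -> R) :
  measurable_fun setT h -> (forall t, 0 <= h t) -> h 0 = 0 ->
  (forall n, 0 <= b n) -> (forall n, 0 < rho n) ->
  (forall t, 0 < t -> h t != 0 -> exists n, t <= rho n /\ h t <= b n) ->
  (\int[mu]_y (h (mdist x y))%:E <=
    \sum_(n <oo) (b n * (C * rho n `^ df))%:E)%E.
Proof.
move=> mh h0 h00 b0 rho0 hb.
pose A n := cball x (rho n) `\ (x : borel X).
pose g n (y : borel X) := (b n * \1_(A n) y)%:E.
have g0 n y : (0 <= g n y)%E by rewrite lee_fin mulr_ge0.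
have mg n : measurable_fun setT (g n).
  by apply/measurable_EFinP/measurable_funM => //;
    exact: measurable_indic (mball _ _).
apply: (@le_trans _ _ (\int[mu]_y \sum_(n <oo) g n y)%E).
  apply: ge0_le_integral => //.
  - by move=> y _; rewrite lee_fin.
  - by apply/measurable_EFinP; exact: measurable_mdist_comp.
  - exact: ge0_emeasurable_sum.
  move=> y _; have [->|hy] := eqVneq (h (mdist x y)) 0.
    exact: nneseries_ge0.
  have d0 : 0 < mdist x y.
    rewrite lt_neqAle mdist_ge0 andbT eq_sym.
    by apply: contra hy => /eqP->; rewrite h00.
  have [n [dn hn]] := hb _ d0 hy.
  apply: le_trans (nneseries_lim_ge n.+1 _) => //.
  rewrite big_mkord big_ord_recr/=; apply: le_trans (leeDr _ _); last first.
    exact: sume_ge0.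
  rewrite /g lee_fin indicE mem_set ?mulr1//; split=> // yx.
  by move: d0; rewrite yx mdistxx ltxx.
rewrite integral_nneseries//; apply: lee_nneseries => [n _ _|n _].
  exact: integral_ge0.
rewrite /g; under eq_integral do rewrite EFinM.
rewrite ge0_integralZl_EFin//; last first.
  by apply/measurable_EFinP; exact: measurable_indic (mball _ _).
rewrite integral_indic ?setIT//; last exact: mball.
rewrite EFinM.
by apply: lee_wpmul2l; rewrite ?lee_fin// ball_upper.
Qed.

Lemma near_integral (t : R) : 0 < t -> exists2 M : R, 0 < M & forall (x : X) r,
  0 < r -> (\int[mu]_y (mdist x y `^ (t - df) * \1_`]0, r] (mdist x y))%:E <=
    (M * r `^ t)%:E)%E.
Proof.
move=> t0; pose M := 2 `^ `|t - df| * C.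
have q0 : 0 < (2 : R)^-1 by rewrite invr_gt0.
pose q := (2 : R)^-1 `^ t.
have q01 : 0 <= q < 1.
  have <- : 1 `^ t = 1 :> R by rewrite powR1.
  by rewrite powR_ge0/= gt0_ltr_powR ?nnegrE// invf_lt1// ltr1n.
have q1 : 0 < 1 - q by rewrite subr_gt0; case/andP: q01.
exists (M / (1 - q)); first by rewrite divr_gt0// mulr_gt0// powR_gt0.
move=> x r r0; pose rho n := r * 2^-1 ^+ n.
have rho0 n : 0 < rho n by rewrite mulr_gt0// exprn_gt0.
pose b n := 2 `^ `|t - df| * rho n `^ (t - df).
apply: le_trans (@integral_shells x (fun s => s `^ (t - df) * \1_`]0, r] s)
  b rho _ _ _ _ _ _) _ => //.
- apply: measurable_funM; first exact: measurable_powR.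
  exact: measurable_indic.
- by move=> s; rewrite mulr_ge0 ?powR_ge0.
- by rewrite indicE memNset ?mulr0//= in_itv/= ltxx.
- by move=> n; rewrite mulr_ge0 ?powR_ge0.
- move=> s s0; rewrite indicE; have [|_] := boolP (s \in _); last first.
    by rewrite mulr0 eqxx.
  rewrite inE/= in_itv/= s0/= => sr _; rewrite mulr1.
  have [|n] := @dyadic_bracket _ (r / s); first by rewrite ler_pdivlMr// mul1r.
  rewrite ler_pdivlMr// ltr_pdivrMr// => /andP[n1 n2].
  have srn : s <= rho n by rewrite /rho exprVn ler_pdivlMr ?exprn_gt0// mulrC.
  exists n; split=> //; apply: powR_comparable => //.
    rewrite /rho exprVn ler_pdivrMr// ler_pdivrMr ?exprn_gt0//.
    by rewrite -mulrA -exprS mulrC ltW.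
  by rewrite (le_trans srn)// ler_peMl ?(ltW (rho0 n))// ler1n.
apply: le_trans (lee_nneseries _ _) _; last first.
- rewrite [leRHS](_ : _ = (M * r `^ t / (1 - q))%:E); last by congr EFin; ring.
  apply: nneseries_geometric_le q01.
  by rewrite !mulr_ge0 ?powR_ge0 ?(ltW C_gt0).
- move=> n _; rewrite lee_fin le_eqVlt; apply/orP; left; apply/eqP.
  rewrite /b [RHS](_ : _ = M * (r `^ t * q ^+ n)); last by ring.
  rewrite -powRX ?ltW// -powRM ?(ltW r0) ?exprn_ge0 ?(ltW q0)// -/(rho n).
  have -> : rho n `^ t = rho n `^ (t - df) * rho n `^ df.
    by rewrite -powRD_gt0// subrK.
  by rewrite /M; ring.
- move=> n _ _; rewrite lee_fin !mulr_ge0 ?powR_ge0 ?(ltW C_gt0)//.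
Qed.

Lemma far_integral (t : R) : 0 < t -> exists2 M : R, 0 < M & forall (x : X) r,
  0 < r -> (\int[mu]_y (mdist x y `^ (- df - t) *
    \1_`[r, +oo[ (mdist x y))%:E <=
    (M * r `^ (- t))%:E)%E.
Proof.
move=> t0; pose M := 2 `^ `|- df - t| * C * 2 `^ df.
have q0 : 0 < (2 : R)^-1 by rewrite invr_gt0.
pose q := (2 : R)^-1 `^ t.
have q01 : 0 <= q < 1.
  have <- : 1 `^ t = 1 :> R by rewrite powR1.
  by rewrite powR_ge0/= gt0_ltr_powR ?nnegrE// invf_lt1// ltr1n.
have q1 : 0 < 1 - q by rewrite subr_gt0; case/andP: q01.
exists (M / (1 - q)); first by rewrite divr_gt0// !mulr_gt0// powR_gt0.
move=> x r r0; pose rho n := r * 2 ^+ n.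
have rho0 n : 0 < rho n by rewrite mulr_gt0// exprn_gt0.
pose b n := 2 `^ `|- df - t| * rho n `^ (- df - t).
apply: le_trans (@integral_shells x
  (fun s => s `^ (- df - t) * \1_`[r, +oo[ s)
  b (fun n => 2 * rho n) _ _ _ _ _ _) _ => //.
- apply: measurable_funM; first exact: measurable_powR.
  exact: measurable_indic.
- by move=> s; rewrite mulr_ge0 ?powR_ge0.
- by rewrite indicE memNset ?mulr0//= in_itv/= andbT leNgt r0.
- by move=> n; rewrite mulr_ge0 ?powR_ge0.
- by move=> n; rewrite mulr_gt0.
- move=> s s0; rewrite indicE; have [|_] := boolP (s \in _); last first.
    by rewrite mulr0 eqxx.
  rewrite inE/= in_itv/= andbT => rs _; rewrite mulr1.
  have [|n] := @dyadic_bracket _ (s / r); first by rewrite ler_pdivlMr// mul1r.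
  rewrite ler_pdivlMr// ltr_pdivrMr// => /andP[n1 n2].
  have srn : s <= 2 * rho n.
    by rewrite /rho mulrCA -exprS mulrC ltW.
  have rns : rho n <= s by rewrite /rho mulrC.
  exists n; split=> //; apply: powR_comparable => //.
  by rewrite ler_pdivrMr// (le_trans rns)// ler_peMr ?(ltW s0)// ler1n.
apply: le_trans (lee_nneseries _ _) _; last first.
- rewrite [leRHS](_ : _ = (M * r `^ (- t) / (1 - q))%:E); last first.
    by congr EFin; ring.
  apply: nneseries_geometric_le q01.
  by rewrite !mulr_ge0 ?powR_ge0 ?(ltW C_gt0).
- move=> n _; rewrite lee_fin le_eqVlt; apply/orP; left; apply/eqP.
  rewrite /b [RHS](_ : _ = M * (r `^ (- t) * q ^+ n)); last by ring.
  have -> : q ^+ n = (2 ^+ n) `^ (- t) by rewrite /q powRV// -powRX.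
  rewrite -powRM ?(ltW r0) ?exprn_ge0// -/(rho n).
  have -> : (2 * rho n) `^ df = 2 `^ df * rho n `^ df.
    by rewrite (powRM df (ler0n R 2) (ltW (rho0 n))).
  have -> : rho n `^ (- t) = rho n `^ (- df - t) * rho n `^ df.
    by rewrite -powRD_gt0// addrAC addNr add0r.
  by rewrite /M; ring.
- move=> n _ _; rewrite lee_fin !mulr_ge0 ?powR_ge0 ?(ltW C_gt0)//.
Qed.

End ShellIntegrals.

(** * Integral operators *)

Section ComplexFubini.
Context d (T : measurableType d) (R : realType).
Variable mu : {finite_measure set T -> \bar R}.
Implicit Types (F : T * T -> R[i]).

Lemma measurable_Rintegral (g : T * T -> R) : measurable_fun setT g ->
  measurable_fun setT (fun x => Rintegral mu setT (fun y => g (x, y))).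
Proof.
move=> mg; apply: (measurableT_comp (fine_measurable measurableT)).
have mE : measurable_fun setT (EFin \o g) by exact/measurable_EFinP.
under eq_fun do rewrite integralE.
apply: emeasurable_funB.
  rewrite (_ : (fun _ => _) = fubini_F mu (EFin \o g)^\+%E).
    by apply: measurable_fun_fubini_tonelli_F => //; exact: measurable_funepos.
  by apply/funext => x; apply: eq_integral => y _;
    exact: (congr1 (@^~ y) (funepos_comp (EFin \o g) (pair x))).
rewrite (_ : (fun _ => _) = fubini_F mu (EFin \o g)^\-%E).
  by apply: measurable_fun_fubini_tonelli_F => //; exact: measurable_funeneg.
by apply/funext => x; apply: eq_integral => y _;
    exact: (congr1 (@^~ y) (funeneg_comp (EFin \o g) (pair x))).
Qed.

Lemma cmeasurable_cintegral F : cmeasurable F ->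
  cmeasurable (fun x => cintegral mu setT (fun y => F (x, y))).
Proof.
move=> [Fr Fi]; split; first exact: (measurable_Rintegral Fr).
exact: (measurable_Rintegral Fi).
Qed.

Lemma cmeasurable_pair1 F x : cmeasurable F -> cmeasurable (fun y => F (x, y)).
Proof.
move=> [Fr Fi]; split.
  exact: (measurable_fun_pair2 x Fr).
exact: (measurable_fun_pair2 x Fi).
Qed.

Lemma cmeasurable_pair2 F y : cmeasurable F -> cmeasurable (fun x => F (x, y)).
Proof.
move=> [Fr Fi]; split.
  exact: (measurable_fun_pair1 y Fr).
exact: (measurable_fun_pair1 y Fi).
Qed.

Lemma Rintegral_fubini (g : T * T -> R) :
  (mu \x mu)%E.-integrable setT (EFin \o g) ->
  Rintegral mu setT (fun x => Rintegral mu setT (fun y => g (x, y))) =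
    Rintegral (mu \x mu)%E setT g /\
  Rintegral mu setT (fun y => Rintegral mu setT (fun x => g (x, y))) =
    Rintegral (mu \x mu)%E setT g.
Proof.
move=> ig; have mg : measurable_fun setT g.
  by apply/measurable_EFinP; exact: measurable_int ig.
have mg' : measurable_fun setT (fun z : T * T => g (z.2, z.1)).
  apply: (measurableT_comp mg); apply/measurable_fun_pairP; split.
    exact: measurable_snd.
  exact: measurable_fst.
split; congr fine.
- rewrite -(integral12_prod_meas1 ig); apply: ae_eq_integral => //.
  + exact/measurable_EFinP/measurable_Rintegral.
  + exact: (measurable_fubini_F ig).
  + have := ae_integrable1 ig; apply: filterS => x ix _ /=.
    by rewrite /Rintegral fineK//; exact: integrable_fin_num.
- rewrite -(integral21_prod_meas1 ig); apply: ae_eq_integral => //.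
  + exact/measurable_EFinP/(measurable_Rintegral mg').
  + exact: (measurable_fubini_G ig).
  + have := ae_integrable2 ig; apply: filterS => x ix _ /=.
    by rewrite /Rintegral fineK//; exact: integrable_fin_num.
Qed.

Lemma cintegral_fubini F : cintegrable (mu \x mu)%E F ->
  cintegral mu setT (fun x => cintegral mu setT (fun y => F (x, y))) =
    cintegral (mu \x mu)%E setT F /\
  cintegral mu setT (fun y => cintegral mu setT (fun x => F (x, y))) =
    cintegral (mu \x mu)%E setT F.
Proof.
move=> [/Rintegral_fubini[r1 r2] /Rintegral_fubini[i1 i2]].
by split; apply: complex_eqP.
Qed.

Lemma integrable_tonelli (g : T * T -> R) : measurable_fun setT g ->
  (forall z, 0 <= g z) -> (\int[mu]_x \int[mu]_y (g (x, y))%:E < +oo)%E ->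
  (mu \x mu)%E.-integrable setT (EFin \o g).
Proof.
move=> mg g0 gi; apply/integrable12ltyP; first exact/measurable_EFinP.
apply: le_lt_trans gi; rewrite le_eqVlt; apply/orP; left; apply/eqP.
apply: eq_integral => x _; apply: eq_integral => y _.
by rewrite gee0_abs// lee_fin.
Qed.

End ComplexFubini.

Section KernelOperator.
Context d (T : measurableType d) (R : realType).
Variable mu : {finite_measure set T -> \bar R}.
Implicit Types (k : T -> T -> R[i]) (u v : L2 mu).
Let N u := ip_norm (@L2_ip _ _ _ mu) u.
Let ipP := L2_inner_product mu.

Definition schur_kernel k (A : R) :=
  [/\ 0 < A, cmeasurable (fun z : T * T => k z.1 z.2),
      forall x, (\int[mu]_y (cmod (k x y))%:E <= A%:E)%E &
      forall y, (\int[mu]_x (cmod (k x y))%:E <= A%:E)%E].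

Definition kernel_fun k (f : T -> R[i]) (x : T) : R[i] :=
  cintegral mu setT (fun y => k x y * f y).

Definition kernel_op k u : L2 mu := L2_class mu (kernel_fun k (L2_repr u)).

Section Schur.
Variables (k : T -> T -> R[i]) (A : R).
Hypothesis kA : schur_kernel k A.

Let A0 : 0 < A. Proof. by case: kA. Qed.

Let mk : cmeasurable (fun z : T * T => k z.1 z.2). Proof. by case: kA. Qed.

Let mf1 (f : T -> R[i]) : cmeasurable f ->
  cmeasurable (fun z : T * T => f z.1).
Proof.
move=> [fr fi]; split; first exact: (measurableT_comp fr measurable_fst).
exact: (measurableT_comp fi measurable_fst).
Qed.

Let mf2 (f : T -> R[i]) : cmeasurable f ->
  cmeasurable (fun z : T * T => f z.2).
Proof.
move=> [fr fi]; split; first exact: (measurableT_comp fr measurable_snd).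
exact: (measurableT_comp fi measurable_snd).
Qed.

Let mkx x : cmeasurable (k x). Proof. exact: (cmeasurable_pair1 x mk). Qed.

Let mky y : cmeasurable (k^~ y). Proof. exact: (cmeasurable_pair2 y mk). Qed.

Let S (f : T -> R[i]) x := (\int[mu]_y (cmod (k x y) * cmod (f y) ^+ 2)%:E)%E.

Let mkf2 f : cmeasurable f -> measurable_fun setT
  (fun z : T * T => cmod (k z.1 z.2) * cmod (f z.2) ^+ 2).
Proof.
move=> mf; apply: measurable_funM; first exact: measurable_cmod.
by apply/measurable_funX/measurable_cmod; exact: mf2.
Qed.

Lemma schur_integral2 (f : T -> R[i]) : cmeasurable f ->
  (\int[mu]_x S f x <= A%:E * \int[mu]_y (cmod (f y) ^+ 2)%:E)%E.
Proof.
move=> mf; have k0 x y : 0 <= cmod (k x y) * cmod (f y) ^+ 2.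
  by rewrite mulr_ge0 ?sqr_ge0 ?cmod_ge0.
have := @fubini_tonelli _ _ _ _ _ mu mu
  (fun z => (cmod (k z.1 z.2) * cmod (f z.2) ^+ 2)%:E).
move=> /(_ _ _)/= ->; last 2 first.
- by apply/measurable_EFinP; exact: mkf2.
- by move=> z; rewrite lee_fin.
rewrite -ge0_integralZl_EFin ?(ltW A0)//; last 2 first.
- by move=> y _; rewrite lee_fin sqr_ge0.
- exact/measurable_EFinP/measurable_funX/measurable_cmod.
apply: ge0_le_integral => //.
- by move=> y _; apply: integral_ge0 => x _; rewrite lee_fin.
- exact: (measurable_fun_fubini_tonelli_G (m1 := mu)
    (fun z => (cmod (k z.1 z.2) * cmod (f z.2) ^+ 2)%:E)
    ((measurable_EFinP _ _).2 (mkf2 mf)) (fun z => k0 z.1 z.2)).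
- apply: measurable_funeM.
  exact/measurable_EFinP/measurable_funX/measurable_cmod.
move=> y _; under eq_integral do rewrite EFinM muleC.
rewrite ge0_integralZl_EFin ?sqr_ge0//; last 2 first.
- by move=> x _; rewrite lee_fin cmod_ge0.
- exact/measurable_EFinP/measurable_cmod.
by rewrite muleC lee_wpmul2r ?lee_fin ?sqr_ge0//; case: kA.
Qed.

Let S_ge0 f x : (0 <= S f x)%E.
Proof.
by apply: integral_ge0 => y _; rewrite lee_fin mulr_ge0 ?sqr_ge0 ?cmod_ge0.
Qed.

Let mS f : cmeasurable f -> measurable_fun setT (S f).
Proof.
move=> mf; apply: (measurable_fun_fubini_tonelli_F (m2 := mu)
  (fun z => (cmod (k z.1 z.2) * cmod (f z.2) ^+ 2)%:E)).
  by apply/measurable_EFinP; exact: mkf2.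
by move=> z; rewrite lee_fin mulr_ge0 ?sqr_ge0 ?cmod_ge0.
Qed.

Let iS f : sq_integrable mu f -> mu.-integrable setT (S f).
Proof.
move=> [mf f2]; apply/integrableP; split; first exact: mS.
under eq_integral => x _ do rewrite gee0_abs//.
apply: le_lt_trans (schur_integral2 mf) _.
rewrite -ge0_fin_numE; last first.
  rewrite mule_ge0 ?lee_fin ?(ltW A0)//.
  by apply: integral_ge0 => x _; rewrite lee_fin sqr_ge0.
by rewrite fin_numM//; exact: integrable_fin_num.
Qed.

(* AM-GM: [2 c |k| |f| <= c^2 |k| + |k| |f|^2] for every [c]. *)
Let amgm (f : T -> R[i]) x (c : R) : 0 <= c -> cmeasurable f ->
  ((2 * c)%:E * \int[mu]_y (cmod (k x y * f y))%:E <=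
    (c ^+ 2 * A)%:E + S f x)%E.
Proof.
move=> c0 mf; have mkf : measurable_fun setT (fun y => cmod (k x y * f y)).
  exact/measurable_cmod/cmeasurableM.
rewrite -ge0_integralZl_EFin ?mulr_ge0//; last 2 first.
- by move=> y _; rewrite lee_fin cmod_ge0.
- exact/measurable_EFinP.
have mk2 : measurable_fun setT (fun y => cmod (k x y)).
  exact/measurable_cmod.
have mkS : measurable_fun setT (fun y => cmod (k x y) * cmod (f y) ^+ 2).
  by apply: measurable_funM => //; exact/measurable_funX/measurable_cmod.
apply: (@le_trans _ _ (\int[mu]_y ((c ^+ 2)%:E * (cmod (k x y))%:E +
    (cmod (k x y) * cmod (f y) ^+ 2)%:E))%E).
  apply: ge0_le_integral => //.
  - by move=> y _; rewrite -EFinM lee_fin !mulr_ge0 ?cmod_ge0.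
  - by apply: measurable_funeM; exact/measurable_EFinP.
  - apply: emeasurable_funD; last exact/measurable_EFinP.
    by apply: measurable_funeM; exact/measurable_EFinP.
  move=> y _; rewrite -!EFinM -EFinD lee_fin cmodM.
  have := mulr_ge0 (cmod_ge0 (k x y)) (sqr_ge0 (c - cmod (f y))).
  by rewrite sqrrB; lra.
rewrite ge0_integralD//; last 4 first.
- by move=> y _; rewrite -EFinM lee_fin mulr_ge0 ?sqr_ge0 ?cmod_ge0.
- by apply: measurable_funeM; exact/measurable_EFinP.
- by move=> y _; rewrite lee_fin mulr_ge0 ?sqr_ge0 ?cmod_ge0.
- exact/measurable_EFinP.
rewrite leeD2r// ge0_integralZl_EFin ?sqr_ge0//; last 2 first.
- by move=> y _; rewrite lee_fin cmod_ge0.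
- exact/measurable_EFinP.
by rewrite (EFinM (c ^+ 2) A) lee_wpmul2l ?lee_fin ?sqr_ge0//; case: kA.
Qed.

Let S_cintegrable f x : cmeasurable f -> (S f x < +oo)%E ->
  cintegrable mu (fun y => k x y * f y).
Proof.
move=> mf Sx; apply: (@cintegrable_le _ _ _ _ _ (fun y => cmod (k x y * f y))).
- exact: cmeasurableM.
- apply/integrableP; split.
    exact/measurable_EFinP/measurable_cmod/cmeasurableM.
  under eq_integral => y _ do rewrite gee0_abs ?lee_fin ?cmod_ge0//.
  have := amgm x (c := 2^-1) _ mf; rewrite mulfV// mul1e => /(_ _)/le_lt_trans.
  by apply; rewrite ?invr_ge0// lte_add_pinfty ?ltry.
- by [].
Qed.

Lemma kernel_cintegrable f : sq_integrable mu f ->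
  {ae mu, forall x, cintegrable mu (fun y => k x y * f y)}.
Proof.
move=> fL; apply: filterS (integrable_ae measurableT (iS fL)) => x /(_ I) Sx.
by apply: S_cintegrable; [case: fL | rewrite ltey_eq Sx].
Qed.

Let kernel_sqr f x : cmeasurable f ->
  ((cmod (kernel_fun k f x) ^+ 2)%:E <= (4 * A)%:E * S f x)%E.
Proof.
move=> mf; have [Sx|] := ltP (S f x) +oo%E; last first.
  by rewrite leye_eq => /eqP->; rewrite gt0_muley ?leey// lte_fin mulr_gt0.
have ci := S_cintegrable mf Sx.
pose m := Rintegral mu setT (fun y => cmod (k x y * f y)).
have m0 : 0 <= m by apply: Rintegral_ge0 => y _; exact: cmod_ge0.
have cm : cmod (kernel_fun k f x) <= m by exact: cmod_cintegral_le.
have SE : S f x = (fine (S f x))%:E by rewrite fineK// ge0_fin_numE.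
have mE : m%:E = (\int[mu]_y (cmod (k x y * f y))%:E)%E.
  rewrite /m /Rintegral fineK//.
  by apply: integrable_fin_num => //; exact: integrable_cmod.
have := amgm x (c := m / A) _ mf.
rewrite -mE SE -!EFinM -EFinD !lee_fin => /(_ (divr_ge0 m0 (ltW A0))) h.
have h2 : m ^+ 2 <= A * fine (S f x).
  have := ler_wpM2l (ltW A0) h; rewrite mulrDr.
  have -> : A * (2 * (m / A) * m) = 2 * m ^+ 2.
    by field; rewrite gt_eqF.
  have -> : A * ((m / A) ^+ 2 * A) = m ^+ 2.
    by field; rewrite gt_eqF.
  by lra.
have h3 : cmod (kernel_fun k f x) ^+ 2 <= m ^+ 2.
  by rewrite ler_sqr ?nnegrE ?cmod_ge0.
have : 0 <= A * fine (S f x) by rewrite mulr_ge0 ?(ltW A0)// fine_ge0.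
by lra.
Qed.

Lemma kernel_sq_integrable f : sq_integrable mu f ->
  sq_integrable mu (kernel_fun k f).
Proof.
move=> fL; have [mf f2] := fL.
have mkf : cmeasurable (kernel_fun k f).
  apply: (@cmeasurable_cintegral _ _ _ mu (fun z => k z.1 z.2 * f z.2)).
  by apply: cmeasurableM => //; exact: mf2.
split=> //.
apply: (le_integrable measurableT _ _
  (integrableZl measurableT (4 * A) (iS fL))).
  exact/measurable_EFinP/measurable_funX/measurable_cmod.
move=> x _; rewrite gee0_abs ?lee_fin ?sqr_ge0//.
by rewrite gee0_abs ?kernel_sqr// mule_ge0// lee_fin mulr_ge0 ?(ltW A0).
Qed.

Lemma kernel_opE u :
  {ae mu, forall x, L2_repr (kernel_op k u) x = kernel_fun k (L2_repr u) x}.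
Proof.
by apply: L2_classK; apply: kernel_sq_integrable; exact: sq_integrable_repr.
Qed.

Lemma kernel_op_norm u : N (kernel_op k u) <= 2 * A * N u.
Proof.
have A20 : 0 <= 2 * A by rewrite mulr_ge0 ?(ltW A0).
rewrite -ler_sqr ?nnegrE ?mulr_ge0 ?ip_norm_ge0 ?(ltW A0)//.
have uL := sq_integrable_repr u.
have [mu_u _] := uL.
have [mk_u _] := kernel_sq_integrable uL.
rewrite -lee_fin (L2_norm_sqrE mk_u (kernel_opE u)).
apply: (@le_trans _ _ (\int[mu]_x ((4 * A)%:E * S (L2_repr u) x))%E).
  apply: ge0_le_integral => //.
  - by move=> x _; rewrite lee_fin sqr_ge0.
  - exact/measurable_EFinP/measurable_funX/measurable_cmod.
  - by apply: measurable_funeM; exact: mS.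
  - by move=> x _; exact: kernel_sqr.
rewrite ge0_integralZl_EFin ?mulr_ge0 ?(ltW A0)//; last exact: mS.
apply: le_trans (lee_wpmul2l _ (schur_integral2 mu_u)) _.
  by rewrite lee_fin mulr_ge0 ?(ltW A0).
rewrite -L2_norm_sqr -/(N u) -!EFinM lee_fin.
by rewrite le_eqVlt; apply/orP; left; apply/eqP; ring.
Qed.

Let kernel_fun_ae x (f g : T -> R[i]) : cmeasurable f -> cmeasurable g ->
  {ae mu, forall y, f y = g y} -> kernel_fun k f x = kernel_fun k g x.
Proof.
move=> mf mg fg; apply: ae_eq_cintegral; try exact: cmeasurableM.
by apply: filterS fg => y ->.
Qed.

Lemma kernel_op_linear : linear (kernel_op k).
Proof.
move=> a u v; have uL := sq_integrable_repr u; have vL := sq_integrable_repr v.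
have auL := sq_integrableZ a uL.
have wL := sq_integrableD auL vL.
apply: L2_eq.
have h1 : {ae mu, forall x, L2_repr (kernel_op k (a *: u + v)) x =
    kernel_fun k (fun y => a * L2_repr u y + L2_repr v y) x}.
  apply: filterS (kernel_opE (a *: u + v)) => x ->; apply: kernel_fun_ae.
  - by case: (sq_integrable_repr (a *: u + v)).
  - by case: wL.
  - by apply: filterS2 (L2_reprD (a *: u) v) (L2_reprZ a u) => y -> ->.
apply: filterS3 h1
  (filterI (filterI (kernel_opE u) (kernel_opE v))
    (filterI (kernel_cintegrable uL) (kernel_cintegrable vL)))
  (filterI (L2_reprD (a *: kernel_op k u) (kernel_op k v))
    (L2_reprZ a (kernel_op k u))).
move=> x -> [[ux vx] [cu cv]] [-> ->]; rewrite ux vx /kernel_fun.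
rewrite -cintegralZ// -cintegralD//; last exact: cintegrableZ.
by congr cintegral; apply/funext => y; ring.
Qed.

Lemma kernel_integrable_sqr f : sq_integrable mu f ->
  (mu \x mu)%E.-integrable setT
    (fun z => (cmod (k z.1 z.2) * cmod (f z.2) ^+ 2)%:E).
Proof.
move=> [mf f2]; apply: integrable_tonelli.
- exact: mkf2.
- by move=> z; rewrite mulr_ge0 ?sqr_ge0 ?cmod_ge0.
- by apply: integrable_lty => //; exact: (iS (conj mf f2)).
Qed.

Lemma kernel_cintegrable2 (g f : T -> R[i]) : sq_integrable mu g ->
  sq_integrable mu f ->
  cintegrable (mu \x mu)%E (fun z => g z.1 * k z.1 z.2 * f z.2).
Proof.
move=> [mg g2] [mf f2].
pose h1 (z : T * T) := cmod (k z.1 z.2) * cmod (f z.2) ^+ 2.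
pose h2 (z : T * T) := cmod (g z.1) ^+ 2 * cmod (k z.1 z.2).
have mh1 : measurable_fun setT h1 by exact: mkf2.
have mh2 : measurable_fun setT h2.
  apply: measurable_funM; last exact: measurable_cmod.
  by apply/measurable_funX/measurable_cmod; exact: mf1.
apply: (@cintegrable_le _ _ _ _ _ (fun z => h2 z + h1 z)).
- by apply: cmeasurableM; [apply: cmeasurableM => //; exact: mf1|exact: mf2].
- under eq_fun do rewrite EFinD; apply: integrableD => //.
    apply: integrable_tonelli => //.
      by move=> z; rewrite mulr_ge0 ?sqr_ge0 ?cmod_ge0.
    apply: (@le_lt_trans _ _ (\int[mu]_x (A%:E * (cmod (g x) ^+ 2)%:E))%E).
      apply: ge0_le_integral => //.
      + move=> x _; apply: integral_ge0 => y _.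
        by rewrite lee_fin mulr_ge0 ?sqr_ge0 ?cmod_ge0.
      + apply: (measurable_fun_fubini_tonelli_F (m2 := mu) (EFin \o h2)).
          exact/measurable_EFinP.
        by move=> z; rewrite lee_fin mulr_ge0 ?sqr_ge0 ?cmod_ge0.
      + apply: measurable_funeM.
        exact/measurable_EFinP/measurable_funX/measurable_cmod.
      move=> x _; under eq_integral do rewrite EFinM.
      rewrite /= ge0_integralZl_EFin ?sqr_ge0//; last 2 first.
      + by move=> y _; rewrite lee_fin cmod_ge0.
      + exact/measurable_EFinP/measurable_cmod.
      by rewrite muleC lee_wpmul2r ?lee_fin ?sqr_ge0//; case: kA.
    by apply: integrable_lty => //; exact: integrableZl.
  exact: kernel_integrable_sqr.
- move=> z; rewrite /h1 /h2 !cmodM.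
  have := mulr_ge0 (cmod_ge0 (k z.1 z.2))
    (sqr_ge0 (cmod (g z.1) - cmod (f z.2))).
  have := cmod_ge0 (k z.1 z.2).
  have := cmod_ge0 (g z.1); have := cmod_ge0 (f z.2).
  move: (cmod _) (cmod _) (cmod _) => a b c a0 b0 c0.
  have := mulr_ge0 c0 (mulr_ge0 a0 b0); rewrite sqrrB.
  by lra.
Qed.

Lemma kernel_op_ip (g u : L2 mu) : L2_ip g (kernel_op k u) =
  cintegral (mu \x mu)%E setT
    (fun z => (L2_repr g z.1)^*%C * k z.1 z.2 * L2_repr u z.2).
Proof.
have uL := sq_integrable_repr u; have gL := sq_integrable_repr g.
rewrite (L2_ipE gL (kernel_sq_integrable uL)); [|exact: aeW|exact: kernel_opE].
have ci := kernel_cintegrable2 (sq_integrableJ gL) uL.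
rewrite -(cintegral_fubini ci).1; apply: ae_eq_cintegral.
- apply: cmeasurableM; first by case: (sq_integrableJ gL).
  by case: (kernel_sq_integrable uL).
- exact: (cmeasurable_cintegral mu (cintegrable_measurable ci)).
- apply: filterS (kernel_cintegrable uL) => x ci_x /=.
  rewrite /kernel_fun -cintegralZ//.
  by congr cintegral; apply/funext => y; rewrite mulrA.
Qed.

End Schur.

End KernelOperator.

Section KernelAdjoint.
Context d (T : measurableType d) (R : realType).
Variable mu : {finite_measure set T -> \bar R}.
Implicit Types (k : T -> T -> R[i]) (u v : L2 mu).
Let N u := ip_norm (@L2_ip _ _ _ mu) u.
Let ipP := L2_inner_product mu.

Lemma cmeasurable_swap (F : T * T -> R[i]) : cmeasurable F ->
  cmeasurable (fun z => F (z.2, z.1)).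
Proof.
have ms : measurable_fun [set: T * T] (fun z : T * T => (z.2, z.1)).
  by apply/measurable_fun_pairP; split;
    [exact: measurable_snd|exact: measurable_fst].
by move=> [Fr Fi]; split;
  [exact: (measurableT_comp Fr ms)|exact: (measurableT_comp Fi ms)].
Qed.

Lemma cintegral_swap (F : T * T -> R[i]) : cintegrable (mu \x mu)%E F ->
  cintegrable (mu \x mu)%E (fun z => F (z.2, z.1)) ->
  cintegral (mu \x mu)%E setT (fun z => F (z.2, z.1)) =
  cintegral (mu \x mu)%E setT F.
Proof.
by move=> /cintegral_fubini[_ h1] /cintegral_fubini[h2 _]; rewrite -h1 -h2.
Qed.

Lemma schur_kernelJ k A : schur_kernel mu k A ->
  schur_kernel mu (fun x y => (k y x)^*%C) A.
Proof.
move=> [A0 mk k1 k2]; split=> //.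
- exact: cmeasurableJ (cmeasurable_swap mk).
- by move=> x; under eq_integral do rewrite cmodJ; exact: k2.
- by move=> y; under eq_integral do rewrite cmodJ; exact: k1.
Qed.

Lemma kernel_op_adjoint k A u v : schur_kernel mu k A ->
  L2_ip (kernel_op k u) v = L2_ip u (kernel_op (fun x y => (k y x)^*%C) v).
Proof.
move=> kA; have kJ := schur_kernelJ kA.
have uL := sq_integrable_repr u; have vL := sq_integrable_repr v.
rewrite (ipC ipP) (kernel_op_ip kA) (kernel_op_ip kJ).
have ci := kernel_cintegrable2 kA (sq_integrableJ vL) uL.
have cj := kernel_cintegrable2 kJ (sq_integrableJ uL) vL.
rewrite -cintegralJ// -[LHS]cintegral_swap; last 2 first.
- exact: cintegrableJ.
- have {}cj : cintegrable (mu \x mu)%E (fun z => ((L2_repr v z.2)^*%C *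
      k z.2 z.1 * L2_repr u z.1)^*%C).
    move: cj; congr (cintegrable _ _); apply/funext => z.
    by rewrite !rmorphM/= conjcK; ring.
  exact: cj.
congr cintegral; apply/funext => z /=.
by rewrite !rmorphM/= conjcK; ring.
Qed.

Lemma bounded_sq_integrable (f : T -> R[i]) (M : R) : cmeasurable f ->
  (forall x, cmod (f x) <= M) -> sq_integrable mu f.
Proof.
move=> mf fM; apply: (@sq_integrable_le _ _ _ _ _ (fun=> M ^+ 2)) => //.
  exact: finite_measure_integrable_cst.
move=> x; rewrite ler_sqr ?nnegrE ?cmod_ge0// (le_trans _ (fM x))//.
exact: cmod_ge0.
Qed.

Lemma cmeasurable_indic (Q : set T) : measurable Q ->
  cmeasurable (fun y => (\1_Q y : R)%:C%C).
Proof. by move=> mQ; apply: cmeasurable_real; exact: measurable_indic. Qed.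

Lemma cmod_indic (Q : set T) y : cmod (\1_Q y : R)%:C%C <= 1.
Proof.
by rewrite cmodC indicE; case: (_ \in _); rewrite ?normr1 ?normr0 ?ler01.
Qed.

Lemma kernel_op_split k k' A A' n (phi : 'I_n -> T -> R[i])
    (Q : 'I_n -> set T) (M : R) u :
  schur_kernel mu k A -> schur_kernel mu k' A' ->
  (forall i, cmeasurable (phi i)) -> (forall i x, cmod (phi i x) <= M) ->
  (forall i, measurable (Q i)) ->
  (forall x y, k x y = k' x y + \sum_i phi i x * (\1_(Q i) y)%:C%C) ->
  kernel_op k u = kernel_op k' u + \sum_(i < n)
    L2_ip (L2_class mu (fun y => (\1_(Q i) y)%:C%C)) u *: L2_class mu (phi i).
Proof.
move=> kA kA' mphi phiM mQ kE.
have uL := sq_integrable_repr u.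
have QL i : sq_integrable mu (fun y => (\1_(Q i) y : R)%:C%C).
  by apply: bounded_sq_integrable (cmeasurable_indic (mQ i)) _ => x;
    exact: cmod_indic.
have phiL i : sq_integrable mu (phi i).
  by apply: bounded_sq_integrable (mphi i) (phiM i).
pose c i := L2_ip (L2_class mu (fun y => (\1_(Q i) y : R)%:C%C)) u.
have cE i : c i = cintegral mu setT (fun y => (\1_(Q i) y)%:C%C * L2_repr u y).
  rewrite /c (L2_ipE (QL i) uL (L2_classK (QL i)) (aeW _ _))//.
  by congr cintegral; apply/funext => y; rewrite conjc_real.
have sumE m (g : 'I_m -> L2 mu) : {ae mu, forall x,
    L2_repr (\sum_i g i) x = \sum_i L2_repr (g i) x}.
  elim: m g => [|m IH] g.
    rewrite big_ord0 -(scale0r (0 : L2 mu)).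
    apply: filterS (L2_reprZ 0 (0 : L2 mu)) => x ->.
    by rewrite mul0r big_ord0.
  rewrite big_ord_recl; apply: filterS2
    (L2_reprD (g ord0) (\sum_i g (lift ord0 i)))
      (IH (fun i => g (lift ord0 i))).
  by move=> x -> ->; rewrite big_ord_recl.
have phiE : {ae mu, forall x i, L2_repr (c i *: L2_class mu (phi i)) x =
    c i * phi i x}.
  have : forall i, {ae mu, forall x,
      L2_repr (c i *: L2_class mu (phi i)) x = c i * phi i x}.
    move=> i; apply: filterS2 (L2_reprZ (c i) (L2_class mu (phi i)))
      (L2_classK (phiL i)) => x -> ->//.
  by move=> h; exact: filter_forall.
apply: L2_eq.
apply: filterS3
  (filterI (kernel_opE kA u) (kernel_opE kA' u))
  (filterI (L2_reprD (kernel_op k' u) (\sum_i c i *: L2_class mu (phi i)))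
    (sumE n (fun i => c i *: L2_class mu (phi i))))
  (filterI phiE (kernel_cintegrable kA' uL)).
move=> x [kx k'x] [-> ->] [phix ci]; rewrite kx k'x /kernel_fun.
rewrite (eq_bigr (fun i => phi i x *
    cintegral mu setT (fun y => (\1_(Q i) y)%:C%C * L2_repr u y))); last first.
  by move=> i _; rewrite phix cE mulrC.
have ciQ i : cintegrable mu (fun y => (\1_(Q i) y)%:C%C * L2_repr u y).
  exact: cintegrable_mul.
rewrite (eq_bigr (fun i => cintegral mu setT (fun y =>
    phi i x * ((\1_(Q i) y)%:C%C * L2_repr u y)))); last first.
  by move=> i _; rewrite cintegralZ.
rewrite -cintegral_sum; last by move=> i; exact: cintegrableZ.
rewrite -cintegralD//; last by apply: cintegrable_sum => i; exact: cintegrableZ.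
congr cintegral; apply/funext => y; rewrite kE mulrDl mulr_suml; congr (_ + _).
by apply: eq_bigr => i _; rewrite mulrA.
Qed.

End KernelAdjoint.

Section ProductNull.
Context d (T : measurableType d) (R : realType).
Variable mu : {finite_measure set T -> \bar R}.

Lemma ae_prod (Q : T -> Prop) : {ae mu, forall x, Q x} ->
  {ae (mu \x mu)%E, forall z, Q z.1 /\ Q z.2}.
Proof.
move=> [A [mA A0 QA]].
exists ((A `*` setT) `|` (setT `*` A)); split.
- by apply: measurableU; exact: measurableX.
- have h1 : (mu \x mu)%E (A `*` setT) = 0%E.
    by rewrite product_measure1E// [X in (X * _)%E](_ : _ = 0%E) ?mul0e.
  have h2 : (mu \x mu)%E (setT `*` A) = 0%E.
    by rewrite product_measure1E// [X in (_ * X)%E](_ : _ = 0%E) ?mule0.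
  apply/eqP; rewrite eq_le measure_ge0 andbT.
  apply: le_trans (measureU2 _ _ _) _; try exact: measurableX.
  rewrite -[leRHS]adde0; apply: leeD; rewrite le_eqVlt; apply/orP; left.
    exact/eqP/h1.
  exact/eqP/h2.
- move=> [x y] /= /not_andP[/QA|/QA] Ax; [left|right]; by split.
Qed.

End ProductNull.

(** * The commutator as an integral operator *)

Section HoelderFunctions.
Context (R : realType) (X : pmetricType R).
Hypothesis X_compact : compact [set: X].

Lemma continuous_cmeasurable (f : X -> R[i]) :
  (forall x e, 0 < e -> exists2 r, 0 < r &
    forall y, mdist x y < r -> cmod (f x - f y) <= e) ->
  cmeasurable (f : borel X -> R[i]).
Proof.
move=> fc; split; apply: continuous_borel; apply: near_continuous => x e e0;
    have [r r0 fr] := fc x e e0; exists r => // y /fr; apply: le_trans.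
  by rewrite -ReN -ReD Re_le_cmod.
by rewrite -ImN -ImD Im_le_cmod.
Qed.

Variables (b L : R) (f : X -> R[i]).
Hypothesis b_gt0 : 0 < b.
Hypothesis fL : forall x y, cmod (f x - f y) <= L * mdist x y `^ b.

Lemma hoelder_continuous x e : 0 < e -> exists2 r, 0 < r &
  forall y, mdist x y < r -> cmod (f x - f y) <= e.
Proof.
move=> e0; pose L' : R := `|L| + 1.
have L'0 : 0 < L' by rewrite ltr_wpDl.
exists ((e / L') `^ b^-1); first by rewrite powR_gt0// divr_gt0.
move=> y xy; apply: le_trans (fL x y) _.
apply: (@le_trans _ _ (L' * (e / L'))); last by rewrite mulrC divfK// gt_eqF.
apply: (@le_trans _ _ (L' * mdist x y `^ b)).
  by rewrite ler_wpM2r ?powR_ge0// ler_wpDr// ler_norm.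
rewrite ler_wpM2l ?(ltW L'0)//.
have -> : e / L' = ((e / L') `^ b^-1) `^ b.
  by rewrite -powRrM mulVf ?gt_eqF// powRr1// divr_ge0 ?ltW.
by apply: powR_homo; rewrite ?mdist_ge0 ?ltW.
Qed.

Lemma hoelder_cmeasurable : cmeasurable (f : borel X -> R[i]).
Proof. exact/continuous_cmeasurable/hoelder_continuous. Qed.

Lemma hoelder_bounded : exists M, forall x, cmod (f x) <= M.
Proof.
have [D D0 XD] := dist_bounded X_compact.
exists (cmod (f point) + `|L| * D `^ b) => x.
rewrite -[f x](subrKC (f point)) (le_trans (cmodD _ _))// lerD2l.
apply: le_trans (fL _ _) _.
apply: (@le_trans _ _ (`|L| * mdist x point `^ b)).
  by rewrite ler_wpM2r ?powR_ge0// ler_norm.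
by rewrite ler_wpM2l//; apply: powR_homo; rewrite ?mdist_ge0 ?(ltW b_gt0).
Qed.

End HoelderFunctions.

Section CommutatorKernel.
Context (R : realType) (X : pmetricType R).
Variables (mu : {finite_measure set (borel X) -> \bar R}) (df a C : R).
Hypothesis X_compact : compact [set: X].
Hypothesis df_gt0 : 0 < df.
Hypothesis a_gt0 : 0 < 2 * a.
Hypothesis C_gt0 : 0 < C.
Hypothesis ball_upper : forall (x : X) r, 0 < r ->
  (mu (cball x r `\ (x : borel X)) <= (C * r `^ df)%:E)%E.

Let s := df + 2 * a.
Let s_gt0 : 0 < s. Proof. by rewrite addr_gt0. Qed.

Definition comm_kernel (f : borel X -> R[i]) (x y : borel X) : R[i] :=
  (f x - f y) / (mdist (x : X) y `^ s)%:C%C.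

Lemma comm_kernelE f x y :
  comm_kernel f x y = (f x - f y) * (mdist (x : X) y `^ (- s))%:C%C.
Proof. by rewrite /comm_kernel powRN fmorphV. Qed.

Lemma cmod_comm_kernel f x y :
  cmod (comm_kernel f x y) = cmod (f x - f y) * mdist (x : X) y `^ (- s).
Proof. by rewrite comm_kernelE cmodM cmodC ger0_norm ?powR_ge0. Qed.

Lemma cmeasurable_fst (f : borel X -> R[i]) : cmeasurable f ->
  cmeasurable (fun z : borel X * borel X => f z.1).
Proof.
move=> [fr fi]; split; first exact: (measurableT_comp fr measurable_fst).
exact: (measurableT_comp fi measurable_fst).
Qed.

Lemma cmeasurable_snd (f : borel X -> R[i]) : cmeasurable f ->
  cmeasurable (fun z : borel X * borel X => f z.2).
Proof.
move=> [fr fi]; split; first exact: (measurableT_comp fr measurable_snd).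
exact: (measurableT_comp fi measurable_snd).
Qed.

Let mdist_pow t : measurable_fun [set: borel X * borel X]
  (fun z : borel X * borel X => mdist (z.1 : X) z.2 `^ t).
Proof.
exact: (measurableT_comp (measurable_powR t) (mdist_measurable2 X_compact)).
Qed.

Lemma comm_kernel_measurable f : cmeasurable f ->
  cmeasurable (fun z : borel X * borel X => comm_kernel f z.1 z.2).
Proof.
move=> mf; under eq_fun do rewrite comm_kernelE.
apply: cmeasurableM.
  by apply: cmeasurableB; [exact: cmeasurable_fst|exact: cmeasurable_snd].
exact: cmeasurable_real (mdist_pow (- s)).
Qed.

Lemma power_kernel_bound (t : R) : 0 < t -> exists2 M : R, 0 < M &
  forall x : X, (\int[mu]_y (mdist x y `^ (t - df) *
    \1_`]0, +oo[ (mdist x y))%:E <= M%:E)%E.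
Proof.
move=> t0; have [M M0 MP] := near_integral C_gt0 ball_upper t0.
have [D D0 XD] := dist_bounded X_compact.
exists (M * D `^ t); first by rewrite mulr_gt0// powR_gt0.
move=> x; apply: le_trans (MP x D D0); rewrite le_eqVlt; apply/orP; left.
apply/eqP; apply: eq_integral => y _; congr (_ * _)%:E.
rewrite !indicE; congr (nat_of_bool _)%:R.
by rewrite !mem_setE !in_itv/= XD andbT.
Qed.

Section Hoelder.
Variable b : R.
Hypothesis b_gt : 2 * a < b.

Let t := b - 2 * a.
Let t_gt0 : 0 < t. Proof. by rewrite subr_gt0. Qed.
Let b_gt0 : 0 < b. Proof. exact: lt_trans b_gt. Qed.

Lemma cmod_comm_kernel_le (f : X -> R[i]) L (x y : X) : 0 <= L ->
  (forall x y : X, cmod (f x - f y) <= L * mdist x y `^ b) ->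
  cmod (comm_kernel f x y) <=
    L * (mdist x y `^ (t - df) * \1_`]0, +oo[ (mdist x y)).
Proof.
move=> L0 fL; rewrite cmod_comm_kernel indicE.
have [->|xy] := eqVneq x y.
  by rewrite subrr cmod0 mul0r !mulr_ge0 ?powR_ge0.
have xy0 : 0 < mdist x y by rewrite mdist_gt0.
rewrite mem_set ?mulr1/=; last by rewrite in_itv/= xy0.
apply: le_trans (ler_wpM2r _ (fL x y)) _; first exact: powR_ge0.
rewrite -mulrA ler_wpM2l// -powRD_gt0//.
by rewrite /t /s opprD addrA addrAC.
Qed.

Lemma comm_kernel_schur : exists2 M : R, 0 < M &
  forall (f : X -> R[i]) (L : R), 0 < L ->
  (forall x y : X, cmod (f x - f y) <= L * mdist x y `^ b) ->
  schur_kernel mu (comm_kernel f) (M * L).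
Proof.
have [M M0 MP] := power_kernel_bound t_gt0.
exists M => // f L L0 fL.
have mf : cmeasurable (f : borel X -> R[i])
  by exact: hoelder_cmeasurable b_gt0 fL.
have mk := comm_kernel_measurable mf.
have key (x : X) : (\int[mu]_y (cmod (comm_kernel f x y))%:E <= (M * L)%:E)%E.
  apply: (@le_trans _ _ (\int[mu]_y (L%:E * (mdist x y `^ (t - df) *
      \1_`]0, +oo[ (mdist x y))%:E))%E).
    apply: ge0_le_integral => //.
    - by move=> y _; rewrite lee_fin cmod_ge0.
    - apply/measurable_EFinP/measurable_cmod.
      exact: (cmeasurable_pair1 (x : borel X) mk).
    - apply: measurable_funeM; apply/measurable_EFinP.
      apply: (measurable_mdist_comp x
        (h := fun u => u `^ (t - df) * \1_`]0, +oo[ u)).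
      apply: measurable_funM; first exact: measurable_powR.
      exact: measurable_indic.
    - by move=> y _; rewrite -EFinM lee_fin;
      exact: cmod_comm_kernel_le (ltW L0) fL.
  rewrite ge0_integralZl_EFin ?(ltW L0)//; last 2 first.
  - by move=> y _; rewrite lee_fin mulr_ge0 ?powR_ge0.
  - apply/measurable_EFinP; apply: (measurable_mdist_comp x
      (h := fun u => u `^ (t - df) * \1_`]0, +oo[ u)).
    by apply: measurable_funM; [exact: measurable_powR|exact: measurable_indic].
  by rewrite muleC EFinM lee_wpmul2r// lee_fin ltW.
split; [exact: mulr_gt0|exact: mk|exact: key|].
move=> y; apply: le_trans (key y); rewrite le_eqVlt; apply/orP; left; apply/eqP.
apply: eq_integral => x _; congr EFin.
by rewrite !cmod_comm_kernel cmodB metric_sym.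
Qed.

End Hoelder.

End CommutatorKernel.

Section FractionalForm.
Context (R : realType) (X : pmetricType R).
Variables (mu : {finite_measure set (borel X) -> \bar R}) (df a : R).
Hypothesis X_compact : compact [set: X].

Let s := df + 2 * a.
Let D (z : borel X * borel X) := mdist (z.1 : X) z.2 `^ s.

Lemma integral_setC1 (F : borel X -> \bar R) (x : borel X) : F x = 0%E ->
  (\int[mu]_(y in ~` [set x]) F y = \int[mu]_y F y)%E.
Proof.
move=> Fx; rewrite integral_mkcond; apply: eq_integral => y _.
rewrite patchE; case: ifPn => //; rewrite notin_setE => /contrapT ->.
by rewrite Fx.
Qed.

Lemma cintegral_setC1 (F : borel X -> R[i]) (x : borel X) : F x = 0 ->
  cintegral mu (~` [set x]) F = cintegral mu setT F.
Proof.
by move=> Fx; apply: complex_eqP; congr fine; apply: integral_setC1; rewrite Fx.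
Qed.

Let mD : measurable_fun setT (fun z => (D z)^-1).
Proof.
under eq_fun do rewrite -powRN.
exact: (measurableT_comp (measurable_powR (- s)) (mdist_measurable2 X_compact)).
Qed.

Let D_ge0 z : 0 <= (D z)^-1. Proof. by rewrite invr_ge0 powR_ge0. Qed.

Let mdiff (g : borel X -> R[i]) : cmeasurable g ->
  cmeasurable (fun z : borel X * borel X => g z.1 - g z.2).
Proof.
by move=> mg; apply: cmeasurableB;
  [exact: cmeasurable_fst|exact: cmeasurable_snd].
Qed.

Let mG (g : borel X -> R[i]) : cmeasurable g -> measurable_fun setT
  (fun z : borel X * borel X => cmod (g z.1 - g z.2) ^+ 2 / D z).
Proof.
move=> mg; apply: measurable_funM => //.
by apply: measurable_funX; apply: measurable_cmod; exact: mdiff.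
Qed.

Lemma frac_domP (u : L2 mu) (g : borel X -> R[i]) : cmeasurable g ->
  {ae mu, forall x, L2_repr u x = g x} ->
  frac_dom df a u <-> (mu \x mu)%E.-integrable setT
    (fun z => (cmod (g z.1 - g z.2) ^+ 2 / D z)%:E).
Proof.
move=> mg ug; have [mu_u _] := sq_integrable_repr u.
have G0 h z : (0 <= (cmod (h z.1 - h z.2) ^+ 2 / D z)%:E)%E.
  by rewrite lee_fin mulr_ge0 ?sqr_ge0.
have -> : frac_dom df a u = (\int[mu \x mu]_z
    (cmod (g z.1 - g z.2) ^+ 2 / D z)%:E < +oo)%E.
  rewrite /frac_dom /=; congr (_ < _)%E.
  transitivity (\int[mu \x mu]_z
      (cmod (L2_repr u z.1 - L2_repr u z.2) ^+ 2 / D z)%:E)%E.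
    have mE : measurable_fun setT (fun z : borel X * borel X =>
        (cmod (L2_repr u z.1 - L2_repr u z.2) ^+ 2 / D z)%:E).
      by apply/measurable_EFinP; exact: mG.
    rewrite (@fubini_tonelli1 _ _ _ _ _ mu mu _ mE (G0 (L2_repr u))).
    apply: eq_integral => x _; apply: integral_setC1.
    by rewrite subrr cmod0 expr0n mul0r.
  apply: ge0_ae_eq_integral => //.
  - by apply/measurable_EFinP; exact: mG.
  - by apply/measurable_EFinP; exact: mG.
  - by apply: filterS (ae_prod ug) => z [/= -> ->].
split=> [h|/integrable_lty]; last exact.
apply/integrableP; split; first by apply/measurable_EFinP; exact: mG.
by under eq_integral do rewrite gee0_abs//.
Qed.

Definition form_density (g h : borel X -> R[i]) (z : borel X * borel X) :=
  (g z.1 - g z.2)^*%C * (h z.1 - h z.2) / (D z)%:C%C.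

Lemma form_density_cintegrable g h : cmeasurable g -> cmeasurable h ->
  (mu \x mu)%E.-integrable setT
    (fun z => (cmod (g z.1 - g z.2) ^+ 2 / D z)%:E) ->
  (mu \x mu)%E.-integrable setT
    (fun z => (cmod (h z.1 - h z.2) ^+ 2 / D z)%:E) ->
  cintegrable (mu \x mu)%E (form_density g h).
Proof.
move=> mg mh ig ih.
apply: (@cintegrable_le _ _ _ _ _ (fun z => cmod (g z.1 - g z.2) ^+ 2 / D z +
  cmod (h z.1 - h z.2) ^+ 2 / D z)).
- under [X in cmeasurable X]eq_fun do rewrite /form_density -fmorphV.
  apply: cmeasurableM; last exact: cmeasurable_real.
  by apply: cmeasurableM; [by apply: cmeasurableJ; exact: mdiff|exact: mdiff].
- by under eq_fun do rewrite EFinD; exact: integrableD.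
- move=> z; rewrite /form_density -fmorphV !cmodM cmodJ cmodC ger0_norm//.
  rewrite -mulrDl ler_wpM2r//.
  have := cmod_ge0 (g z.1 - g z.2); have := cmod_ge0 (h z.1 - h z.2).
  by move: (cmod _) (cmod _) => p q; nra.
Qed.

Lemma frac_formP (u v : L2 mu) g h : cmeasurable g -> cmeasurable h ->
  {ae mu, forall x, L2_repr u x = g x} ->
  {ae mu, forall x, L2_repr v x = h x} ->
  frac_dom df a u -> frac_dom df a v ->
  cintegrable (mu \x mu)%E (form_density g h) /\
  frac_form df a u v = 2^-1 * cintegral (mu \x mu)%E setT (form_density g h).
Proof.
move=> mg mh ug vh du dv.
have [mu_u _] := sq_integrable_repr u; have [mu_v _] := sq_integrable_repr v.
have ci : cintegrable (mu \x mu)%E (form_density (L2_repr u) (L2_repr v)).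
  apply: (form_density_cintegrable mu_u mu_v).
    exact: (frac_domP mu_u (aeW mu (frefl _))).1 du.
  exact: (frac_domP mu_v (aeW mu (frefl _))).1 dv.
have ci' : cintegrable (mu \x mu)%E (form_density g h).
  apply: (form_density_cintegrable mg mh).
    exact: (frac_domP mg ug).1 du.
  exact: (frac_domP mh vh).1 dv.
split=> //; rewrite /frac_form; congr (_ * _).
transitivity (cintegral (mu \x mu)%E setT
    (form_density (L2_repr u) (L2_repr v))).
  rewrite -(cintegral_fubini ci).1; congr cintegral; apply/funext => x.
  by apply: cintegral_setC1; rewrite !subrr mulr0 mul0r.
apply: ae_eq_cintegral; [exact: cintegrable_measurable ci|
  exact: cintegrable_measurable ci'|].
by apply: filterS2 (ae_prod ug) (ae_prod vh) => z [ux uy] [vx vy];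
  rewrite /form_density ux uy vx vy.
Qed.

End FractionalForm.

Section BoundedExtension.
Context (R : realType) (H : lmodType R[i]) (ip : H -> H -> R[i]).
Hypothesis ipP : is_inner_product ip.

Lemma bounded_linear_ext (A : unbounded H) (K K' : {linear H -> H}) :
  dense_dom ip A -> bounded_op ip K -> bounded_op ip K' ->
  (forall u, dom A u -> K u = K' u) -> forall u, K u = K' u.
Proof.
move=> dA /bounded_op_gt0[M M0 KM] /bounded_op_gt0[M' M'0 KM'] KK' u.
apply/eqP; rewrite -subr_eq0; apply/eqP/(ip_norm_le0 ipP) => e e0.
have [v dv uv] := dA u (e / (M + M')) (divr_gt0 e0 (addr_gt0 M0 M'0)).
have -> : K u - K' u = K (u - v) - K' (u - v).
  have KB : K (u - v) = K u - K v := raddfB K u v.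
  have KB' : K' (u - v) = K' u - K' v := raddfB K' u v.
  by rewrite KB KB' (KK' v)// opprB addrA subrK.
apply: le_trans (ip_normD ipP _ _) _; rewrite (ip_normN ipP).
apply: le_trans (lerD (KM _) (KM' _)) _.
rewrite -mulrDl; move: uv; rewrite ltr_pdivlMr ?addr_gt0// mulrC.
exact: ltW.
Qed.

End BoundedExtension.

Section Commutator.
Context (R : realType) (X : pmetricType R).
Variables (mu : {finite_measure set (borel X) -> \bar R}) (df a : R).
Hypothesis X_compact : compact [set: X].
Let ipP := L2_inner_product mu.

Section Multiplication.
Variables (f : borel X -> R[i]) (M A : R).
Hypothesis mf : cmeasurable f.
Hypothesis fM : forall x, cmod (f x) <= M.

Lemma L2_multE (u : L2 mu) :
  {ae mu, forall x, L2_repr (L2_mult f u) x = f x * L2_repr u x}.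
Proof.
apply: L2_classK; apply: sq_integrable_bounded mf _ fM.
exact: sq_integrable_repr.
Qed.

Lemma L2_mult_adjoint (u v : L2 mu) :
  L2_ip (L2_mult (fun x => (f x)^*%C) u) v = L2_ip u (L2_mult f v).
Proof.
have uL := sq_integrable_repr u; have vL := sq_integrable_repr v.
have fuL : sq_integrable mu (fun x => (f x)^*%C * L2_repr u x).
  apply: sq_integrable_bounded (cmeasurableJ mf) uL _ => x.
  by rewrite cmodJ; exact: fM.
have fvL := sq_integrable_bounded mf vL fM.
rewrite (L2_ipE fuL vL (L2_classK fuL) (aeW _ (frefl _))).
rewrite (L2_ipE uL fvL (aeW _ (frefl _)) (L2_classK fvL)).
by congr cintegral; apply/funext => x; rewrite rmorphM/= conjcK mulrCA mulrA.
Qed.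

Hypothesis kA : schur_kernel mu (comm_kernel df a f) A.

Lemma L2_mult_frac_dom (u : L2 mu) :
  frac_dom df a u -> frac_dom df a (L2_mult f u).
Proof.
have [mu_u u2] := sq_integrable_repr u.
have mfu := cmeasurableM mf mu_u.
move=> /(frac_domP df a X_compact mu_u (aeW mu (frefl _))) du.
apply/(frac_domP df a X_compact mfu (L2_multE u)).
have ik := kernel_integrable_sqr kA (sq_integrable_repr u).
set D := fun z : borel X * borel X => mdist (z.1 : X) z.2 `^ (df + 2 * a).
pose G1 z := cmod (L2_repr u z.1 - L2_repr u z.2) ^+ 2 / D z.
pose G2 z := cmod (comm_kernel df a f z.1 z.2) * cmod (L2_repr u z.2) ^+ 2.
have iG : (mu \x mu)%E.-integrable setT
    (fun z => (2 * M ^+ 2 * G1 z + 4 * M * G2 z)%:E).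
  under eq_fun do rewrite EFinD [(_ * G1 _)%:E]EFinM [(_ * G2 _)%:E]EFinM.
  by apply: integrableD => //; exact: integrableZl.
apply: (le_integrable measurableT _ _ iG).
  apply/measurable_EFinP/measurable_funM.
    apply/measurable_funX/measurable_cmod/cmeasurableB.
      exact: (cmeasurable_fst mfu).
    exact: (cmeasurable_snd mfu).
  under eq_fun do rewrite -powRN.
  exact: (measurableT_comp (measurable_powR _) (mdist_measurable2 X_compact)).
move=> z _; have M0 : 0 <= M := le_trans (cmod_ge0 _) (fM z.1).
have D0 : 0 <= (D z)^-1 by rewrite invr_ge0 powR_ge0.
have G10 : 0 <= G1 z by rewrite mulr_ge0 ?sqr_ge0 ?cmod_ge0.
have G20 : 0 <= G2 z by rewrite mulr_ge0 ?sqr_ge0 ?cmod_ge0.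
rewrite !abse_EFin lee_fin !ger0_norm ?addr_ge0 ?mulr_ge0 ?sqr_ge0 ?cmod_ge0//.
have kE : cmod (comm_kernel df a f z.1 z.2) = cmod (f z.1 - f z.2) * (D z)^-1.
  by rewrite cmod_comm_kernel powRN.
rewrite /G1 /G2 kE.
have -> : f z.1 * L2_repr u z.1 - f z.2 * L2_repr u z.2 =
    f z.1 * (L2_repr u z.1 - L2_repr u z.2) + (f z.1 - f z.2) * L2_repr u z.2.
  by ring.
have := cmodD (f z.1 * (L2_repr u z.1 - L2_repr u z.2))
  ((f z.1 - f z.2) * L2_repr u z.2).
rewrite !cmodM; set p := cmod (_ + _); have p0 : 0 <= p by exact: cmod_ge0.
have f1 := fM z.1; have f12 : cmod (f z.1 - f z.2) <= 2 * M.
  apply: le_trans (cmodD _ _) _; rewrite cmodN; have := fM z.2; lra.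
have c1 := cmod_ge0 (f z.1); have c2 := cmod_ge0 (f z.1 - f z.2).
have c3 := cmod_ge0 (L2_repr u z.1 - L2_repr u z.2).
have c4 := cmod_ge0 (L2_repr u z.2).
move: (cmod (f z.1)) (cmod (f z.1 - f z.2))
  (cmod (L2_repr u z.1 - L2_repr u z.2))
  (cmod (L2_repr u z.2)) (D z)^-1 D0 f1 f12 c1 c2 c3 c4.
move=> q r v w i i0 qM rM q0 r0 v0 w0 pq.
have -> : 2 * M ^+ 2 * (v ^+ 2 * i) + 4 * M * (r * i * w ^+ 2) =
  (2 * (M * v) ^+ 2 + 2 * ((2 * M) * r * w ^+ 2)) * i by ring.
apply: ler_wpM2r => //.
have s1 : p ^+ 2 <= (q * v + r * w) ^+ 2.
  by rewrite ler_sqr ?nnegrE ?addr_ge0 ?mulr_ge0.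
have s2 : (q * v + r * w) ^+ 2 <= 2 * (q * v) ^+ 2 + 2 * (r * w) ^+ 2.
  by have := sqr_ge0 (q * v - r * w); move: (q * v) (r * w) => ??; nra.
have s3 : (q * v) ^+ 2 <= (M * v) ^+ 2.
  by rewrite ler_sqr ?nnegrE ?mulr_ge0// ler_wpM2r.
have s4 : (r * w) ^+ 2 <= 2 * M * r * w ^+ 2.
  by rewrite exprMn ler_wpM2r ?sqr_ge0// expr2 ler_wpM2r.
lra.
Qed.

End Multiplication.

Variables (f : borel X -> R[i]) (M A : R).
Hypothesis mf : cmeasurable f.
Hypothesis fM : forall x, cmod (f x) <= M.
Hypothesis kA : schur_kernel mu (comm_kernel df a f) A.

Let mfJ : cmeasurable (fun x => (f x)^*%C). Proof. exact: cmeasurableJ. Qed.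
Let fJM x : cmod (f x)^*%C <= M. Proof. by rewrite cmodJ fM. Qed.
Let kJA : schur_kernel mu (comm_kernel df a (fun x => (f x)^*%C)) A.
Proof.
have [A0 mk k1 k2] := kA.
have kE x y : cmod (comm_kernel df a (fun x => (f x)^*%C) x y) =
    cmod (comm_kernel df a f x y).
  by rewrite !cmod_comm_kernel -rmorphB cmodJ.
split; [exact: A0| | |].
- exact: comm_kernel_measurable mfJ.
- by move=> x; under eq_integral do rewrite kE; exact: k1.
- by move=> x; under eq_integral do rewrite kE; exact: k2.
Qed.

(* [conj (g x - g y) (f h x - f h y)
    - conj (conj f g x - conj f g y) (h x - h y)]
   is [(f x - f y) (conj (g x) h y - conj (g y) h x)], and the integral of the
   second term is obtained from that of the first by exchanging [x] and [y]. *)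
Lemma frac_form_commutator (w u : L2 mu) :
  frac_dom df a w -> frac_dom df a u ->
  frac_form df a w (L2_mult f u) =
  frac_form df a (L2_mult (fun x => (f x)^*%C) w) u +
    L2_ip w (kernel_op (comm_kernel df a f) u).
Proof.
move=> dw du; have wL := sq_integrable_repr w; have uL := sq_integrable_repr u.
have [mw _] := wL; have [mu_u _] := uL.
have [c1 ->] := frac_formP X_compact mw (cmeasurableM mf mu_u)
  (aeW mu (frefl _)) (L2_multE mf fM u) dw (L2_mult_frac_dom mf fM kA du).
have [c2 ->] := frac_formP X_compact (cmeasurableM mfJ mw) mu_u
  (L2_multE mfJ fJM w) (aeW mu (frefl _)) (L2_mult_frac_dom mfJ fJM kJA dw) du.
rewrite (kernel_op_ip kA).
pose F (z : borel X * borel X) :=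
  (L2_repr w z.1)^*%C * comm_kernel df a f z.1 z.2 * L2_repr u z.2.
have cF : cintegrable (mu \x mu)%E F.
  exact: (kernel_cintegrable2 kA (sq_integrableJ wL) uL).
have FE z : F (z.2, z.1) =
    form_density df a (L2_repr w) (fun x => f x * L2_repr u x) z -
    form_density df a (fun x => (f x)^*%C * L2_repr w x) (L2_repr u) z - F z.
  rewrite /F /form_density /comm_kernel/= metric_sym.
  rewrite !rmorphB/= !rmorphM/= !conjcK; set i := ((_)%:C%C)^-1.
  by ring.
have cF' : cintegrable (mu \x mu)%E (fun z => F (z.2, z.1)).
  rewrite (funext FE); apply: cintegrableB cF.
  exact: (cintegrableB c1 c2).
have := cintegral_swap cF cF'; rewrite (funext FE) => /esym.
rewrite (cintegralB (cintegrableB c1 c2) cF) (cintegralB c1 c2) => FF.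
have two : (2 : R[i]) != 0 by rewrite pnatr_eq0.
apply: (mulfI two); rewrite mulrDr !mulrA divff// !mul1r.
by rewrite -/F mulr_natl mulr2n {1}FF; ring.
Qed.

Variable Delta : unbounded (L2 mu).
Hypothesis Delta_a : frac_laplacian df a Delta.

Lemma commutator_kernel (u : L2 mu) : dom Delta u ->
  dom Delta (L2_mult f u) /\
  kernel_op (comm_kernel df a f) u =
    Delta (L2_mult f u) - L2_mult f (Delta u).
Proof.
have [_ [S [[[_ _ SA] _] [dSD SSD] dS SE]]] := Delta_a.
move=> du; have [Su SSu] := (dSD u).1 du.
have fu : dom S (L2_mult f u).
  by rewrite dS; apply: (L2_mult_frac_dom mf fM kA); rewrite -dS.
have : adjoint_graph (@L2_ip _ _ _ mu) (dom S) S (S (L2_mult f u))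
    (L2_mult f (Delta u) + kernel_op (comm_kernel df a f) u).
  move=> w dw; have dw' : frac_dom df a w by rewrite -dS.
  have du' : frac_dom df a u by rewrite -dS.
  have dfw : frac_dom df a (L2_mult (fun x => (f x)^*%C) w).
    exact: (L2_mult_frac_dom mfJ fJM kJA dw').
  have dfu : frac_dom df a (L2_mult f u) by rewrite -dS.
  rewrite -(SE _ _ dw' dfu) (frac_form_commutator dw' du') (SE _ _ dfw du').
  rewrite (ipDr ipP); congr (_ + _).
  rewrite -(L2_mult_adjoint mf fM) (SSD _ du).
  have dSfw : dom S (L2_mult (fun x => (f x)^*%C) w) by rewrite dS.
  exact: ((SA (S u) (S (S u))).2 (conj SSu erefl) _ dSfw).
move=> /SA[dSfu SSfu].
have dDfu : dom Delta (L2_mult f u) := (dSD _).2 (conj fu dSfu).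
split; first exact: dDfu.
by rewrite (SSD _ dDfu) SSfu addrC addKr; reflexivity.
Qed.

Lemma kernel_commutator_cl : exists2 K : {linear L2 mu -> L2 mu},
  commutator_cl Delta f K & forall u, K u = kernel_op (comm_kernel df a f) u.
Proof.
pose K : {linear L2 mu -> L2 mu} := HB.pack (kernel_op (comm_kernel df a f))
  (GRing.isLinear.Build _ _ _ _ _ (kernel_op_linear kA)).
exists K; last by [].
split; first by exists (2 * A) => u; exact: kernel_op_norm.
by move=> u du; exact: commutator_kernel.
Qed.

Lemma commutator_clE (K : {linear L2 mu -> L2 mu}) u :
  commutator_cl Delta f K -> K u = kernel_op (comm_kernel df a f) u.
Proof.
have [K' [bK' K'E] <-] := kernel_commutator_cl => -[bK KE].
have [[[_ dD _] _] _] := Delta_a.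
apply: bounded_linear_ext dD bK bK' _ u => // v dv.
by rewrite (KE v dv).2 (K'E v dv).2.
Qed.

End Commutator.

(** * Singular values of the commutator *)

Section PowerDifference.
Context (R : realType).

(* Comparing [z ^ s] with an integral power of [z] replaces the mean value
   theorem. *)
Lemma powRV_diff (s : R) : 0 < s -> exists2 K : R, 0 < K & forall x y : R,
  0 < x -> 0 < y -> y <= 2 * x ->
  `|x `^ (- s) - y `^ (- s)| <= K * (`|x - y| / x) * y `^ (- s).
Proof.
move=> s0; pose m := (Num.trunc s).+1.
have sm : s <= m%:R by have /andP[_ /ltW] := truncn_itv (ltW s0).
exists (m%:R * 2 ^+ m); first by rewrite mulr_gt0 ?exprn_gt0 ?ltr0n.
move=> x y x0 y0 yx; pose z := y / x.
have z0 : 0 < z by rewrite divr_gt0.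
have z2 : z <= 2 by rewrite ler_pdivrMr.
have zE : z - 1 = (y - x) / x by rewrite /z mulrBl divff ?gt_eqF.
have xE : x `^ (- s) = z `^ s * y `^ (- s).
  rewrite /z powRM ?ltW ?invr_gt0// powRV// mulrAC -powRD_gt0// subrr powRr0.
  by rewrite mul1r.
have -> : x `^ (- s) - y `^ (- s) = (z `^ s - 1) * y `^ (- s).
  by rewrite xE mulrBl mul1r.
rewrite normrM [`|y `^ _|]ger0_norm ?powR_ge0// ler_wpM2r ?powR_ge0//.
have -> : `|x - y| / x = `|z - 1|.
  by rewrite zE normrM distrC [`|x^-1|]ger0_norm// invr_ge0 ltW.
apply: (@le_trans _ _ `|z ^+ m - 1|).
  rewrite -powR_mulrn ?(ltW z0)//; have [z1|/ltW z1] := leP 1 z.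
    have h1 : 1 <= z `^ s by rewrite -(powRr0 z) ler_powR// ltW.
    have h2 : z `^ s <= z `^ m%:R by exact: ler_powR.
    by rewrite !ger0_norm ?lerD2r// subr_ge0 ?(le_trans h1).
  have z01 : 0 < z <= 1 by rewrite z0.
  have h1 : z `^ s <= 1 by rewrite -(powRr0 z); apply: ger_powR => //;
    exact: ltW.
  have h2 : z `^ m%:R <= z `^ s by exact: ger_powR.
  by rewrite !ler0_norm ?lerN2 ?lerD2r// subr_le0 ?(le_trans h2).
rewrite subrX1 normrM mulrC ler_wpM2r//.
apply: le_trans (ler_norm_sum _ _ _) _.
rewrite -[m in X in _ <= X * _]card_ord -sum1_card natr_sum mulr_suml.
apply: ler_sum => i _; rewrite mul1r normrX ger0_norm ?(ltW z0)//.
apply: (@le_trans _ _ (2 ^+ i)); first by apply: lerXn2r;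
  rewrite ?nnegrE ?(ltW z0).
by rewrite ler_eXn2l ?ltr1n// ltnW.
Qed.

End PowerDifference.

Section KernelApproximation.
Context (R : realType) (X : pmetricType R).
Variables (mu : {finite_measure set (borel X) -> \bar R}) (df a b : R).
Hypothesis X_compact : compact [set: X].
Hypothesis df_gt0 : 0 < df.
Hypothesis mu_regular : ahlfors_regular mu df.
Hypothesis a_gt0 : 0 < 2 * a.
Hypothesis b_gt : 2 * a < b.
Hypothesis b_le1 : b <= 1.

Let s := df + 2 * a.
Let t := b - 2 * a.
Let s_gt0 : 0 < s. Proof. exact: addr_gt0. Qed.
Let t_gt0 : 0 < t. Proof. by rewrite subr_gt0. Qed.
Let b_gt0 : 0 < b. Proof. exact: lt_trans b_gt. Qed.
Let k := @comm_kernel R X df a.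

Lemma comm_kernel_shift : exists2 C : R, 0 < C &
  forall (f : X -> R[i]) (L r : R) (x y c : X), 0 <= L -> 0 < r ->
  (forall x y : X, cmod (f x - f y) <= L * mdist x y `^ b) ->
  mdist c y <= r -> 3 * r <= mdist x c ->
  cmod (k f x y - k f x c) <= C * L * r `^ b * mdist x y `^ (- s).
Proof.
have [K K0 KP] := powRV_diff s_gt0.
exists ((K + 1) * 2 `^ `|- s|); first by rewrite mulr_gt0 ?addr_gt0 ?powR_gt0.
move=> f L r x y c L0 r0 fL cy xc.
have xy_xc := le_trans (mdist_lip c y x) cy;
  rewrite ![mdist _ x]metric_sym in xy_xc.
have xy : 2 * r <= mdist x y.
  by move: xy_xc; rewrite ler_norml => /andP[_]; lra.
have xc_xy : mdist x c <= 2 * mdist x y.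
  by move: xy_xc; rewrite ler_norml => /andP[_]; lra.
have xy_xc2 : mdist x y / 2 <= mdist x c.
  by move: xy_xc; rewrite ler_norml => /andP[? _]; lra.
rewrite /k /comm_kernel.
have fcy := fL c y; have fxy := fL x y.
rewrite -!fmorphV -!powRN -/s.
move: (mdist x y) (mdist x c) xy xc_xy xy_xc2 xy_xc xc fxy
  => d e rd ed de dist re fxy.
have d0 : 0 < d by lra.
have e0 : 0 < e by lra.
have -> : (f x - f y) * (d `^ (- s))%:C%C - (f x - f c) * (e `^ (- s))%:C%C =
  (f x - f y) * (d `^ (- s) - e `^ (- s))%:C%C +
    (f c - f y) * (e `^ (- s))%:C%C.
  by rewrite rmorphB/=; ring.
apply: le_trans (cmodD _ _) _; rewrite !cmodM !cmodC.
rewrite [`|e `^ _|]ger0_norm ?powR_ge0//.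
have es : e `^ (- s) <= 2 `^ `|- s| * d `^ (- s) by exact: powR_comparable.
have h1 : cmod (f c - f y) <= L * r `^ b.
  apply: le_trans fcy _; rewrite ler_wpM2l//; apply: powR_homo cy _ => //.
    exact: mdist_ge0.
  exact: ltW.
have h2 : `|d `^ (- s) - e `^ (- s)| <= K * (r / d) * e `^ (- s).
  apply: le_trans (KP _ _ d0 e0 ed) _; rewrite ler_wpM2r ?powR_ge0//.
  by rewrite ler_wpM2l ?(ltW K0)// ler_pM2r ?invr_gt0// distrC.
have h3 : d `^ b * (r / d) <= r `^ b.
  have rd0 : 0 < r / d by rewrite divr_gt0.
  have rd1 : 0 < r / d <= 1 by rewrite rd0 ler_pdivrMr// mul1r; lra.
  apply: (@le_trans _ _ (d `^ b * (r / d) `^ b)).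
    by rewrite ler_wpM2l ?powR_ge0// ger1_powR.
  by rewrite -powRM ?(ltW rd0) ?(ltW d0)// mulrC divfK// gt_eqF.
apply: (@le_trans _ _ ((K + 1) * L * r `^ b * e `^ (- s))); last first.
  rewrite [X in _ <= X](_ : _ = (K + 1) * L * r `^ b *
    (2 `^ `|- s| * d `^ (- s))).
    by rewrite ler_wpM2l// !mulr_ge0 ?powR_ge0// ?addr_ge0 ?(ltW K0).
  by ring.
apply: (@le_trans _ _ (L * d `^ b * (K * (r / d) * e `^ (- s)) +
    L * r `^ b * e `^ (- s))).
  apply: lerD; last by rewrite ler_wpM2r ?powR_ge0.
  apply: ler_pM => //; exact: cmod_ge0.
rewrite mulrDl mul1r 2!mulrDl lerD2r.
rewrite [leLHS](_ : _ = K * L * (d `^ b * (r / d)) * e `^ (- s)); last by ring.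
by rewrite ler_wpM2r ?powR_ge0// ler_wpM2l// mulr_ge0 ?(ltW K0).
Qed.

Let shell (C L r : R) (u : R) : R :=
  L * (u `^ (t - df) * \1_`]0, 8 * r] u) +
  C * L * (2 * r) `^ b * (u `^ (- df - 2 * a) * \1_`[4 * r, +oo[ u).

Let shell_integral (C : R) : 0 < C -> exists2 M : R, 0 < M &
  forall (x : X) (L r : R), 0 < L -> 0 < r ->
  (\int[mu]_y (shell C L r (mdist x y))%:E <= (M * L * r `^ t)%:E)%E.
Proof.
move=> C0; have [C1 C10 C1P] :=
  punctured_ball_upper X_compact df_gt0 mu_regular.
have [M1 M10 M1P] := near_integral C10 C1P t_gt0.
have [M2 M20 M2P] := far_integral C10 C1P a_gt0.
exists (M1 * 8 `^ t + C * 2 `^ b * M2 * 4 `^ (- (2 * a))).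
  by rewrite addr_gt0 ?mulr_gt0 ?powR_gt0.
move=> x L r L0 r0.
have m1 : measurable_fun setT (fun y : borel X =>
    (mdist x y `^ (t - df) * \1_`]0, 8 * r] (mdist x y))%:E).
  apply/measurable_EFinP; apply: (measurable_mdist_comp x
    (h := fun u => u `^ (t - df) * \1_`]0, 8 * r] u)).
  by apply: measurable_funM; [exact: measurable_powR|exact: measurable_indic].
have m2 : measurable_fun setT (fun y : borel X =>
    (mdist x y `^ (- df - 2 * a) * \1_`[4 * r, +oo[ (mdist x y))%:E).
  apply/measurable_EFinP; apply: (measurable_mdist_comp x
    (h := fun u => u `^ (- df - 2 * a) * \1_`[4 * r, +oo[ u)).
  by apply: measurable_funM; [exact: measurable_powR|exact: measurable_indic].
have r80 : 0 < 8 * r by rewrite mulr_gt0.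
have r40 : 0 < 4 * r by rewrite mulr_gt0.
have CL0 : 0 <= C * L * (2 * r) `^ b by rewrite !mulr_ge0 ?powR_ge0 ?ltW.
have nn (v w : R) (A : set R) : (0 <= (v `^ w * \1_A v)%:E)%E.
  by rewrite lee_fin mulr_ge0 ?powR_ge0.
rewrite /shell; under eq_integral do rewrite EFinD EFinM
  [(_ * (_ * \1_`[_, +oo[ _))%:E]EFinM.
rewrite ge0_integralD//; last 4 first.
- by move=> y _; rewrite mule_ge0 ?nn// lee_fin ltW.
- exact: measurable_funeM.
- by move=> y _; rewrite mule_ge0 ?nn// lee_fin.
- exact: measurable_funeM.
rewrite !ge0_integralZl_EFin// ?(ltW L0)//; try by move=> y _; exact: nn.
apply: (@le_trans _ _ (L%:E * (M1 * (8 * r) `^ t)%:E +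
    (C * L * (2 * r) `^ b)%:E * (M2 * (4 * r) `^ (- (2 * a)))%:E)%E).
  apply: leeD; apply: lee_wpmul2l; rewrite ?lee_fin ?(ltW L0)//.
    exact: M1P.
  exact: M2P.
rewrite -!EFinM -EFinD lee_fin !powRM ?(ltW r0)//.
have -> : r `^ t = r `^ b * r `^ (- (2 * a)) by rewrite -powRD_gt0.
rewrite le_eqVlt; apply/orP; left; apply/eqP; ring.
Qed.

Let cell n (c : 'I_n -> X) (r : R) (i : 'I_n) : set (borel X) :=
  cball (c i) r `\` \big[setU/set0]_(j < n | (j < i)%N) cball (c j) r.

Let cellP n (c : 'I_n -> X) (r : R) (y : X) :
  (exists i, mdist (c i) y <= r) -> exists i, mdist (c i) y <= r /\
    forall j, (\1_(cell c r j) y : R) = (j == i)%:R.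
Proof.
move=> [i0 i0P].
case: (@arg_minnP _ i0 (fun i => mdist (c i) y <= r) val i0P) => i iP imin.
exists i; split=> // j; rewrite indicE; congr (nat_of_bool _)%:R.
have cellE l : (cell c r l) y <-> mdist (c l) y <= r /\
    forall m : 'I_n, (m < l)%N -> ~ (mdist (c m) y <= r).
  rewrite /cell -bigcup_seq_cond /=; split=> [[h1 h2]|[h1 h2]]; split=> //.
    by move=> m ml hm; apply: h2; exists m => //=; rewrite mem_index_enum.
  by move=> [m /= /andP[_ ml] hm]; exact: (h2 m).
apply/idP/eqP => [/set_mem/cellE[jP jmin]|->].
  apply/val_inj/eqP; rewrite eqn_leq imin// andbT leqNgt.
  by apply/negP => /jmin; rewrite iP.
apply/mem_set/cellE; split=> // m mi hm.
by have := imin m hm; rewrite leqNgt mi.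
Qed.

Lemma comm_kernel_approx : exists2 M : R, 0 < M &
  forall (f : X -> R[i]) (L r : R), 0 < L -> 0 < r ->
  (forall x y : X, cmod (f x - f y) <= L * mdist x y `^ b) ->
  exists (n : nat) (Q : 'I_n -> set (borel X)) (phi : 'I_n -> borel X -> R[i])
    (k' : borel X -> borel X -> R[i]) (B : R),
    [/\ n%:R <= Num.max 1 (M * r `^ (- df)),
        forall i, measurable (Q i),
        forall i, cmeasurable (phi i) /\ forall x, cmod (phi i x) <= B,
        forall x y, k f x y = k' x y + \sum_i phi i x * (\1_(Q i) y : R)%:C%C &
        schur_kernel mu k' (M * L * r `^ t)].
Proof.
have [C C0 CP] := comm_kernel_shift.
have [M1 M10 M1P] := shell_integral C0.
have [M2 M20 M2P] := separated_size X_compact mu_regular.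
exists (M1 + M2); first exact: addr_gt0.
move=> f L r L0 r0 fL.
have mf : cmeasurable (f : borel X -> R[i]) := hoelder_cmeasurable b_gt0 fL.
have [M fM] := hoelder_bounded X_compact b_gt0 fL.
have mk := comm_kernel_measurable df a X_compact mf.
have [l [lr lP]] := separated_net X_compact r0.
pose n := size l; pose c (i : 'I_n) := nth (point : X) l i.
have cP y : exists i, mdist (c i) y <= 2 * r.
  have [z zl yz] := lP y.
  have zn : (index z l < n)%N by rewrite index_mem.
  exists (Ordinal zn); rewrite /c/= nth_index// metric_sym.
  exact: ltW.
pose far x i := if 6 * r <= mdist x (c i) then k f x (c i) else 0.
pose Q := cell c (2 * r).
have mQ i : measurable (Q i).
  apply: measurableD; first exact: measurable_cball.
  by apply: bigsetU_measurable => j _; exact: measurable_cball.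
have mfar i : cmeasurable (fun x : borel X => far x i).
  have -> : (fun x : borel X => far x i) = (fun x =>
      k f x (c i) * (\1_(~` [set x | mdist (x : X) (c i) < 6 * r]) x : R)%:C%C).
    apply/funext => x; rewrite /far indicE leNgt.
    have [xc|xc] := boolP (mdist (x : X) (c i) < 6 * r).
      by rewrite memNset ?mulr0//=; apply; exact: xc.
    by rewrite mem_set ?mulr1//= => h; move: xc; rewrite h.
  apply: cmeasurableM; first exact: (cmeasurable_pair2 (c i : borel X) mk).
  apply: cmeasurable_indic; apply: measurableC.
  have := mdist_measurable (c i).
  move=> /(_ measurableT `]-oo, 6 * r[%classic (measurable_itv _)).
  rewrite setTI; congr (measurable _); apply/seteqP; split => y /=;
    by rewrite in_itv.
have farB i x : cmod (far x i) <= 2 * M * (6 * r) `^ (- s).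
  have M0 : 0 <= M := le_trans (cmod_ge0 _) (fM x).
  rewrite /far; case: ifPn => xc; last first.
    by rewrite cmod0 !mulr_ge0 ?powR_ge0.
  rewrite cmod_comm_kernel; apply: ler_pM; rewrite ?powR_ge0 ?cmod_ge0//.
    apply: le_trans (cmodD _ _) _; rewrite cmodN.
    by have := fM x; have := fM (c i); lra.
  rewrite !powRN lef_pV2 ?posrE ?powR_gt0 ?mulr_gt0//; last first.
    by apply: lt_le_trans xc; rewrite mulr_gt0.
  by apply: powR_homo; rewrite ?mulr_ge0 ?(ltW r0) ?(ltW s_gt0).
pose k' (x y : borel X) := k f x y - \sum_i far x i * (\1_(Q i) y : R)%:C%C.
exists n, Q, (fun i x => far x i), k', (2 * M * (6 * r) `^ (- s)).
have nM : n%:R <= Num.max 1 (M2 * r `^ (- df)) by exact: M2P.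
split=> //.
- apply: le_trans nM _; rewrite ge_max !le_max lexx/=.
  by rewrite ler_wpM2r ?powR_ge0 ?lerDr ?(ltW M10) ?orbT.
- by move=> x y; rewrite /k' subrK.
have mk' : cmeasurable (fun z : borel X * borel X => k' z.1 z.2).
  apply: cmeasurableB => //; apply: cmeasurable_sum => i.
  apply: cmeasurableM; first exact: (cmeasurable_fst (mfar i)).
  apply: (cmeasurable_snd (f := fun y => (\1_(Q i) y : R)%:C%C)).
  exact: cmeasurable_indic.
have k'h x y : cmod (k' x y) <= shell C L r (mdist (x : X) y).
  have [i [yi yQ]] := cellP (cP y).
  have -> : k' x y = k f x y - far x i.
    rewrite /k'; congr (_ - _); rewrite (bigD1 i)//= big1 ?addr0.
      by rewrite yQ eqxx mulr1.
    by move=> j /negPf ji; rewrite yQ ji mulr0.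
  have s1 : 0 <= L * (mdist (x : X) y `^ (t - df) *
      \1_`]0, 8 * r] (mdist (x : X) y)).
    by rewrite !mulr_ge0 ?powR_ge0 ?(ltW L0).
  have s2 : 0 <= C * L * (2 * r) `^ b * (mdist (x : X) y `^ (- df - 2 * a) *
      \1_`[4 * r, +oo[ (mdist (x : X) y)).
    by rewrite !mulr_ge0 ?powR_ge0 ?(ltW L0) ?(ltW C0).
  rewrite /far; case: ifPn => xc.
    rewrite /shell ler_wpDl//.
    have xy : 4 * r <= mdist (x : X) y.
      have := le_trans (mdist_lip (c i) y x) yi.
      by rewrite [mdist _ x]metric_sym [mdist y x]metric_sym
        ler_norml => /andP[_]; lra.
    rewrite indicE mem_set ?mulr1/=; last by rewrite in_itv/= xy.
    rewrite -opprD; apply: CP fL yi _; rewrite ?(ltW L0) ?mulr_gt0//.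
    by rewrite mulrA -natrM.
  rewrite subr0 /shell ler_wpDr//.
  apply: le_trans (cmod_comm_kernel_le df a x y (ltW L0) fL) _.
  rewrite ler_wpM2l ?(ltW L0)// ler_wpM2l ?powR_ge0// !indicE.
  rewrite ler_nat; have [/set_mem|//] := boolP (_ \in `]0, +oo[%classic).
  rewrite /= in_itv/= andbT => xy0; rewrite mem_set//= in_itv/= xy0/=.
  have := le_trans (mdist_lip (c i) y x) yi; move: xc; rewrite -ltNge.
  by rewrite [mdist _ x]metric_sym [mdist y x]metric_sym ler_norml => ? /andP[];
    lra.
have mshell x : measurable_fun setT
    (fun y : borel X => (shell C L r (mdist (x : X) y))%:E).
  apply/measurable_EFinP; apply: (measurable_mdist_comp x).
  by apply: measurable_funD; apply: measurable_funM => //;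
    apply: measurable_funM; [exact: measurable_powR|exact: measurable_indic|
      exact: measurable_powR|exact: measurable_indic].
have rt : 0 < r `^ t by exact: powR_gt0.
have le1 (x : X) : (\int[mu]_y (shell C L r (mdist x y))%:E <=
    ((M1 + M2) * L * r `^ t)%:E)%E.
  apply: le_trans (M1P x L r L0 r0) _; rewrite lee_fin.
  by rewrite !ler_wpM2r ?(ltW L0) ?(ltW rt)// lerDl ltW.
split.
- by rewrite !mulr_gt0 ?addr_gt0.
- exact: mk'.
- move=> x; apply: le_trans (le1 x); apply: ge0_le_integral => //.
  + by move=> y _; rewrite lee_fin cmod_ge0.
  + apply/measurable_EFinP/measurable_cmod.
    exact: (cmeasurable_pair1 (x : borel X) mk').
  + by move=> y _; rewrite lee_fin; exact: k'h.
- move=> y; apply: le_trans (le1 y); apply: ge0_le_integral => //.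
  + by move=> x _; rewrite lee_fin cmod_ge0.
  + apply/measurable_EFinP/measurable_cmod.
    exact: (cmeasurable_pair2 (y : borel X) mk').
  + by move=> x _; rewrite lee_fin [mdist y x]metric_sym; exact: k'h.
Qed.

End KernelApproximation.

Section SingularValues.
Context (R : realType) (H : lmodType R[i]) (ip : H -> H -> R[i]).
Hypothesis ipP : is_inner_product ip.

Lemma singular_values_exist (K Ks : {linear H -> H}) :
  (forall u v, ip (K u) v = ip u (Ks v)) ->
  bounded_op ip K -> bounded_op ip Ks -> compact_op ip K ->
  (forall c, 0 < c -> exists n, approximable ip K n c) ->
  exists s, singular_values ip K s /\
    forall n c, 0 <= c -> approximable ip K n c -> s n <= c.
Proof.
move=> K_adj bK bKs cK K_approx.
have [e [s es]] := singular_system_exists ipP K_adj bK bKs cK.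
have sc n c : 0 <= c -> approximable ip K n c -> s n <= c.
  exact: (singular_le_approx ipP K_adj es).
exists s; split=> //; apply: (singular_system_values ipP K_adj es).
have s_ge0 n : 0 <= s n.
  by case: es => _ _ _ /(_ n)[[-> _]|[/ltW]].
apply/cvgrPdist_le => c c0; have [n nP] := K_approx c c0.
exists n => // m /= nm; rewrite sub0r normrN ger0_norm//.
by apply: sc; [exact: ltW|exact: approximableW nP].
Qed.

End SingularValues.

Section DyadicSeries.
Context (R : realType).

Lemma series_powR_bound (q : R) : 1 < q -> exists2 S : R, 0 < S &
  forall n, \sum_(k < n) k.+1%:R `^ (- q) <= S.
Proof.
move=> q1; pose z : R := 2 `^ (1 - q).
have z0 : 0 < z by exact: powR_gt0.
have z1 : z < 1.
  have q10 : 0 < q - 1 by rewrite subr_gt0.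
  rewrite /z -opprB powRN invf_lt1 ?powR_gt0//
    -[ltLHS](congr1 (@^~ (q - 1)) (powR1 R)).
  by apply: gt0_ltr_powR; rewrite ?nnegrE ?ltr1n.
pose G j := \sum_(i < j) z ^+ i.
have block j : \sum_(k < (2 ^ j)%N) k.+1%:R `^ (- q) <= 1 + G j.
  elim: j => [|j IH].
    by rewrite /G expn0 big_ord_recl !big_ord0 powR1 /= !addr0.
  rewrite /G big_ord_recr/= addrA -/(G j) expnS mul2n -addnn big_split_ord/=.
  apply: lerD => //.
  apply: (@le_trans _ _ (\sum_(i < (2 ^ j)%N) (2 ^ j)%:R `^ (- q))).
    apply: ler_sum => i _; rewrite !powRN lef_pV2 ?posrE ?powR_gt0//.
    by apply: powR_homo; rewrite ?ler_nat ?ltW ?(lt_trans _ q1)// leqW//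
      leq_addr.
  rewrite sumr_const card_ord -[leLHS]mulr_natl.
  rewrite natrX /z -[2 ^+ j]powR_mulrn// -!powRrM -powRD_gt0//.
  by rewrite -powR_mulrn ?powR_ge0// -powRrM le_eqVlt; apply/orP; left;
    apply/eqP; congr powR; ring.
have Gle j : G j <= (1 - z)^-1.
  rewrite -[leRHS]mul1r ler_pdivlMr ?subr_gt0// mulrC.
  have -> : (1 - z) * G j = 1 - z ^+ j.
    by have := subrX1 z j; rewrite -/(G j) => h; rewrite -opprB mulNr -h opprB.
  by rewrite gerBl exprn_ge0 ?ltW.
exists (1 + (1 - z)^-1); first by rewrite addr_gt0 ?invr_gt0 ?subr_gt0.
move=> n; apply: le_trans (lerD (lexx 1) (Gle n)); apply: le_trans (block n).
have n2 : (n <= 2 ^ n)%N by apply: ltnW; exact: ltn_expl.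
rewrite -(subnKC n2) big_split_ord/= lerDl.
by apply: sumr_ge0 => i _; exact: powR_ge0.
Qed.

End DyadicSeries.

Section SchattenBound.
Context (R : realType) (X : pmetricType R).
Variables (mu : {finite_measure set (borel X) -> \bar R}) (df a b : R).
Hypothesis X_compact : compact [set: X].
Hypothesis df_gt0 : 0 < df.
Hypothesis mu_regular : ahlfors_regular mu df.
Hypothesis a_gt0 : 0 < 2 * a.
Hypothesis b_gt : 2 * a < b.
Hypothesis b_le1 : b <= 1.

Let t := b - 2 * a.
Let t_gt0 : 0 < t. Proof. by rewrite subr_gt0. Qed.
Let b_gt0 : 0 < b. Proof. exact: lt_trans b_gt. Qed.
Let ip := @L2_ip _ _ _ mu.
Let ipP : is_inner_product ip := L2_inner_product mu.
Let K f : L2 mu -> L2 mu := kernel_op (comm_kernel df a f).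

Lemma hoelder_schur : exists2 M : R, 0 < M &
  forall (f : X -> R[i]) (L : R), 0 < L ->
  (forall x y : X, cmod (f x - f y) <= L * mdist x y `^ b) ->
  schur_kernel mu (comm_kernel df a f) (M * L).
Proof.
have [C C0 CP] := punctured_ball_upper X_compact df_gt0 mu_regular.
exact: (comm_kernel_schur X_compact a_gt0 C0 CP b_gt).
Qed.

Lemma comm_op_approximable : exists2 C : R, 0 < C &
  forall (f : X -> R[i]) (L : R), 0 < L ->
  (forall x y : X, cmod (f x - f y) <= L * mdist x y `^ b) ->
  forall n, approximable ip (K f) n (C * L * n.+1%:R `^ (- (t / df))).
Proof.
have [M1 M10 M1P] := hoelder_schur.
have [M M0 MP] := comm_kernel_approx X_compact df_gt0 mu_regular a_gt0 b_gt
  b_le1.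
have tdf : 0 < t / df by rewrite divr_gt0.
pose C := 2 * M1 + 2 * M * (2 * M) `^ (t / df).
have C2 : 0 < 2 * M * (2 * M) `^ (t / df)
  by rewrite !mulr_gt0 ?powR_gt0 ?mulr_gt0.
have C0 : 0 < C by rewrite addr_gt0// mulr_gt0.
exists C => // f L L0 fL [|n].
  exists (K f), (fun=> 0), (fun=> 0); split=> u;
    first by rewrite big_ord0 addr0.
  apply: le_trans (kernel_op_norm (M1P f L L0 fL) u) _.
  rewrite powR1 /= mulr1 mulrA ler_wpM2r ?ip_norm_ge0//.
  by rewrite ler_wpM2r ?(ltW L0)// lerDl ltW.
have n0 : (0 : R) < n.+1%:R by rewrite ltr0n.
have Mn0 : 0 < M / n.+1%:R by rewrite divr_gt0.
pose r := (M / n.+1%:R) `^ df^-1.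
have r0 : 0 < r by exact: powR_gt0.
have rdf : M * r `^ (- df) = n.+1%:R.
  rewrite /r -powRrM mulrN mulVf ?gt_eqF// powR_inv1 ?(ltW Mn0)// invf_div.
  by rewrite mulrC divfK// gt_eqF.
have [m [Q [phi [k' [B [mn mQ phiP kE k'A]]]]]] := MP f L r L0 r0 fL.
apply: (@approximableW _ _ _ _ m).
  by move: mn; rewrite rdf -(ler_nat R) => /le_trans; apply;
    rewrite ge_max lexx ler1n.
exists (kernel_op k'), (fun i => L2_class mu (fun y => (\1_(Q i) y)%:C%C)),
  (fun i => L2_class mu (phi i)); split=> u.
  exact: (kernel_op_split u (M1P f L L0 fL) k'A (fun i => (phiP i).1)
    (fun i => (phiP i).2) mQ kE).
apply: le_trans (kernel_op_norm k'A u) _.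
rewrite ler_wpM2r ?ip_norm_ge0//.
have rt : r `^ t <= (2 * M) `^ (t / df) * n.+2%:R `^ (- (t / df)).
  rewrite -powRV ?ltr0n// -powRM ?invr_ge0 ?ler0n ?mulr_ge0 ?(ltW M0)//.
  rewrite /r -powRrM [df^-1 * t]mulrC; apply: powR_homo;
    rewrite ?(ltW Mn0) ?(ltW tdf)//.
  rewrite ler_pdivlMr ?ltr0n// mulrAC ler_pdivrMr// [2 * M]mulrC -mulrA.
  by rewrite ler_wpM2l ?(ltW M0)// -natrM ler_nat mul2n -addnn addnS addSn !ltnS
    leq_addr.
apply: (@le_trans _ _ (2 *
  (M * L * ((2 * M) `^ (t / df) * n.+2%:R `^ (- (t / df)))))).
  by rewrite ler_wpM2l// ler_wpM2l// mulr_ge0 ?ltW.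
rewrite [leLHS](_ : _ = 2 * M * (2 * M) `^ (t / df) * L *
  n.+2%:R `^ (- (t / df)));
  last by ring.
by rewrite ler_wpM2r ?powR_ge0// ler_wpM2r ?(ltW L0)// lerDr ltW// mulr_gt0.
Qed.

Lemma kernel_linear (k : borel X -> borel X -> R[i]) A : schur_kernel mu k A ->
  exists2 T : {linear L2 mu -> L2 mu}, (forall u, T u = kernel_op k u) &
    bounded_op ip T.
Proof.
move=> kA; pose T : {linear L2 mu -> L2 mu} := HB.pack (@kernel_op _ _ _ mu k)
  (GRing.isLinear.Build _ _ _ _ _ (kernel_op_linear kA)).
by exists T => //; exists (2 * A) => u; exact: kernel_op_norm.
Qed.

Variable Delta : unbounded (L2 mu).
Hypothesis Delta_a : frac_laplacian df a Delta.

Lemma hoelder_commutator_cl (f : X -> R[i]) (L : R) : 0 < L ->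
  (forall x y : X, cmod (f x - f y) <= L * mdist x y `^ b) ->
  exists T : {linear L2 mu -> L2 mu},
    commutator_cl Delta f T /\ forall u, T u = K f u.
Proof.
move=> L0 fL; have [M M0 MP] := hoelder_schur.
have [B fB] := hoelder_bounded X_compact b_gt0 fL.
have [T T1 T2] := kernel_commutator_cl X_compact
  (hoelder_cmeasurable b_gt0 fL) fB (MP f L L0 fL) Delta_a.
by exists T.
Qed.

Lemma hoelder_commutator_clE (f : X -> R[i]) (L : R)
  (T : {linear L2 mu -> L2 mu}) :
  0 < L -> (forall x y : X, cmod (f x - f y) <= L * mdist x y `^ b) ->
  commutator_cl Delta f T -> forall u, T u = K f u.
Proof.
move=> L0 fL fT u; have [M M0 MP] := hoelder_schur.
have [B fB] := hoelder_bounded X_compact b_gt0 fL.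
exact: (commutator_clE X_compact
  (hoelder_cmeasurable b_gt0 fL) fB (MP f L L0 fL) Delta_a u fT).
Qed.

Lemma commutator_cl_adjoint (f : X -> R[i]) (L : R)
  (T : {linear L2 mu -> L2 mu}) :
  0 < L -> (forall x y : X, cmod (f x - f y) <= L * mdist x y `^ b) ->
  commutator_cl Delta f T -> exists2 Ts : {linear L2 mu -> L2 mu},
    (forall u v, ip (T u) v = ip u (Ts v)) & bounded_op ip Ts.
Proof.
move=> L0 fL fT; have [M M0 MP] := hoelder_schur; have kA := MP f L L0 fL.
have [Ts TsE bTs] := kernel_linear (schur_kernelJ kA).
exists Ts => // u v.
by rewrite (hoelder_commutator_clE L0 fL fT) TsE; exact: kernel_op_adjoint kA.
Qed.

Lemma commutator_cl_compact (f : X -> R[i]) (L : R)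
  (T : {linear L2 mu -> L2 mu}) :
  0 < L -> (forall x y : X, cmod (f x - f y) <= L * mdist x y `^ b) ->
  commutator_cl Delta f T ->
  compact_op ip T /\ forall c, 0 < c -> exists n, approximable ip T n c.
Proof.
move=> L0 fL fT; have TE := hoelder_commutator_clE L0 fL fT.
have [C C0 CP] := comm_op_approximable.
have tdf : 0 < t / df by rewrite divr_gt0.
have appr c : 0 < c -> exists n, approximable ip T n c.
  move=> c0; have CL0 : 0 < C * L by rewrite mulr_gt0.
  pose n := Num.trunc ((C * L / c) `^ (t / df)^-1).
  exists n; have [K' [q [g [KE K'a]]]] := CP f L L0 fL n.
  exists K', q, g; split; first by move=> u; rewrite TE KE.
  move=> u; apply: le_trans (K'a u) _; rewrite ler_wpM2r ?ip_norm_ge0//.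
  have n0 : (0 : R) < n.+1%:R by rewrite ltr0n.
  rewrite powRN ler_pdivrMr ?powR_gt0// -ler_pdivrMl// [c^-1 * _]mulrC.
  have cc : 0 <= C * L / c by rewrite divr_ge0 ?ltW.
  have -> : C * L / c = ((C * L / c) `^ (t / df)^-1) `^ (t / df).
    by rewrite -powRrM mulVf ?gt_eqF// powRr1.
  apply: powR_homo; rewrite ?powR_ge0 ?(ltW tdf)//.
  by have /andP[_ /ltW] := truncn_itv (powR_ge0 (C * L / c) (t / df)^-1).
split=> //; apply: (compact_op_approx ipP); last exact: appr.
move=> w w_fast; apply: L2_complete w_fast.
by rewrite -ge0_fin_numE// fin_num_measure.
Qed.

Lemma hoelder_admissible (p : R) : df / t < p -> exists2 c : R, 0 < c &
  forall f : X -> R[i],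
  (forall x y : X, cmod (f x - f y) <= c * mdist x y `^ b) ->
  exists2 T, commutator_cl Delta f T & (schatten_norm ip p T <= 1)%E.
Proof.
move=> tp; have p0 : 0 < p by apply: lt_trans tp; rewrite divr_gt0.
have [C C0 CP] := comm_op_approximable.
have [S S0 SP] : exists2 S : R, 0 < S &
    forall n, \sum_(k < n) k.+1%:R `^ (- (p * (t / df))) <= S.
  apply: series_powR_bound; rewrite -ltr_pdivrMr ?divr_gt0//.
  by rewrite mul1r invf_div.
pose c := S `^ (- p^-1) / C.
have c0 : 0 < c by rewrite divr_gt0 ?powR_gt0.
exists c => // f fc; have [T [fT TE]] := hoelder_commutator_cl c0 fc.
exists T => //; have [Ts Tadj bTs] := commutator_cl_adjoint c0 fc fT.
have [cT Tappr] := commutator_cl_compact c0 fc fT.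
have [s [sT sa]] := singular_values_exist ipP Tadj fT.1 bTs cT Tappr.
have [s_ge0 _ _ _] := sT.
have sn n : s n <= S `^ (- p^-1) * n.+1%:R `^ (- (t / df)).
  apply: sa; first by rewrite mulr_ge0 ?powR_ge0.
  have [K' [q [g [KE K'a]]]] := CP f c c0 fc n.
  exists K', q, g; split; first by move=> u; rewrite TE KE.
  have cE : C * c = S `^ (- p^-1) by rewrite mulrC divfK// gt_eqF.
  by move: K'a; rewrite cE.
apply: (@le_trans _ _ ('N[counting]_(p%:E)[EFin \o s])%E).
  by apply: ereal_inf_lbound; exists s.
rewrite (Lnorm_counting _ p0) -(poweR1r p^-1).
apply: gt0_ler_poweR; rewrite ?invr_ge0 ?(ltW p0) ?in_itv/= ?leey ?andbT//.
  by apply: nneseries_ge0 => n _ _; rewrite lee_fin powR_ge0.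
apply: nneseries_le => [n|n]; first by rewrite lee_fin powR_ge0.
apply: (@le_trans _ _ (\sum_(0 <= k < n)
  (S^-1 * k.+1%:R `^ (- (p * (t / df))))%:E)%E).
  apply: lee_sum => k _ /=; rewrite ger0_norm// lee_fin.
  apply: le_trans (powR_homo (s_ge0 k) (sn k) (ltW p0)) _.
  rewrite powRM ?powR_ge0// -!powRrM mulNr mulVf ?gt_eqF//.
  by rewrite powR_inv1 ?(ltW S0)// mulNr [t / df * p]mulrC.
rewrite sumEFin lee_fin -mulr_sumr big_mkord mulrC ler_pdivrMr// mul1r.
exact: SP.
Qed.

End SchattenBound.

(** * Oscillation of admissible functions *)

Section Oscillation.
Context (R : realType) (X : pmetricType R).
Variables (mu : {finite_measure set (borel X) -> \bar R}) (df a b : R).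
Hypothesis X_compact : compact [set: X].
Hypothesis df_gt0 : 0 < df.
Hypothesis mu_regular : ahlfors_regular mu df.
Hypothesis a_gt0 : 0 < 2 * a.
Hypothesis b_gt : 2 * a < b.
Hypothesis b_le1 : b <= 1.
Variable Delta : unbounded (L2 mu).
Hypothesis Delta_a : frac_laplacian df a Delta.

Let s := df + 2 * a.
Let s_gt0 : 0 < s. Proof. exact: addr_gt0. Qed.
Let b_gt0 : 0 < b. Proof. exact: lt_trans b_gt. Qed.
Let ip := @L2_ip _ _ _ mu.
Let ipP : is_inner_product ip := L2_inner_product mu.

Lemma contraction_of_schatten (p : R) (f : X -> R[i]) (L : R)
    (T : {linear L2 mu -> L2 mu}) : 0 < p -> 0 < L ->
  (forall x y : X, cmod (f x - f y) <= L * mdist x y `^ b) ->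
  commutator_cl Delta f T -> (schatten_norm ip p T <= 1)%E ->
  forall u, ip_norm ip (T u) <= ip_norm ip u.
Proof.
move=> p0 L0 fL fT T1 u.
have [Ts Tadj bTs] := commutator_cl_adjoint X_compact df_gt0 mu_regular a_gt0
  b_gt Delta_a L0 fL fT.
have [cT _] := commutator_cl_compact X_compact df_gt0 mu_regular a_gt0
  b_gt b_le1 Delta_a L0 fL fT.
have [u0|u0] := eqVneq (ip_norm ip u) 0.
  by rewrite (ip_norm_eq0 ipP u0) raddf0 (ip_norm0 ipP).
have {}u0 : 0 < ip_norm ip u by rewrite lt_neqAle eq_sym u0 ip_norm_ge0.
rewrite -[leRHS]mul1r -ler_pdivrMr// -lee_fin; apply: le_trans T1.
apply: le_ereal_inf_tmp => _ [s' [_ s'T] <-].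
have := op_norm_le_schatten_norm ipP Tadj fT.1 bTs cT p0 s'T u.
by rewrite EFinM -lee_pdivrMr.
Qed.

Let indic_class (B : set (borel X)) : L2 mu :=
  L2_class mu (fun y => (\1_B y : R)%:C%C).

Let indic_sq (B : set (borel X)) : measurable B ->
  sq_integrable mu (fun y => (\1_B y : R)%:C%C).
Proof.
move=> mB; apply: (@bounded_sq_integrable _ _ _ _ _ 1).
  exact: cmeasurable_indic.
by move=> y; exact: cmod_indic.
Qed.

Let indic_classE (B : set (borel X)) : measurable B ->
  {ae mu, forall x, L2_repr (indic_class B) x = (\1_B x : R)%:C%C}.
Proof. by move=> mB; apply: L2_classK; exact: indic_sq. Qed.

Let indic_class_norm (B : set (borel X)) : measurable B ->
  ip_norm ip (indic_class B) ^+ 2 = fine (mu B).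
Proof.
move=> mB; apply: EFin_inj.
rewrite (L2_norm_sqrE (indic_sq mB).1 (indic_classE mB)).
rewrite fineK ?fin_num_measure// -[in RHS](setIT B) -integral_indic//.
apply: eq_integral => x _; rewrite cmodC indicE.
by case: (_ \in _); rewrite ?normr1 ?expr1n// normr0 expr0n.
Qed.

Lemma kernel_op_test (k : borel X -> borel X -> R[i]) (A m : R) (t : R[i])
    (B B' : set (borel X)) : schur_kernel mu k A -> measurable B ->
  measurable B' -> cmod t = 1 ->
  (forall u, ip_norm ip (kernel_op k u) <= ip_norm ip u) ->
  (forall x y, B' x -> B y -> m <= complex.Re (t * k x y)) ->
  m * (fine (mu B') * fine (mu B)) <=
    Num.sqrt (fine (mu B')) * Num.sqrt (fine (mu B)).
Proof.
move=> kA mB mB' t1 k1 km.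
pose u := indic_class B; pose v := indic_class B'.
have Nu : ip_norm ip u = Num.sqrt (fine (mu B)).
  by rewrite -indic_class_norm// sqrtr_sqr ger0_norm// ip_norm_ge0.
have Nv : ip_norm ip v = Num.sqrt (fine (mu B')).
  by rewrite -indic_class_norm// sqrtr_sqr ger0_norm// ip_norm_ge0.
rewrite -Nu -Nv.
apply: (@le_trans _ _ (cmod (ip v (kernel_op k u)))); last first.
  apply: le_trans (cauchy_schwarz ipP _ _) _.
  by rewrite ler_wpM2l ?ip_norm_ge0// k1.
pose F (z : borel X * borel X) := (\1_B' z.1 : R)%:C%C * k z.1 z.2 *
  (\1_B z.2 : R)%:C%C.
have cF : cintegrable (mu \x mu)%E F.
  exact: (kernel_cintegrable2 kA (indic_sq mB') (indic_sq mB)).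
have -> : ip v (kernel_op k u) = cintegral (mu \x mu)%E setT F.
  rewrite /ip (kernel_op_ip kA).
  have c1 := kernel_cintegrable2 kA (sq_integrableJ (sq_integrable_repr v))
    (sq_integrable_repr u).
  apply: ae_eq_cintegral (cintegrable_measurable c1) (cintegrable_measurable cF)
    _.
  apply: filterS2 (ae_prod (indic_classE mB)) (ae_prod (indic_classE mB')).
  by move=> z [_ u2] [v1 _]; rewrite /F /u /v u2 v1 conjc_real.
rewrite -[leRHS]mul1r -t1 -cmodM -cintegralZ//.
apply: le_trans (le_trans (ler_norm _) (Re_le_cmod _)).
have [ctF _] := cintegrableZ t cF.
have mBB : measurable (B' `*` B) by exact: measurableX.
have i1 : (mu \x mu)%E.-integrable setT (fun z => (\1_(B' `*` B) z : R)%:E).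
  apply/integrableP; split.
    by apply/measurable_EFinP; exact: measurable_indic.
  under eq_integral do rewrite gee0_abs ?lee_fin//.
  rewrite integral_indic// setIT.
  rewrite -[X in (X < _)%E]/((mu \x mu)%E (B' `*` B)) product_measure1E//.
  by rewrite ltey_eq fin_numM// fin_num_measure.
have iBB : (mu \x mu)%E.-integrable setT
    (fun z => (m * \1_(B' `*` B) z)%:E).
  under eq_fun do rewrite EFinM.
  exact: integrableZl.
have -> : m * (fine (mu B') * fine (mu B)) =
    Rintegral (mu \x mu)%E setT (fun z => m * \1_(B' `*` B) z).
  rewrite /Rintegral; under eq_integral do rewrite EFinM.
  rewrite (integralZl measurableT i1) integral_indic// setIT.
  rewrite -[X in fine (_ * X)]/((mu \x mu)%E (B' `*` B)) product_measure1E//.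
  rewrite fineM//= ?fineM// ?fin_num_measure//.
  by rewrite fin_numM// fin_num_measure.
apply: le_Rintegral => // -[x y] _ /=.
rewrite indicE; case: (boolP (_ \in _)) => [/set_mem/= [xB yB]|].
  by rewrite mulr1 /F/= !indicE !mem_set// mul1r mulr1; exact: km.
move=> /negP xy; rewrite mulr0 /F/= !indicE.
case: (boolP (x \in B')) => [/set_mem xB|_]; last by rewrite !mul0r mulr0.
case: (boolP (y \in B)) => [/set_mem yB|_]; last by rewrite !mulr0.
by exfalso; apply: xy; exact/mem_set.
Qed.

(* Testing the commutator on the indicators of two balls of radius [e * d(x, y)]
   bounds the oscillation at [(x, y)] by [C1 + w / 2] times [d(x, y) ^ (2 a)]
   when [w] is any bound; the best [w] is therefore at most [2 * C1]. *)
Lemma oscillation_step : exists2 C : R, 0 < C &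
  forall (f : X -> R[i]) (A w : R), schur_kernel mu (comm_kernel df a f) A ->
  (forall u, ip_norm ip (kernel_op (comm_kernel df a f) u) <= ip_norm ip u) ->
  (forall x y : X, cmod (f x - f y) <= w * mdist x y `^ (2 * a)) ->
  forall x y : X, cmod (f x - f y) <= (C + w / 2) * mdist x y `^ (2 * a).
Proof.
have [c c0 cP] := ball_lower mu_regular.
pose e : R := 4^-1 * 4^-1 `^ (2 * a)^-1.
have e0 : 0 < e by rewrite mulr_gt0// powR_gt0.
have q1 : (4^-1 : R) `^ (2 * a)^-1 <= 1.
  rewrite powRV// powRN invf_le1 ?powR_gt0//.
  by rewrite -[leLHS](powRr0 (4 : R)) ler_powR ?ler1n// invr_ge0 ltW.
have e4 : e <= 4^-1 by rewrite /e ler_piMr// invr_ge0.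
have ea : e `^ (2 * a) <= 4^-1.
  apply: (@le_trans _ _ ((4^-1 `^ (2 * a)^-1) `^ (2 * a))).
    by apply: powR_homo; rewrite ?(ltW e0) ?(ltW a_gt0)// ler_piMl ?powR_ge0//;
      lra.
  by rewrite -powRrM mulVf ?gt_eqF// powRr1.
exists (2 `^ s / (c * e `^ df)); first by rewrite divr_gt0 ?mulr_gt0 ?powR_gt0.
move=> f A w kA k1 fw x y.
have [->|xy] := eqVneq x y.
  by rewrite subrr cmod0 mdistxx powR0 ?gt_eqF// mulr0.
pose D := mdist x y.
have D0 : 0 < D by rewrite mdist_gt0.
have w0 : 0 <= w.
  have := le_trans (cmod_ge0 _) (fw x y).
  by rewrite pmulr_lge0// powR_gt0.
have [t t1 tf] := cmod_phase (f x - f y).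
pose r := e * D; have r0 : 0 < r by rewrite mulr_gt0.
pose m0 := cmod (f x - f y) - w / 2 * D `^ (2 * a).
rewrite mulrDl -lerBlDr -/D -/m0.
have C0 : 0 <= 2 `^ s / (c * e `^ df) * D `^ (2 * a).
  by rewrite mulr_ge0 ?divr_ge0 ?mulr_ge0 ?powR_ge0 ?(ltW c0).
have [/le_trans/(_ C0)//|m00] := leP m0 0.
have ra : r `^ (2 * a) <= D `^ (2 * a) / 4.
  by rewrite /r powRM ?(ltW e0) ?(ltW D0)// mulrC ler_wpM2l ?powR_ge0.
have osc (z z' : X) : mdist z z' <= r ->
    cmod (f z - f z') <= w / 4 * D `^ (2 * a).
  move=> zr; apply: le_trans (fw z z') _.
  rewrite -mulrA ler_wpM2l// [4^-1 * _]mulrC; apply: le_trans ra.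
  by apply: powR_homo; rewrite ?mdist_ge0 ?(ltW a_gt0).
have test : forall z z' : borel X, cball x r z -> cball y r z' ->
    m0 * (2 * D) `^ (- s) <= complex.Re (t * comm_kernel df a f z z').
  move=> z z' /= xz yz'.
  have zz' : 0 < mdist (z : X) z' <= 2 * D.
    have h1 := le_trans (mdist_lip x z y) xz.
    have h2 := le_trans (mdist_lip y z' z) yz'.
    move: h1 h2; rewrite ![mdist _ z]metric_sym [mdist z y]metric_sym -/D.
    have : r <= D / 4 by rewrite /r mulrC ler_wpM2l// ltW.
    rewrite !ler_norml [mdist z z']metric_sym => ? /andP[? ?] /andP[? ?].
    by apply/andP; split; lra.
  have fzz : m0 <= complex.Re (t * (f z - f z')).
    have -> : f z - f z' = (f x - f y) + ((f z - f x) + (f y - f z')) by ring.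
    rewrite mulrDr tf ReD /=.
    have h1 : cmod (t * (f z - f x + (f y - f z'))) <= w / 2 * D `^ (2 * a).
      rewrite cmodM t1 mul1r; apply: le_trans (cmodD _ _) _.
      rewrite (cmodB (f z)); have := osc x z xz; have := osc y z' yz'.
      by move: (cmod _) (cmod _) => p q; lra.
    have := le_trans (Re_le_cmod _) h1; rewrite ler_norml => /andP[h2 _].
    by rewrite /m0 lerD2l.
  rewrite comm_kernelE mulrA [_ * _%:C%C]mulrC ReMr [leRHS]mulrC.
  case/andP: zz' => zz0 zzD; apply: ler_pM => //;
    rewrite ?powR_ge0 ?(ltW m00)//.
  rewrite !powRN lef_pV2 ?posrE ?powR_gt0 ?mulr_gt0//.
  by apply: powR_homo; rewrite ?(ltW zz0) ?(ltW s_gt0).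
have mB := measurable_cball x r; have mB' := measurable_cball y r.
have := kernel_op_test kA mB' mB t1 k1 test.
have rdiam : 0 <= r < diam X.
  rewrite (ltW r0) (@lt_le_trans _ _ D)// ?mdist_le_diam//.
  by rewrite /r gtr_pMl// (le_lt_trans e4)// invf_lt1// ltr1n.
have lower z : c * r `^ df <= fine (mu (cball z r)).
  by rewrite -lee_fin fineK ?fin_num_measure//;
    [exact: cP|exact: measurable_cball].
have cr0 : 0 < c * r `^ df by rewrite mulr_gt0// powR_gt0.
have := lower x; have := lower y.
move: (fine _) (fine _) => p q cp cq.
have p0 := lt_le_trans cr0 cp; have q0 := lt_le_trans cr0 cq.
rewrite -{1}(sqr_sqrtr (ltW q0)) -{1}(sqr_sqrtr (ltW p0)).
have cp' : Num.sqrt (c * r `^ df) <= Num.sqrt p by exact: ler_wsqrtr.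
have cq' : Num.sqrt (c * r `^ df) <= Num.sqrt q by exact: ler_wsqrtr.
have pq : c * r `^ df <= Num.sqrt p * Num.sqrt q.
  by rewrite -[leLHS](sqr_sqrtr (ltW cr0)) expr2 ler_pM ?sqrtr_ge0.
have pq0 := lt_le_trans cr0 pq.
rewrite -exprMn expr2 mulrA => h.
have {}h : m0 * (2 * D) `^ (- s) * (Num.sqrt p * Num.sqrt q) <= 1.
  by rewrite -(ler_pM2r pq0) mul1r; move: h; rewrite !mulrA.
have {}h : m0 * (2 * D) `^ (- s) * (c * r `^ df) <= 1.
  by apply: le_trans h; rewrite ler_wpM2l// mulr_ge0 ?powR_ge0// ltW.
have DE : 2 `^ s / (c * e `^ df) * D `^ (2 * a) *
    ((2 * D) `^ (- s) * (c * r `^ df)) = 1.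
  rewrite /r powRN !powRM ?(ltW e0) ?(ltW D0)// [D `^ s]powRD_gt0//.
  by field; rewrite ?gt_eqF ?powR_gt0.
have Y0 : 0 < (2 * D) `^ (- s) * (c * r `^ df).
  by rewrite mulr_gt0// powR_gt0// mulr_gt0.
by rewrite -(ler_pM2r Y0) DE [leLHS]mulrA.
Qed.

Lemma oscillation_bound : exists2 C : R, 0 < C &
  forall (p : R) (f : X -> R[i]) (T : {linear L2 mu -> L2 mu}),
  0 < p -> hoelder_fun b f -> commutator_cl Delta f T ->
  (schatten_norm ip p T <= 1)%E ->
  forall x y : X, cmod (f x - f y) <= C * mdist x y `^ (2 * a).
Proof.
have [C C0 CP] := oscillation_step.
exists (2 * C); first by rewrite mulr_gt0.
move=> p f T p0 [K fK] fT T1.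
pose L := `|K| + 1; have L0 : 0 < L by rewrite ltr_wpDl.
have fL x y : cmod (f x - f y) <= L * mdist x y `^ b.
  apply: le_trans (fK x y) _; rewrite ler_wpM2r ?powR_ge0//.
  by rewrite ler_wpDr// ler_norm.
have [M M0 MP] := hoelder_schur X_compact df_gt0 mu_regular a_gt0 b_gt.
have kA := MP f L L0 fL.
have k1 u : ip_norm ip (kernel_op (comm_kernel df a f) u) <= ip_norm ip u.
  rewrite -(hoelder_commutator_clE X_compact df_gt0 mu_regular a_gt0 b_gt
    Delta_a L0 fL fT).
  exact: contraction_of_schatten p0 L0 fL fT T1 u.
have [D D0 XD] := dist_bounded X_compact.
pose S := [set cmod (f z.1 - f z.2) / mdist z.1 z.2 `^ (2 * a) | z
  in [set: X * X]].
have Sub w : (forall x y, cmod (f x - f y) <= w * mdist x y `^ (2 * a)) ->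
    0 <= w -> ubound S w.
  move=> fw w0 _ [[x y] _ <-] /=.
  have [->|xy] := eqVneq x y; first by rewrite subrr cmod0 mul0r.
  by rewrite ler_pdivrMr// powR_gt0// mdist_gt0.
have Sn : S !=set0 by exists
  (cmod (f point - f point) / mdist (point : X) point `^ (2 * a));
    exists (point, point).
have bS : has_ubound S.
  exists (L * D `^ (b - 2 * a)); apply: Sub;
    last by rewrite mulr_ge0 ?powR_ge0 ?ltW.
  move=> x y; apply: le_trans (fL x y) _.
  rewrite -mulrA ler_wpM2l ?(ltW L0)//.
  have [->|xy] := eqVneq x y.
    by rewrite mdistxx powR0 ?gt_eqF// mulr_ge0 ?powR_ge0.
  have xy0 : 0 < mdist x y by rewrite mdist_gt0.
  rewrite -[b in leLHS](subrK (2 * a)) (powRD_gt0 _ _ xy0).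
  rewrite ler_wpM2r ?powR_ge0//; apply: powR_homo; rewrite ?mdist_ge0//.
  by rewrite subr_ge0 ltW.
have fS x y : cmod (f x - f y) <= sup S * mdist x y `^ (2 * a).
  have [->|xy] := eqVneq x y.
    by rewrite subrr cmod0 mdistxx powR0 ?gt_eqF// mulr0.
  rewrite -ler_pdivrMr ?powR_gt0 ?mdist_gt0//.
  by apply: (ub_le_sup bS); exists (x, y).
have S0 : 0 <= sup S.
  apply: le_trans (ub_le_sup bS (_ : S 0)) => //; exists (point, point) => //=.
  by rewrite subrr cmod0 mul0r.
have S2 : sup S <= C + sup S / 2.
  apply: ge_sup => //; apply: Sub; last by rewrite addr_ge0 ?divr_ge0 ?(ltW C0).
  exact: CP kA k1 fS.
move=> x y; apply: le_trans (fS x y) _; rewrite ler_wpM2r ?powR_ge0//.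
by move: (sup S) S2 => w; lra.
Qed.

End Oscillation.

(** * The weak-* topology *)

Section ProbabilityIntegral.
Context (R : realType) (X : pmetricType R).
Variable phi : probability (borel X) R.

Let Rintegral_const (r : R) : Rintegral phi setT (fun=> r) = r.
Proof.
rewrite Rintegral_cst// [X in _ * X](_ : _ = 1) ?mulr1//.
exact: (congr1 fine (probability_setT phi)).
Qed.

Lemma bounded_cintegrable (f : borel X -> R[i]) (M : R) : cmeasurable f ->
  (forall x, cmod (f x) <= M) -> cintegrable phi f.
Proof.
move=> mf fM; apply: (@cintegrable_le _ _ _ _ _ (fun=> M)) => //.
exact: finite_measure_integrable_cst.
Qed.

Lemma cintegral_cst (c : R[i]) : cintegral phi setT (fun=> c) = c.
Proof. by apply: complex_eqP; exact: Rintegral_const. Qed.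

Lemma cmod_cintegral_bound (f : borel X -> R[i]) (M : R) : cmeasurable f ->
  (forall x, cmod (f x) <= M) -> cmod (cintegral phi setT f) <= M.
Proof.
move=> mf fM; have fi := bounded_cintegrable mf fM.
apply: le_trans (cmod_cintegral_le fi) _.
rewrite -[leRHS]Rintegral_const.
apply: le_Rintegral => //; first exact: integrable_cmod.
exact: finite_measure_integrable_cst.
Qed.

End ProbabilityIntegral.

Section PartitionOfUnity.
Context (R : realType) (X : pmetricType R).
Hypothesis X_compact : compact [set: X].

Lemma compact_uniform_continuity (f : X -> R[i]) (e : R) : 0 < e ->
  (forall x e, 0 < e -> exists2 r, 0 < r &
    forall y, mdist x y < r -> cmod (f x - f y) <= e) ->
  exists2 r : R, 0 < r &
    forall x y, mdist x y < r -> cmod (f x - f y) <= e.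
Proof.
move=> e0 fc; have := X_compact; rewrite compact_near_coveringP.
move=> /(_ R (0^'+)%classic
  (fun r x => forall y, mdist x y < r -> cmod (f x - f y) <= e) _) h.
have {}h : \forall r \near 0^'+, [set: X] `<=`
    (fun x => forall y, mdist x y < r -> cmod (f x - f y) <= e).
  apply: h => x _; have [r r0 fr] := fc x (e / 2) (divr_gt0 e0 (ltr0Sn R 1)).
  exists (ball x (r / 2), `]0, r / 2[%classic) => /=.
    split; first by apply: nbhsx_ballx; rewrite divr_gt0.
    near=> d; rewrite /= in_itv/=; apply/andP; split; near: d.
      exact: nbhs_right_gt.
    by apply: nbhs_right_lt; rewrite divr_gt0.
  move=> [x' d] /= [xx']; rewrite in_itv/= => /andP[d0 dr] y x'y.
  have x'x : mdist x x' < r / 2 by move: xx'; rewrite ballEmdist.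
  have -> : f x' - f y = (f x' - f x) + (f x - f y) by ring.
  apply: le_trans (cmodD _ _) _; rewrite [e]splitr (cmodB (f x')); apply: lerD.
    by apply: fr; rewrite (lt_trans x'x)// ltr_pdivrMr// ltr_pMr// ltr1n.
  apply: fr; apply: le_lt_trans (metric_triangle _ x' _) _.
  by rewrite [r]splitr ltrD// (lt_trans x'y).
near (0 : R)^'+ => r.
exists r; first by near: r; exact: nbhs_right_gt.
by move=> x; have : [set: X] x by []; move: x; near: r; exact: h.
Unshelve. all: by end_near. Qed.

Lemma lipschitz_partition (r : R) : 0 < r ->
  exists (n : nat) (c : 'I_n -> X) (h : 'I_n -> X -> R) (L : R),
    [/\ 0 < L, forall i x, 0 <= h i x, forall x, \sum_i h i x = 1,
        forall i x, 2 * r <= mdist (c i) x -> h i x = 0 &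
        forall i x y, `|h i x - h i y| <= L * mdist x y].
Proof.
move=> r0; have [l lP] := finite_net X_compact r0.
pose n := size l; pose c (i : 'I_n) := nth (point : X) l i.
pose g i x := Num.max 0 (2 * r - mdist (c i) x).
have g0 i x : 0 <= g i x by rewrite /g le_max lexx.
have g1 i x y : `|g i x - g i y| <= mdist x y.
  have := mdist_lip x y (c i);
    rewrite (metric_sym x (c i)) (metric_sym y (c i)).
  rewrite /g; move: (mdist x y) (mdist (c i) x) (mdist (c i) y) => d u v.
  rewrite !ler_norml => /andP[h1 h2].
  by rewrite !maxEle; case: ifPn; case: ifPn; rewrite -?ltNge => ? ?;
    apply/andP; split; lra.
pose G x := \sum_i g i x.
have Gr x : r <= G x.
  have [z zl xz] := lP x.
  have zn : (index z l < n)%N by rewrite index_mem.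
  rewrite /G (bigD1 (Ordinal zn))//= ler_wpDr ?sumr_ge0//.
  rewrite /g le_max; apply/orP; right.
  by rewrite /c/= nth_index// metric_sym; lra.
have G0 x : 0 < G x := lt_le_trans r0 (Gr x).
have gG i x : g i x <= G x.
  by rewrite /G (bigD1 i)//= lerDl sumr_ge0.
have GL x y : `|G x - G y| <= n%:R * mdist x y.
  rewrite /G -sumrB; apply: le_trans (ler_norm_sum _ _ _) _.
  rewrite -[n in n%:R]card_ord -sum1_card natr_sum mulr_suml.
  by apply: ler_sum => i _; rewrite mul1r.
exists n, c, (fun i x => g i x / G x), ((n%:R + 1) / r); split.
- by rewrite divr_gt0// ltr_wpDl.
- by move=> i x; rewrite divr_ge0// ltW.
- by move=> x; rewrite -mulr_suml -/(G x) divff// gt_eqF.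
- by move=> i x cx; rewrite /g max_l ?mul0r// subr_le0.
move=> i x y.
have -> : g i x / G x - g i y / G y =
    (g i x - g i y) / G x + g i y / G y * ((G y - G x) / G x).
  by field; rewrite !gt_eqF.
have q1 : g i y / G y <= 1 by rewrite ler_pdivrMr// mul1r.
have q0 : 0 <= g i y / G y by rewrite divr_ge0// ltW.
apply: le_trans (ler_normD _ _) _.
move: (g i y / G y) q0 q1 => q q0 q1.
rewrite !normrM (ger0_norm q0) [`|(G x)^-1|]ger0_norm ?invr_ge0 ?(ltW (G0 x))//.
have Gi : (G x)^-1 <= r^-1 by rewrite lef_pV2 ?posrE.
apply: (@le_trans _ _ (mdist x y / r + 1 * (n%:R * mdist x y / r))).
  apply: lerD; first by apply: ler_pM => //; rewrite invr_ge0 ltW.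
  apply: ler_pM => //; first by rewrite mulr_ge0// invr_ge0 ltW.
  by apply: ler_pM => //; [rewrite invr_ge0 ltW|rewrite distrC].
by rewrite le_eqVlt; apply/orP; left; apply/eqP; field; rewrite gt_eqF.
Qed.

Lemma lipschitz_cmeasurable (h : X -> R) (L : R) : 0 < L ->
  (forall x y, `|h x - h y| <= L * mdist x y) ->
  cmeasurable (fun x : borel X => (h x)%:C%C).
Proof.
move=> L0 hL; apply: cmeasurable_real; apply: continuous_borel.
apply: near_continuous => x e e0; exists (e / L); first by rewrite divr_gt0.
move=> y /ltW xy; apply: le_trans (hL x y) _.
by rewrite mulrC -ler_pdivlMr.
Qed.

Lemma partition_approx n (c : 'I_n -> X) (h : 'I_n -> X -> R) (L M r e : R)
    (f : borel X -> R[i]) (phi : probability (borel X) R) : 0 < L -> 0 <= e ->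
  (forall i x, 0 <= h i x) -> (forall x, \sum_i h i x = 1) ->
  (forall i x, 2 * r <= mdist (c i) x -> h i x = 0) ->
  (forall i x y, `|h i x - h i y| <= L * mdist x y) ->
  cmeasurable f -> (forall x, cmod (f x) <= M) ->
  (forall x y : X, mdist x y < 2 * r -> cmod (f x - f y) <= e) ->
  cmod (cintegral phi setT f -
    \sum_i f (c i) * cintegral phi setT (fun x => (h i x)%:C%C)) <= e.
Proof.
move=> L0 e0 h0 h1 hr hL mf fM fe.
have mh i : cmeasurable (fun x : borel X => (h i x)%:C%C).
  exact: lipschitz_cmeasurable L0 (hL i).
have ch i : cintegrable phi (fun x : borel X => (h i x)%:C%C).
  apply: (@bounded_cintegrable _ _ _ _ 1) => // x.
  by rewrite cmodC ger0_norm// -(h1 x) (bigD1 i)//= lerDl sumr_ge0.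
have cs : cintegrable phi (fun x : borel X => \sum_i f (c i) * (h i x)%:C%C).
  by apply: cintegrable_sum => i; exact: cintegrableZ.
have cf := bounded_cintegrable phi mf fM.
have -> : \sum_i f (c i) * cintegral phi setT (fun x => (h i x)%:C%C) =
    cintegral phi setT (fun x => \sum_i f (c i) * (h i x)%:C%C).
  rewrite cintegral_sum; last by move=> i; exact: cintegrableZ.
  by apply: eq_bigr => i _; rewrite cintegralZ.
rewrite -cintegralB//; apply: cmod_cintegral_bound.
  exact: cmeasurableB mf (cintegrable_measurable cs).
move=> x.
have -> : f x - \sum_i f (c i) * (h i x)%:C%C =
    \sum_i (h i x)%:C%C * (f x - f (c i)).
  have h1C : \sum_i (h i x)%:C%C = 1 by rewrite -rmorph_sum/= h1.
  rewrite -[X in X - _]mul1r -h1C mulr_suml -sumrB; apply: eq_bigr => i _.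
  by rewrite mulrBr [f (c i) * _]mulrC.
apply: le_trans (cmod_sum _) _.
rewrite -[leRHS]mul1r -(h1 x) mulr_suml; apply: ler_sum => i _.
rewrite cmodM cmodC ger0_norm//.
have [/hr->|cx] := leP (2 * r) (mdist (c i) x); first by rewrite !mul0r.
by rewrite ler_wpM2l// fe// metric_sym.
Qed.

End PartitionOfUnity.

Section PointwiseTopology.
Context (R : realType) (U : eqType) (S : choiceType).
Variable ev : S -> {ptws U -> R[i]^o}.

Lemma complex_gt0 (e : R[i]) : 0 < e -> exists2 r : R, 0 < r & e = r%:C%C.
Proof.
rewrite ltcE => /andP[/eqP ei er]; exists (complex.Re e) => //.
exact: complex_eqP.
Qed.

Lemma ptws_cvgP (G : set_system {ptws U -> R[i]^o})
    (f : {ptws U -> R[i]^o}) : Filter G ->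
  G --> f <-> forall t, (fun g => g t) @ G --> f t.
Proof.
move=> GG; split=> [Gf t|Gf].
  exact: (cvg_comp _ _ Gf (@proj_continuous U (fun=> R[i]^o) t f)).
rewrite cvg_sup => t; rewrite cvg_image; last first.
  by rewrite eqEsubset; split=> v // _; exists (cst v).
move=> W /= /Gf GW; exists (@^~ t @^-1` W) => //.
by rewrite eqEsubset; split=> [v [g + <-]//|v Wv]; exists (cst v).
Qed.

Lemma initial_ptws_nbhs (s : initial_topology ev) (u : U) (e : R) : 0 < e ->
  nbhs s (fun s' : initial_topology ev => cmod (ev s u - ev s' u) < e).
Proof.
move=> e0; have e0C : (0 : R[i]) < e%:C%C by rewrite ltcR.
have h1 : (fun g => g u) @ nbhs (ev s) --> ev s u.
  by apply: (ptws_cvgP _ _).1.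
have h2 := h1 _ (nbhsx_ballx (ev s u : R[i]^o) _ e0C).
rewrite nbhs_filterE fmapE in h2.
have h3 := @initial_continuous _ _ ev s _ h2.
rewrite nbhs_filterE fmapE in h3.
apply: (filterS _ h3) => s'.
by rewrite /= -ball_normE /= -[`|_|]/((cmod (ev s u - ev s' u))%:C%C) ltcR.
Qed.

Lemma initial_ptws_cvg (G : set_system S) (s : S) (V : set {ptws U -> R[i]^o}) :
  Filter G -> (forall u (e : R), 0 < e ->
    G (fun s' => cmod (ev s u - ev s' u) < e)) ->
  open V -> V (ev s) -> G (ev @^-1` V).
Proof.
move=> GG Gs oV Vs; have : ev @ G --> ev s.
  apply/ptws_cvgP => u; apply/cvgrPdist_lt => _ /complex_gt0[e e0 ->].
  rewrite !near_simpl.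
  apply: (filterS _ (Gs u e e0)) => s'.
  by rewrite -[`|_|]/((cmod (ev s u - ev s' u))%:C%C) ltcR.
by apply; exact: open_nbhs_nbhs.
Qed.

End PointwiseTopology.

Section ProbabilityMetric.
Context (R : realType) (X : pmetricType R).
Hypothesis X_compact : compact [set: X].
Variables (b q c C : R) (F : set (borel X -> R[i])).
Hypothesis b_gt0 : 0 < b.
Hypothesis b_le1 : b <= 1.
Hypothesis q_gt0 : 0 < q.
Hypothesis c_gt0 : 0 < c.
Hypothesis F_small : forall f : X -> R[i],
  (forall x y : X, cmod (f x - f y) <= c * mdist x y `^ b) -> F f.
Hypothesis F_equi : forall f, F f -> forall x y : X,
  cmod (f x - f y) <= C * mdist x y `^ q.

Implicit Types phi psi : probability (borel X) R.

Definition test_dist phi psi : \bar R :=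
  ereal_sup [set (cmod (cintegral phi setT f - cintegral psi setT f))%:E
            | f in F].

Lemma test_dist_ub phi psi f : F f ->
  ((cmod (cintegral phi setT f - cintegral psi setT f))%:E <=
    test_dist phi psi)%E.
Proof. by move=> Ff; apply: ereal_sup_ubound; exists f. Qed.

Lemma test_dist_le phi psi (M : \bar R) :
  (forall f, F f ->
    ((cmod (cintegral phi setT f - cintegral psi setT f))%:E <= M)%E) ->
  (test_dist phi psi <= M)%E.
Proof. by move=> FM; apply: ge_ereal_sup => _ [f Ff <-]; exact: FM. Qed.

Lemma test_dist_ge0 phi psi : (0 <= test_dist phi psi)%E.
Proof.
apply: le_trans (test_dist_ub phi psi (_ : F (fun=> 0))).
  by rewrite lee_fin cmod_ge0.
by apply: F_small => x y; rewrite subrr cmod0 mulr_ge0 ?powR_ge0 ?ltW.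
Qed.

Lemma test_measurable f : F f -> cmeasurable f.
Proof. by move=> /F_equi fC; exact: (hoelder_cmeasurable q_gt0 fC). Qed.

Lemma test_center (f : borel X -> R[i]) : F f -> exists2 g : borel X -> R[i],
  [/\ cmeasurable g, forall x y, g x - g y = f x - f y & g point = 0] &
  forall phi psi, cintegral phi setT f - cintegral psi setT f =
    cintegral phi setT g - cintegral psi setT g.
Proof.
move=> Ff; have mf := test_measurable Ff.
have [M fM] := hoelder_bounded X_compact q_gt0 (F_equi Ff).
exists (fun x => f x - f point).
  split=> [|x y|]; last exact: subrr.
    by apply: cmeasurableB => //; exact: cmeasurable_cst.
  by ring.
move=> phi psi; have fi phi' := bounded_cintegrable phi' mf fM.
have ki phi' : cintegrable phi' (fun=> f point).
  exact: (@bounded_cintegrable _ _ _ _ (cmod (f point))).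
by rewrite !cintegralB// !cintegral_cst; ring.
Qed.

Lemma test_dist_bounded : exists M : R, forall phi psi,
  (test_dist phi psi <= M%:E)%E.
Proof.
have [D D0 XD] := dist_bounded X_compact.
exists (2 * (`|C| * D `^ q)) => phi psi; apply: test_dist_le => f Ff.
have [g [mg gf g0] ->] := test_center Ff.
have gM x : cmod (g x) <= `|C| * D `^ q.
  rewrite -[g x]subr0 -g0 gf; apply: le_trans (F_equi Ff _ _) _.
  apply: (@le_trans _ _ (`|C| * mdist (x : X) point `^ q)).
    by rewrite ler_wpM2r ?powR_ge0// ler_norm.
  by rewrite ler_wpM2l//; apply: powR_homo; rewrite ?mdist_ge0 ?(ltW q_gt0).
rewrite lee_fin; apply: le_trans (cmodD _ _) _; rewrite cmodN.
have := cmod_cintegral_bound phi mg gM; have := cmod_cintegral_bound psi mg gM.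
by lra.
Qed.

Lemma test_dist_fin_num phi psi : test_dist phi psi \is a fin_num.
Proof.
have [M MP] := test_dist_bounded.
by rewrite ge0_fin_numE ?test_dist_ge0// (le_lt_trans (MP _ _))// ltry.
Qed.

Lemma test_dist_sym phi psi : test_dist phi psi = test_dist psi phi.
Proof.
rewrite /test_dist; congr ereal_sup; apply/seteqP.
by split=> _ [f Ff <-]; exists f => //; rewrite cmodB.
Qed.

Lemma test_dist_triangle phi psi chi :
  (test_dist phi chi <= test_dist phi psi + test_dist psi chi)%E.
Proof.
apply: test_dist_le => f Ff.
apply: le_trans (leeD (test_dist_ub phi psi Ff) (test_dist_ub psi chi Ff)).
rewrite -EFinD lee_fin; apply: le_trans (cmodD _ _).
by rewrite addrA subrK.
Qed.

Lemma test_dist_lipschitz (L : R) : 0 < L -> exists2 A : R, 0 < A &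
  forall h : borel X -> R[i],
  (forall x y : X, cmod (h x - h y) <= L * mdist x y) -> forall phi psi,
  ((cmod (cintegral phi setT h - cintegral psi setT h))%:E <=
    A%:E * test_dist phi psi)%E.
Proof.
move=> L0; have [D D0 XD] := dist_bounded X_compact.
pose A := L * D `^ (1 - b) / c.
have A0 : 0 < A by rewrite divr_gt0// mulr_gt0// powR_gt0.
exists A => // h hL phi psi.
have hL1 (x y : X) : cmod (h x - h y) <= L * mdist x y `^ 1.
  by rewrite powRr1 ?mdist_ge0.
have mh : cmeasurable h := hoelder_cmeasurable ltr01 hL1.
have [M hM] := hoelder_bounded X_compact ltr01 hL1.
have hi phi' := bounded_cintegrable phi' mh hM.
have Fh : F (fun x => (A^-1)%:C%C * h x).
  apply: F_small => x y; rewrite -mulrBr cmodM cmodC ger0_norm ?invr_ge0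
    ?(ltW A0)//.
  rewrite mulrC ler_pdivrMr//; apply: le_trans (hL x y) _.
  have [->|xy] := eqVneq x y.
    by rewrite mdistxx mulr0 mulr_ge0 ?(ltW A0)// mulr_ge0 ?powR_ge0// ltW.
  have xy0 : 0 < mdist x y by rewrite mdist_gt0.
  have -> : c * mdist x y `^ b * A = L * (D `^ (1 - b) * mdist x y `^ b).
    by rewrite /A; field; rewrite gt_eqF.
  rewrite ler_wpM2l ?(ltW L0)//.
  rewrite -[leLHS](powRr1 (ltW xy0)) -[X in _ `^ X <= _](subrK b).
  rewrite (powRD_gt0 _ _ xy0) ler_wpM2r ?powR_ge0//.
  by apply: powR_homo; rewrite ?(ltW xy0)// subr_ge0.
have := test_dist_ub phi psi Fh.
rewrite !cintegralZ// -mulrBr cmodM cmodC ger0_norm ?invr_ge0 ?(ltW A0)//.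
by rewrite mulrC EFinM lee_pdivrMr// muleC.
Qed.

(* The functions [min 1 (n * dist(x, ~ U))] increase to the indicator of [U]. *)
Lemma open_lipschitz (U : set X) : open U -> ~` U !=set0 ->
  exists h : nat -> X -> R,
    [/\ forall n x, 0 <= h n x <= 1, forall n x, ~ U x -> h n x = 0,
        forall n x y, `|h n x - h n y| <= n.+1%:R * mdist x y,
        forall n m x, (n <= m)%N -> h n x = 1 -> h m x = 1 &
        forall x, U x -> exists n, h n x = 1].
Proof.
move=> oU [z Uz].
pose S x := [set mdist x y | y in ~` U].
have S0 x : S x !=set0 by exists (mdist x z); exists z.
have Slb x : lbound (S x) 0 by move=> _ [y _ <-]; exact: mdist_ge0.
have Sinf x : has_inf (S x) by split=> //; exists 0.
pose g x := inf (S x).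
have g0 x : 0 <= g x by exact: lb_le_inf.
have gle x y : ~ U y -> g x <= mdist x y.
  by move=> Uy; apply: ge_inf; [exists 0|exists y].
have g1 x y : g x <= mdist x y + g y.
  rewrite -lerBlDl; apply: lb_le_inf => // _ [w Uw <-].
  rewrite lerBlDl; apply: le_trans (gle x w Uw) _; exact: metric_triangle.
exists (fun n x => Num.min 1 (n.+1%:R * g x)); split.
- move=> n x; have : 0 <= n.+1%:R * g x by rewrite mulr_ge0.
  by move=> h; rewrite ge_min lexx/= andbT le_min ler01.
- move=> n x Ux; have -> : g x = 0.
    by apply: le_anti; rewrite g0 andbT -(mdistxx x); exact: gle.
  by rewrite mulr0 min_r.
- move=> n x y; have n0 : (0 : R) < n.+1%:R by rewrite ltr0n.
  have := g1 x y; have := g1 y x; rewrite (metric_sym y x) => h1 h2.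
  have {}h1 : n.+1%:R * g y <= n.+1%:R * mdist x y + n.+1%:R * g x.
    by rewrite -mulrDr ler_pM2l.
  have {}h2 : n.+1%:R * g x <= n.+1%:R * mdist x y + n.+1%:R * g y.
    by rewrite -mulrDr ler_pM2l.
  have : 0 <= n.+1%:R * mdist x y by rewrite mulr_ge0 ?mdist_ge0.
  move: (_ * mdist x y) (_ * g x) (_ * g y) h1 h2 => u v w h1 h2 u0.
  rewrite ler_norml !minEle; case: ifPn; case: ifPn; rewrite -?ltNge => ? ?;
    by apply/andP; split; lra.
- move=> n m x nm; have : n.+1%:R * g x <= m.+1%:R * g x.
    by rewrite ler_wpM2r// ler_nat ltnS.
  move: (n.+1%:R * g x) (m.+1%:R * g x) => u v uv.
  by rewrite !minEle; case: ifPn; case: ifPn; rewrite -?ltNge => ? ?; lra.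
move=> x Ux.
have gx : 0 < g x.
  have : nbhs x U by rewrite nbhsE; exists U.
  move=> /nbhs_ballP[r r0 rU]; apply: lt_le_trans r0 _.
  apply: lb_le_inf => // _ [y Uy <-]; rewrite leNgt; apply/negP => xy.
  by apply: Uy; apply: rU; rewrite ballEmdist.
exists (Num.trunc (g x)^-1); rewrite min_l// -ler_pdivrMr// mul1r.
have gV : 0 <= (g x)^-1 by rewrite invr_ge0 ltW.
by have /andP[_ /ltW] := truncn_itv gV.
Qed.

Lemma open_measure_le phi psi :
  (forall (h : X -> R) (L : R), 0 < L ->
    (forall x y, `|h x - h y| <= L * mdist x y) ->
    Rintegral phi setT h = Rintegral psi setT h) ->
  forall U : set X, open U -> (phi U <= psi U)%E.
Proof.
move=> hh U oU; have [nU|/set0P nU] := eqVneq (~` U) set0.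
  have -> : U = [set: borel X] by rewrite -[U]setCK nU setC0.
  by rewrite (probability_setT phi) (probability_setT psi).
have [h [h01 hU hL hmono hex]] := open_lipschitz oU nU.
have mU : measurable (U : set (borel X)) by exact: open_borel.
have mh n : measurable_fun [set: borel X] (h n : borel X -> R).
  apply: continuous_borel; apply: near_continuous => x e e0.
  exists (e / n.+1%:R); first by rewrite divr_gt0.
  move=> y /ltW xy; apply: le_trans (hL n x y) _.
  by rewrite mulrC -ler_pdivlMr.
pose G n : set (borel X) := [set x | h n x = 1].
have mG n : measurable (G n).
  rewrite -[G n]setTI.
  exact: (mh n measurableT [set 1] (measurable_set1 1)).
have GU : \bigcup_n G n = U.
  apply/seteqP; split=> [x [n _ hx]|x /hex[n hx]]; last by exists n.
  apply: contrapT => /(hU n) h0; move: hx; rewrite /G/= h0 => /eqP.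
  by rewrite eq_sym oner_eq0.
have ih (m : probability (borel X) R) n : m.-integrable setT (EFin \o h n).
  have im := finite_measure_integrable_cst m 1 measurableT.
  apply: (le_integrable measurableT _ _ im); first exact/measurable_EFinP.
  by move=> x _ /=; have /andP[h0 h1] := h01 n x; rewrite lee_fin !ger0_norm.
have i1 (m : probability (borel X) R) (A : set (borel X)) : measurable A ->
    m.-integrable setT (EFin \o (\1_A : _ -> R)) /\
    (Rintegral m setT (\1_A : _ -> R))%:E = m A.
  move=> mA; split; first exact: (integrable_indic m mA).
  rewrite /Rintegral integral_indic// setIT fineK//.
  exact: fin_num_measure.
have Gpsi n : (phi (G n) <= psi U)%E.
  rewrite -(i1 phi _ (mG n)).2 -(i1 psi _ mU).2 lee_fin.
  apply: (@le_trans _ _ (Rintegral phi setT (h n))).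
    apply: le_Rintegral; [by []|exact: (i1 phi _ (mG n)).1|exact: ih|].
    move=> x _; case: (boolP (x \in G n)) => [/set_mem->//|_].
    by have /andP[] := h01 n x.
  rewrite (hh _ _ _ (hL n))//; apply: le_Rintegral;
    [by []|exact: ih|exact: (i1 psi _ mU).1|].
  move=> x _; case: (boolP (x \in U)) => [_|/negP xU].
    by have /andP[] := h01 n x.
  by rewrite hU// => /mem_set.
have := @nondecreasing_cvg_mu _ _ _ phi G mG.
rewrite GU => /(_ mU) cG.
have {}cG : (phi \o G) x @[x --> \oo] --> phi U.
  by apply: cG => n m nm; apply/subsetPset => x; exact: hmono.
rewrite -(cvg_lim _ cG)//; apply: lime_le; first by apply/cvg_ex;
  exists (phi U).
by near=> n; exact: Gpsi.
Unshelve. all: by end_near. Qed.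

Lemma test_dist_eq0 phi psi : test_dist phi psi = 0%E <->
  (forall A, measurable A -> phi A = psi A).
Proof.
split=> [d0|eqm]; last first.
  apply: le_anti; rewrite test_dist_ge0 andbT; apply: test_dist_le => f _.
  rewrite lee_fin [X in cmod X](_ : _ = 0) ?cmod0//; apply/eqP.
  rewrite subr_eq0; apply/eqP; apply: complex_eqP; congr fine;
    by apply: eq_measure_integral => A mA _; exact: eqm.
have hh (h : X -> R) (L : R) : 0 < L ->
    (forall x y, `|h x - h y| <= L * mdist x y) ->
    Rintegral phi setT h = Rintegral psi setT h.
  move=> L0 hL; have [A A0 AP] := test_dist_lipschitz L0.
  have := AP (fun x => (h x)%:C%C) _ phi psi; rewrite d0 mule0 lee_fin => h0.
  have {}h0 : cmod (cintegral phi setT (fun x => (h x)%:C%C) -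
      cintegral psi setT (fun x => (h x)%:C%C)) = 0.
    apply: le_anti; rewrite cmod_ge0 andbT; apply: h0 => x y.
    by rewrite -rmorphB cmodC.
  by move: h0 => /cmod_eq0/eqP;
    rewrite subr_eq0 => /eqP/(congr1 (@complex.Re R)).
apply: (@measure_unique _ R (borel X) (@open X) (fun=> setT)).
- by [].
- exact: openI.
- by move=> _; exact: openT.
- by rewrite bigcup_const//; exists 0%N.
- move=> U oU; apply: le_anti; apply/andP; split.
    exact: open_measure_le hh U oU.
  by apply: open_measure_le oU => h L L0 hL; rewrite (hh h L).
- by move=> _; rewrite ltey_eq fin_num_measure.
Qed.

Lemma test_dist_is_metric : is_metric test_dist.
Proof.
split; [exact: test_dist_fin_num|exact: test_dist_eq0|exact: test_dist_sym|].
exact: test_dist_triangle.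
Qed.

Lemma continuous_modulus (g : X -> R[i]^o) : continuous g ->
  forall x e, 0 < e -> exists2 r, 0 < r &
    forall y, mdist x y < r -> cmod (g x - g y) <= e.
Proof.
move=> cg x e e0; have e0C : (0 : R[i]) < e%:C%C by rewrite ltcR.
have /cvgrPdist_lt/(_ _ e0C)/nbhs_ballP[r r0 rg] := cg x.
exists r => // y xy; have /rg : ball x r y by rewrite ballEmdist.
by rewrite -[`|_|]/((cmod (g x - g y))%:C%C) ltcR => /ltW.
Qed.

Let eval (phi : probability (borel X) R) :
    {ptws continuousType X (R[i]^o) -> R[i]^o} :=
  fun f : continuousType X (R[i]^o) => cintegral phi [set: borel X] f.

Lemma weak_star_nbhs (phi : weak_star X) (g : continuousType X (R[i]^o))
  (e : R) :
  0 < e -> nbhs phi (fun psi : weak_star X =>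
    cmod (cintegral (phi : probability _ _) setT g -
      cintegral (psi : probability _ _) setT g) < e).
Proof. exact: (initial_ptws_nbhs (ev := eval)). Qed.

Lemma test_dist_eval phi (g : continuousType X (R[i]^o)) (e : R) : 0 < e ->
  exists2 r : R, 0 < r & forall psi, (test_dist phi psi < r%:E)%E ->
    cmod (cintegral phi setT g - cintegral psi setT g) < e.
Proof.
move=> e0; have e40 : 0 < e / 4 by rewrite divr_gt0.
have gc := continuous_modulus (@cts_fun _ _ g).
have mg : cmeasurable (g : borel X -> R[i]) by exact: continuous_cmeasurable gc.
have [r r0 gr] := compact_uniform_continuity X_compact e40 gc.
have r20 : 0 < r / 2 by rewrite divr_gt0.
have [n [c' [h [L [L0 h0 h1 hr hL]]]]] := lipschitz_partition X_compact r20.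
rewrite mulrC divfK ?pnatr_eq0// in hr.
pose M := \sum_i cmod (g (c' i)).
have h_le1 i x : h i x <= 1.
  by rewrite -(h1 x) (bigD1 i)//= lerDl sumr_ge0.
have gM x : cmod (g x) <= e / 4 + M.
  have -> : g x = \sum_i (h i x)%:C%C * g x.
    by rewrite -mulr_suml -rmorph_sum/= h1 mul1r.
  apply: le_trans (cmod_sum _) _.
  apply: (@le_trans _ _ (\sum_i (h i x * (e / 4) + cmod (g (c' i))))).
    apply: ler_sum => i _; rewrite cmodM cmodC ger0_norm//.
    have [/hr->|cx] := leP r (mdist (c' i) x);
      first by rewrite !mul0r add0r cmod_ge0.
    have gx : cmod (g x) <= e / 4 + cmod (g (c' i)).
      rewrite -[g x](subrK (g (c' i))); apply: le_trans (cmodD _ _) _.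
      by rewrite lerD2r gr// metric_sym.
    apply: le_trans (ler_wpM2l (h0 i x) gx) _.
    by rewrite mulrDr lerD2l ler_piMl ?cmod_ge0.
  by rewrite big_split/= -mulr_suml h1 mul1r.
pose G (x : borel X) := \sum_i g (c' i) * (h i x)%:C%C.
have GL x y : cmod (G x - G y) <= (M * L + 1) * mdist (x : X) y.
  rewrite /G -sumrB; apply: le_trans (cmod_sum _) _.
  rewrite mulrDl mul1r -mulrA ler_wpDr ?mdist_ge0// mulr_suml.
  apply: ler_sum => i _; rewrite -mulrBr -rmorphB cmodM cmodC.
  by rewrite ler_wpM2l ?cmod_ge0.
have M0 : 0 <= M by rewrite sumr_ge0// => i _; exact: cmod_ge0.
have ML0 : 0 < M * L + 1 by rewrite ltr_wpDl// mulr_ge0// ltW.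
have [A A0 AP] := test_dist_lipschitz ML0.
have app (m : probability (borel X) R) :
    cmod (cintegral m setT g - cintegral m setT G) <= e / 4.
  have mh i : cmeasurable (fun x : borel X => (h i x)%:C%C).
    exact: lipschitz_cmeasurable L0 (hL i).
  have ch i : cintegrable m (fun x : borel X => (h i x)%:C%C).
    apply: (@bounded_cintegrable _ _ _ _ 1) => // x.
    by rewrite cmodC ger0_norm.
  have -> : cintegral m setT G =
      \sum_i g (c' i) * cintegral m setT (fun x => (h i x)%:C%C).
    rewrite /G cintegral_sum; last by move=> i; exact: cintegrableZ.
    by apply: eq_bigr => i _; rewrite cintegralZ.
  apply: (partition_approx (L := L) (r := r / 2) m L0 (ltW e40) h0 h1 _ hL mg
    gM).
    by move=> i x; rewrite mulrC divfK ?pnatr_eq0//; exact: hr.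
  by move=> x y; rewrite mulrC divfK ?pnatr_eq0//; exact: gr.
exists (e / 4 / A); first by rewrite divr_gt0.
move=> psi dpsi.
have h3 : cmod (cintegral phi setT G - cintegral psi setT G) <= e / 4.
  rewrite -lee_fin; apply: le_trans (AP G GL phi psi) _.
  rewrite -[e / 4 in leRHS](divfK (lt0r_neq0 A0)) EFinM muleC.
  by rewrite lee_wpmul2r ?lee_fin ?(ltW A0)// ltW.
have h4 := app phi; have h5 := app psi.
have -> : cintegral phi setT g - cintegral psi setT g =
  (cintegral phi setT g - cintegral phi setT G) +
  ((cintegral phi setT G - cintegral psi setT G) +
   (cintegral psi setT G - cintegral psi setT g)) by ring.
apply: le_lt_trans (cmodD _ _) _.
apply: (@le_lt_trans _ _ (e / 4 + (e / 4 + e / 4))); last by lra.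
apply: lerD => //; apply: le_trans (cmodD _ _) _.
by apply: lerD => //; rewrite cmodB.
Qed.

Lemma weak_star_test_dist (phi : weak_star X) (e : R) : 0 < e ->
  nbhs phi (fun psi : weak_star X => (test_dist phi psi < e%:E)%E).
Proof.
move=> e0; have e40 : 0 < e / 4 by rewrite divr_gt0.
have [D D0 XD] := dist_bounded X_compact.
pose r := (e / 8 / (`|C| + 1)) `^ q^-1 / 4.
have C10 : 0 < `|C| + 1 by rewrite ltr_wpDl.
have eC0 : 0 < e / 8 / (`|C| + 1) by rewrite !divr_gt0.
have r0 : 0 < r by rewrite divr_gt0// powR_gt0.
have Fr f x y : F f -> mdist (x : X) y < 2 * r -> cmod (f x - f y) <= e / 8.
  move=> Ff xy; apply: le_trans (F_equi Ff x y) _.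
  apply: (@le_trans _ _ ((`|C| + 1) * (e / 8 / (`|C| + 1)))); last first.
    by rewrite mulrC divfK// gt_eqF.
  apply: (@le_trans _ _ ((`|C| + 1) * mdist (x : X) y `^ q)).
    by rewrite ler_wpM2r ?powR_ge0// ler_wpDr// ler_norm.
  rewrite ler_wpM2l ?(ltW C10)//.
  have -> : e / 8 / (`|C| + 1) = ((e / 8 / (`|C| + 1)) `^ q^-1) `^ q.
    by rewrite -powRrM mulVf ?gt_eqF// powRr1// ltW.
  apply: powR_homo; rewrite ?mdist_ge0 ?(ltW q_gt0)//.
  apply: ltW (lt_le_trans xy _); rewrite /r mulrCA -[leRHS]mulr1.
  by rewrite ler_wpM2l ?powR_ge0//; lra.
have [n [c' [h [L [L0 h0 h1 hr hL]]]]] := lipschitz_partition X_compact r0.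
pose B := `|C| * D `^ q + 1.
have B0 : 0 < B by rewrite ltr_wpDl// mulr_ge0 ?powR_ge0.
pose d := e / 4 / (B * (n%:R + 1)).
have d0 : 0 < d by rewrite divr_gt0// mulr_gt0// ltr_wpDl.
have hc i : continuous (fun x : X => (h i x)%:C%C : R[i]^o).
  move=> x; apply/cvgrPdist_le => z /complex_gt0[z' z'0 ->].
  apply/nbhs_ballP; exists (z' / L); first by rewrite /= divr_gt0.
  move=> y; rewrite ballEmdist /= => /ltW xy.
  rewrite -[`|_|]/((cmod ((h i x)%:C%C - (h i y)%:C%C))%:C%C) lecR -rmorphB
    cmodC.
  apply: le_trans (hL i x y) _.
  by rewrite mulrC -ler_pdivlMr.
pose k i : continuousType X (R[i]^o) :=
  HB.pack (fun x : X => (h i x)%:C%C : R[i]^o)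
    (isContinuous.Build _ _ _ (hc i)).
have nk : nbhs phi (fun psi : weak_star X => forall i,
    cmod (cintegral (phi : probability _ _) setT (k i) -
      cintegral (psi : probability _ _) setT (k i)) < d).
  have nk i := weak_star_nbhs phi (k i) d0.
  exact: (filter_forall (nbhs_filter phi) nk).
apply: filterS nk => psi kd.
apply: (@le_lt_trans _ _ (e / 2)%:E); last by rewrite lte_fin; lra.
apply: test_dist_le => f Ff; have [g [mg gf g0] ->] := test_center Ff.
have gB x : cmod (g x) <= B.
  rewrite -[g x]subr0 -g0 gf; apply: le_trans (F_equi Ff _ _) _.
  apply: (@le_trans _ _ (`|C| * mdist (x : X) point `^ q)).
    by rewrite ler_wpM2r ?powR_ge0// ler_norm.
  rewrite ler_wpDr// ler_wpM2l//.
  by apply: powR_homo; rewrite ?mdist_ge0 ?(ltW q_gt0).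
have app (m : probability (borel X) R) : cmod (cintegral m setT g -
    \sum_i g (c' i) * cintegral m setT (k i)) <= e / 8.
  apply: (partition_approx m L0 _ h0 h1 hr hL mg gB);
    first by rewrite divr_ge0 ?ltW.
  by move=> x y xy; rewrite gf; exact: Fr.
have := app phi; have := app psi.
set s := \sum_i _; set s' := \sum_i _ => a1 a2.
have ss : cmod (s' - s) <= e / 4.
  rewrite /s /s' -sumrB; apply: le_trans (cmod_sum _) _.
  apply: (@le_trans _ _ (\sum_(i < n) B * d)).
    apply: ler_sum => i _; rewrite -mulrBr cmodM.
    by apply: ler_pM; rewrite ?cmod_ge0// ltW.
  have -> : \sum_(i < n) B * d = n%:R / (n%:R + 1) * (e / 4).
    rewrite sumr_const card_ord -[LHS]mulr_natl /d.
    by field; rewrite (gt_eqF B0) gt_eqF ?ltr_wpDl.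
  rewrite -[leRHS]mul1r ler_wpM2r ?(ltW e40)//.
  by rewrite ler_pdivrMr ?ltr_wpDl// mul1r lerDl.
rewrite lee_fin.
have -> : cintegral (phi : probability _ _) setT g - cintegral
  (psi : probability _ _) setT g =
  (cintegral (phi : probability _ _) setT g - s') + ((s' - s) +
    (s - cintegral (psi : probability _ _) setT g)) by ring.
apply: le_trans (cmodD _ _) _.
apply: (@le_trans _ _ (e / 8 + (e / 4 + e / 8))); last by lra.
apply: lerD => //; apply: le_trans (cmodD _ _) _.
by apply: lerD => //; rewrite cmodB.
Qed.

Lemma test_dist_generates : generates_weak_star test_dist.
Proof.
split; first exact: test_dist_is_metric.
move=> U; split=> [[V oV <-] phi Vphi|Ue]; last first.
  rewrite openE => phi /Ue[e e0 eU].
  by apply: filterS (weak_star_test_dist phi e0) => psi; exact: eU.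
pose Fphi : set_system (probability (borel X) R) :=
  filter_from [set e : R | 0 < e] (fun e psi => (test_dist phi psi < e%:E)%E).
have FF : Filter Fphi.
  apply: filter_from_filter; first by exists 1 => /=.
  move=> e e' /= e0 e'0; exists (Num.min e e') => /=;
    first by rewrite lt_min e0.
  move=> psi h; split; apply: (lt_le_trans h); rewrite lee_fin ge_min lexx//.
  by rewrite orbT.
have : Fphi (eval @^-1` V).
  apply: (initial_ptws_cvg (ev := eval) (s := phi)) => // g e e0.
  by have [r r0 rP] := test_dist_eval phi g e0; exists r.
by move=> [e e0 eV]; exists e.
Qed.

End ProbabilityMetric.

Lemma powR_subadditive (R : realType) (u v b : R) : 0 <= u -> 0 <= v ->
  0 < b -> b <= 1 -> (u + v) `^ b <= u `^ b + v `^ b.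
Proof.
move=> u0 v0 b0 b1; have [uv|uv] := leP (u + v) 0.
  have -> : u = 0 by lra.
  have -> : v = 0 by lra.
  by rewrite addr0 lerDl powR_ge0.
have key w : 0 <= w -> w <= u + v -> w / (u + v) * (u + v) `^ b <= w `^ b.
  move=> w0 wuv; have [->|wn0] := eqVneq w 0;
    first by rewrite mul0r mul0r powR_ge0.
  have {}w0 : 0 < w by rewrite lt_neqAle eq_sym wn0.
  have w1 : 0 < w / (u + v) <= 1 by rewrite divr_gt0//= ler_pdivrMr// mul1r.
  apply: (@le_trans _ _ ((w / (u + v)) `^ b * (u + v) `^ b)).
    by rewrite ler_wpM2r ?powR_ge0// ger1_powR.
  have wuv0 : 0 <= w / (u + v) by case/andP: w1 => /ltW.
  by rewrite -powRM ?(ltW uv)// divfK// gt_eqF.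
have := lerD (key u u0 _) (key v v0 _).
rewrite -mulrDl -mulrDl divff ?gt_eqF// mul1r; apply; lra.
Qed.

Lemma cintegral_dirac (R : realType) (X : pmetricType R) (x : borel X)
    (f : borel X -> R[i]) : cmeasurable f -> cintegral (dirac x) setT f = f x.
Proof.
move=> [mr mi]; apply: complex_eqP; rewrite /= /Rintegral integral_dirac//;
  try exact/measurable_EFinP; by rewrite diracE in_setT mul1e.
Qed.

Lemma critical_exponent_ge (R : realType) (df a b : R) :
  0 < df -> 0 < b -> 2 * a < b -> df / (b - 2 * a) <= critical_exponent df a b.
Proof.
move=> df0 b0 ab; have t0 : 0 < b - 2 * a by rewrite subr_gt0.
rewrite /critical_exponent -mulrA; case: ifP => _; first by rewrite mul1r.
have q0 : 0 <= df / (b - 2 * a) by rewrite divr_ge0 ?ltW.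
rewrite -[leLHS]mul1r ler_wpM2r// lerDr ler0z -(ceil0 R) le_ceil//.
by rewrite divr_ge0 ?ltW.
Qed.

Theorem theoremA (R : realType) (X : pmetricType R)
    (mu : {finite_measure set (borel X) -> \bar R}) (df : R)
    (X_compact : compact [set: X]) (df_gt0 : 0 < df)
    (mu_regular : ahlfors_regular mu df)
    (alpha beta : R) (alpha_gt0 : 0 < 2 * alpha)
    (alpha_lt_beta : 2 * alpha < beta) (beta_le1 : beta <= 1)
    (Delta : unbounded (L2 mu)) (Delta_alpha : frac_laplacian df alpha Delta) :
  let p0 := Num.max (critical_exponent df alpha beta) 1 in
  (forall p : R, p0 < p -> generates_weak_star (rho Delta beta p)) /\
  exists c C : R -> R,
    [/\ forall p : R, p0 < p -> 0 < c p /\ c p < C p,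
        forall p : R, p0 < p -> forall x y : X,
          ((c p * mdist x y `^ beta)%:E
             <= rho Delta beta p (dirac (x : borel X)) (dirac (y : borel X))
             <= (C p * mdist x y `^ (2 * alpha))%:E)%E,
        exists M : R, forall p : R, p0 < p -> `|c p| <= M &
        C p @[p --> +oo] --> +oo].
Proof.
move=> p0; have beta_gt0 : 0 < beta by exact: lt_trans alpha_lt_beta.
have [C0 C00 C0P] := oscillation_bound X_compact df_gt0 mu_regular alpha_gt0
  alpha_lt_beta beta_le1 Delta_alpha.
have p_gt0 p : p0 < p -> 0 < p.
  by apply: le_lt_trans; rewrite /p0 le_max ler01 orbT.
pose F p := [set f : borel X -> R[i] | hoelder_fun beta f /\
  exists2 K, commutator_cl Delta f K &
    (schatten_norm (@L2_ip _ _ _ mu) p K <= 1)%E].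
have F_equi p : p0 < p -> forall f, F p f -> forall x y : X,
    cmod (f x - f y) <= C0 * mdist x y `^ (2 * alpha).
  by move=> pp f [fL [K fK K1]]; exact: C0P (p_gt0 p pp) fL fK K1.
have /choice[c cP] : forall p, exists c : R, p0 < p -> 0 < c /\
    forall f : X -> R[i],
    (forall x y : X, cmod (f x - f y) <= c * mdist x y `^ beta) -> F p f.
  move=> p; have [pp|] := boolP (p0 < p); last by exists 0.
  have [] := hoelder_admissible X_compact df_gt0 mu_regular alpha_gt0
    alpha_lt_beta beta_le1 Delta_alpha (p := p).
    apply: le_lt_trans pp; rewrite /p0 le_max; apply/orP; left.
    exact: critical_exponent_ge.
  move=> c c0 cP; exists c => _; split=> // f fc; split; first by exists c.
  exact: cP.
split=> [p pp|].
  have [c0 F_small] := cP p pp.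
  exact: (test_dist_generates X_compact beta_le1 alpha_gt0 c0 F_small
    (F_equi p pp)).
exists (fun p => Num.min 1 (c p)), (fun p => C0 + 2 + `|p|); split.
- move=> p pp; have [c0 _] := cP p pp; split; first by rewrite lt_min ltr01.
  rewrite gt_min; apply/orP; left.
  by have := normr_ge0 p; lra.
- move=> p pp x y; have [c0 F_small] := cP p pp; apply/andP; split; last first.
    apply: test_dist_le => f Ff; have mf :=
      test_measurable alpha_gt0 (F_equi p pp) Ff.
    rewrite !cintegral_dirac// lee_fin;
      apply: le_trans (F_equi p pp f Ff x y) _.
    by rewrite ler_wpM2r ?powR_ge0//; have := normr_ge0 p; lra.
  pose f (z : borel X) : R[i] :=
    (Num.min 1 (c p) * mdist (z : X) y `^ beta)%:C%C.
  have m0 : 0 < Num.min 1 (c p) by rewrite lt_min ltr01.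
  have sub (z w : X) : mdist z y `^ beta <=
    mdist w y `^ beta + mdist z w `^ beta.
    apply: le_trans (powR_subadditive _ _ beta_gt0 beta_le1);
      rewrite ?mdist_ge0//.
    apply: powR_homo; rewrite ?mdist_ge0 ?(ltW beta_gt0)// addrC.
    exact: metric_triangle.
  have Ff : F p f.
    apply: F_small => z w; rewrite /f -rmorphB cmodC -mulrBr normrM gtr0_norm//.
    apply: ler_pM; rewrite ?(ltW m0)//; first by rewrite ge_min lexx orbT.
    have := sub z w; have := sub w z;
      rewrite (metric_sym w z) ler_norml => h1 h2.
    by apply/andP; split; lra.
  have mf := test_measurable alpha_gt0 (F_equi p pp) Ff.
  apply: le_trans (test_dist_ub _ _ Ff); rewrite !cintegral_dirac// lee_fin.
  rewrite /f mdistxx powR0 ?gt_eqF// mulr0 subr0 cmodC.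
  by rewrite ler_norm.
- exists 1 => p /cP[c0 _]; rewrite ger0_norm ?ge_min ?lexx//.
  by rewrite le_min ler01 ltW.
apply/cvgryPge => A; near=> p.
apply: (@le_trans _ _ p); first by near: p; apply: nbhs_pinfty_ge;
  exact: num_real.
by have := ler_norm p; lra.
Unshelve. all: by end_near. Qed.
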